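(* Let $f(q)=q+\sum_{n=2}^{+\infty}q^{n}a_{n}\in\mathcal{C}$ (with $a_n\in\mathbb{H}$). Then $|a_{n}|\leq n$ for all $n=2,3,\ldots$. Moreover, equality $|a_{n}|=n$ for a given $n\geq2$ holds if and only if $$f(q)=q(1-qu)^{-\ast2},\qquad\forall\, q\in\mathbb{B},$$ for some $u\in\partial\mathbb{B}$.
   Context: $\mathbb{H}$ denotes the quaternions, $\mathbb{B}=\{q\in\mathbb{H}:|q|<1\}$, $\mathbb{S}=\{q\in\mathbb{H}:q^2=-1\}$; for $I\in\mathbb{S}$, $\mathbb{C}_I=\mathbb{R}\oplus I\mathbb{R}$ and $\mathbb{B}_I=\mathbb{B}\cap\mathbb{C}_I$. A function $f:\mathbb{B}\to\mathbb{H}$ is (left) slice regular if for every $I\in\mathbb{S}$ the restriction $f_I=f|_{\mathbb{B}_I}$ has continuous partial derivatives and $\frac12\left(\frac{\partial}{\partial x}+I\frac{\partial}{\partial y}\right)f_I(x+yI)=0$ on $\mathbb{B}_I$; equivalently $f(q)=\sum_{n\ge0}q^na_n$ on $\mathbb{B}$ with $a_n\in\mathbb{H}$. Its slice derivative is $f'(x+yI)=\frac12\left(\frac{\partial}{\partial x}-I\frac{\partial}{\partial y}\right)f_I(x+yI)$, i.e. $f'(q)=\sum_{n\ge1}q^{n-1}na_n$. For slice regular $f=\sum q^na_n$, $g=\sum q^nb_n$ on $\mathbb{B}$: the regular product is $f\ast g(q)=\sum_n q^n\sum_{k=0}^n a_kb_{n-k}$; the regular conjugate is $f^c(q)=\sum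 q^n\overline{a_n}$; the symmetrization is $f^s=f\ast f^c$; the regular reciprocal is $f^{-\ast}(q)=f^s(q)^{-1}f^c(q)$ off the zero set of $f^s$. $(1-qu)^{-\ast2}$ denotes $(1-qu)^{-\ast}\ast(1-qu)^{-\ast}$, so that $q(1-qu)^{-\ast2}=\sum_{n\ge1}n\,q^nu^{n-1}$. $\mathcal{S}$ is the set of slice regular $h:\mathbb{B}\to\mathbb{H}$ whose zero set is $\mathcal{Z}_h=\{0\}$ and with $h'(0)=1$. The class of slice starlike functions $\mathcal{S}^{*}$ is the set of $h\in\mathcal{S}$ such that $\mathrm{Re}\big(h(q)^{-1}qh'(q)\big)>0$ for $q\in\mathbb{B}$. The class $\mathcal{C}$ of slice close-to-convex functions is the set of slice regular $f:\mathbb{B}\to\mathbb{H}$ for which there exists $h\in\mathcal{S}^{*}$ with $\mathrm{Re}\big(h(q)^{-1}qf'(q)\big)>0$ for $q\in\mathbb{B}$. (Products in these conditions are pointwise; at $q=0$ the expressions are understood as their limit values.) *)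

(* Defs.v *)
From Stdlib Require Import Reals Lra Lia ClassicalEpsilon.
From Coquelicot Require Import Coquelicot.
Open Scope R_scope.

Record quat : Type := mkQuat { q_re : R; q_i : R; q_j : R; q_k : R }.

Declare Scope quat_scope.
Delimit Scope quat_scope with quat.
Bind Scope quat_scope with quat.

Definition qreal (r : R) : quat := mkQuat r 0 0 0.

Definition qzero : quat := qreal 0.

Definition qone : quat := qreal 1.

Definition qadd (p q : quat) : quat :=
  mkQuat (q_re p + q_re q) (q_i p + q_i q) (q_j p + q_j q) (q_k p + q_k q).

Definition qopp (q : quat) : quat :=
  mkQuat (- q_re q) (- q_i q) (- q_j q) (- q_k q).

(* Hamilton's product, with i j = k. *)
Definition qmul (p q : quat) : quat :=
  mkQuat
    (q_re p * q_re q - q_i p * q_i q - q_j p * q_j q - q_k p * q_k q)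
    (q_re p * q_i q + q_i p * q_re q + q_j p * q_k q - q_k p * q_j q)
    (q_re p * q_j q - q_i p * q_k q + q_j p * q_re q + q_k p * q_i q)
    (q_re p * q_k q + q_i p * q_j q - q_j p * q_i q + q_k p * q_re q).

Definition qconj (q : quat) : quat :=
  mkQuat (q_re q) (- q_i q) (- q_j q) (- q_k q).

Definition qnorm2 (q : quat) : R :=
  q_re q ^ 2 + q_i q ^ 2 + q_j q ^ 2 + q_k q ^ 2.

Definition qnorm (q : quat) : R := sqrt (qnorm2 q).

(* Two-sided inverse of every nonzero quaternion; its value at 0 is junk. *)
Definition qinv (q : quat) : quat := qmul (qreal (/ qnorm2 q)) (qconj q).

Notation "0" := qzero : quat_scope.
Notation "1" := qone : quat_scope.
Notation "p + q" := (qadd p q) : quat_scope.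
Notation "- q" := (qopp q) : quat_scope.
Notation "p - q" := (qadd p (qopp q)) : quat_scope.
Notation "p * q" := (qmul p q) : quat_scope.
Notation "/ q" := (qinv q) : quat_scope.

Lemma quat_ext (p q : quat) :
  q_re p = q_re q -> q_i p = q_i q -> q_j p = q_j q -> q_k p = q_k q -> p = q.
Proof. destruct p, q; simpl; intros; subst; reflexivity. Qed.

Ltac quat_ring :=
  intros; apply quat_ext; unfold qzero, qone, qreal; simpl; ring.

Lemma qaddC (p q : quat) : (p + q)%quat = (q + p)%quat.
Proof. quat_ring. Qed.

Lemma qaddA (p q r : quat) : (p + (q + r))%quat = (p + q + r)%quat.
Proof. quat_ring. Qed.

Lemma qadd0 (p : quat) : (p + 0)%quat = p.
Proof. quat_ring. Qed.

Lemma qaddN (p : quat) : (p - p)%quat = 0%quat.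
Proof. quat_ring. Qed.

Lemma qmulA (p q r : quat) : (p * (q * r))%quat = (p * q * r)%quat.
Proof. quat_ring. Qed.

Lemma qmul1r (p : quat) : (p * 1)%quat = p.
Proof. quat_ring. Qed.

Lemma qmul1l (p : quat) : (1 * p)%quat = p.
Proof. quat_ring. Qed.

Lemma qmulDl (p q r : quat) : ((p + q) * r)%quat = (p * r + q * r)%quat.
Proof. quat_ring. Qed.

Lemma qmulDr (p q r : quat) : (p * (q + r))%quat = (p * q + p * r)%quat.
Proof. quat_ring. Qed.

Lemma qnorm2_ge0 (q : quat) : 0 <= qnorm2 q.
Proof. unfold qnorm2; nra. Qed.

Lemma qnorm0 : qnorm 0 = 0.
Proof.
unfold qnorm, qnorm2; simpl.
replace (_ + _) with 0 by ring; exact sqrt_0.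
Qed.

Lemma qnormN1 : qnorm (- (1))%quat = 1.
Proof.
unfold qnorm, qnorm2; simpl.
replace (_ + _) with 1 by ring; exact sqrt_1.
Qed.

Lemma qnormM (p q : quat) : qnorm (p * q) = qnorm p * qnorm q.
Proof.
unfold qnorm; rewrite <- sqrt_mult by apply qnorm2_ge0.
f_equal; unfold qnorm2; simpl; ring.
Qed.

Lemma qnormD (p q : quat) : qnorm (p + q) <= qnorm p + qnorm q.
Proof.
pose (s := q_re p * q_re q + q_i p * q_i q + q_j p * q_j q + q_k p * q_k q).
assert (Hs : s <= qnorm p * qnorm q).
{ unfold qnorm; rewrite <- sqrt_mult by apply qnorm2_ge0.
  apply Rle_trans with (Rabs s); [apply Rle_abs|].
  rewrite <- sqrt_Rsqr_abs; apply sqrt_le_1_alt.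
  replace (qnorm2 p * qnorm2 q) with (Rsqr s
    + (q_re p * q_i q - q_i p * q_re q) ^ 2
    + (q_re p * q_j q - q_j p * q_re q) ^ 2
    + (q_re p * q_k q - q_k p * q_re q) ^ 2
    + (q_i p * q_j q - q_j p * q_i q) ^ 2
    + (q_i p * q_k q - q_k p * q_i q) ^ 2
    + (q_j p * q_k q - q_k p * q_j q) ^ 2)
    by (unfold s, qnorm2, Rsqr; ring).
  repeat match goal with |- context [?x ^ 2] =>
    generalize (pow2_ge_0 x); generalize (x ^ 2); intros ? ? end; lra. }
assert (Hp : 0 <= qnorm p) by apply sqrt_pos.
assert (Hq : 0 <= qnorm q) by apply sqrt_pos.
unfold qnorm at 1; rewrite <- (sqrt_Rsqr (qnorm p + qnorm q)) by lra.
apply sqrt_le_1_alt.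
assert (Ep : qnorm p * qnorm p = qnorm2 p) by apply sqrt_sqrt, qnorm2_ge0.
assert (Eq : qnorm q * qnorm q = qnorm2 q) by apply sqrt_sqrt, qnorm2_ge0.
replace (qnorm2 (p + q)) with (qnorm2 p + qnorm2 q + 2 * s)
  by (unfold s, qnorm2; simpl; ring).
unfold Rsqr; nra.
Qed.

Lemma qnorm_eq0 (q : quat) : qnorm q = 0 -> q = 0%quat.
Proof.
intros H; apply sqrt_eq_0 in H; [|apply qnorm2_ge0].
unfold qnorm2 in H; apply quat_ext; simpl; nra.
Qed.

Definition quat_AbelianMonoid_mixin :=
  AbelianMonoid.Mixin quat qadd qzero qaddC qaddA qadd0.

Canonical quat_AbelianMonoid :=
  AbelianMonoid.Pack quat quat_AbelianMonoid_mixin quat.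

Definition quat_AbelianGroup_mixin :=
  AbelianGroup.Mixin quat_AbelianMonoid qopp qaddN.

Canonical quat_AbelianGroup :=
  AbelianGroup.Pack quat
    (AbelianGroup.Class _ quat_AbelianMonoid_mixin quat_AbelianGroup_mixin) quat.

Definition quat_Ring_mixin :=
  Ring.Mixin quat_AbelianGroup qmul qone qmulA qmul1r qmul1l qmulDl qmulDr.

Canonical quat_Ring :=
  Ring.Pack quat
    (Ring.Class _ (AbelianGroup.class quat_AbelianGroup) quat_Ring_mixin) quat.

Definition quat_AbsRing_mixin :=
  AbsRing.Mixin quat_Ring qnorm qnorm0 qnormN1 qnormD
    (fun p q => Req_le _ _ (qnormM p q)) qnorm_eq0.

Canonical quat_AbsRing :=
  AbsRing.Pack quat
    (AbsRing.Class _ (Ring.class quat_Ring) quat_AbsRing_mixin) quat.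

Canonical quat_UniformSpace :=
  UniformSpace.Pack quat (UniformSpace.class (AbsRing_UniformSpace quat_AbsRing)) quat.

Definition in_ball (q : quat) : Prop := qnorm q < 1.

Definition imag_unit (I : quat) : Prop := (I * I)%quat = (- (1))%quat.

Definition slice_point (I : quat) (x y : R) : quat :=
  (qreal x + qreal y * I)%quat.

Definition ex_qderive (phi : R -> quat) (t : R) : Prop :=
  ex_derive (fun s => q_re (phi s)) t /\ ex_derive (fun s => q_i (phi s)) t /\
  ex_derive (fun s => q_j (phi s)) t /\ ex_derive (fun s => q_k (phi s)) t.

Definition qDerive (phi : R -> quat) (t : R) : quat :=
  mkQuat (Derive (fun s => q_re (phi s)) t) (Derive (fun s => q_i (phi s)) t)
         (Derive (fun s => q_j (phi s)) t) (Derive (fun s => q_k (phi s)) t).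

Definition slice_dx (f : quat -> quat) (I : quat) (x y : R) : quat :=
  qDerive (fun s => f (slice_point I s y)) x.

Definition slice_dy (f : quat -> quat) (I : quat) (x y : R) : quat :=
  qDerive (fun t => f (slice_point I x t)) y.

(* Functions on the unit ball are total functions; only their values on
   the ball matter in what follows. *)
Definition slice_regular (f : quat -> quat) : Prop :=
  forall I, imag_unit I -> forall x y, in_ball (slice_point I x y) ->
    ex_qderive (fun s => f (slice_point I s y)) x /\
    ex_qderive (fun t => f (slice_point I x t)) y /\
    continuous (fun z : R * R => slice_dx f I (fst z) (snd z)) (x, y) /\
    continuous (fun z : R * R => slice_dy f I (fst z) (snd z)) (x, y) /\
    (qreal (1 / 2) * (slice_dx f I x y + I * slice_dy f I x y))%quat = 0%quat.

Definition vec_norm (q : quat) : R := sqrt (q_i q ^ 2 + q_j q ^ 2 + q_k q ^ 2).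

(* q = slice_point (slice_unit q) (q_re q) (vec_norm q).  A real q lies on
   every slice, and the choice of unit there is immaterial: for a slice regular
   f the Cauchy-Riemann equation makes the slice derivative equal to df/dx. *)
Definition slice_unit (q : quat) : quat :=
  if Req_EM_T (vec_norm q) 0 then mkQuat 0 1 0 0
  else mkQuat 0 (q_i q / vec_norm q) (q_j q / vec_norm q) (q_k q / vec_norm q).

Definition slice_derivative (f : quat -> quat) (q : quat) : quat :=
  let I := slice_unit q in
  let x := q_re q in
  let y := vec_norm q in
  (qreal (1 / 2) * (slice_dx f I x y - I * slice_dy f I x y))%quat.

(* In Coquelicot, is_pseries a q l says that the series of q^n * a_n, with the
   coefficients on the right, converges to l. *)
Definition is_qseries (a : nat -> quat) (q l : quat) : Prop :=
  is_pseries (V := AbsRing_NormedModule quat_AbsRing) a q l.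

Definition has_expansion (f : quat -> quat) (a : nat -> quat) : Prop :=
  forall q, in_ball q -> is_qseries a q (f q).

(* Unique, hence well determined, when f has an expansion on the ball. *)
Definition coefs (f : quat -> quat) : nat -> quat :=
  epsilon (inhabits (fun _ => 0%quat)) (has_expansion f).

Definition qseries (a : nat -> quat) (q : quat) : quat :=
  epsilon (inhabits 0%quat) (is_qseries a q).

Definition regular_mul (f g : quat -> quat) (q : quat) : quat :=
  qseries (fun n => sum_n (fun k => coefs f k * coefs g (n - k)%nat)%quat n) q.

Definition regular_conj (f : quat -> quat) (q : quat) : quat :=
  qseries (fun n => qconj (coefs f n)) q.

Definition symmetrization (f : quat -> quat) : quat -> quat :=
  regular_mul f (regular_conj f).

Definition regular_inv (f : quat -> quat) (q : quat) : quat :=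
  (/ symmetrization f q * regular_conj f q)%quat.

(* Re g > 0 on the ball, g being understood at 0 as its limit there. *)
Definition pos_re_on_ball (g : quat -> quat) : Prop :=
  (forall q, in_ball q -> q <> 0%quat -> 0 < q_re (g q)) /\
  exists l : quat, filterlim g (locally' (0%quat : quat)) (locally l) /\ 0 < q_re l.

Definition normalized_class (h : quat -> quat) : Prop :=
  slice_regular h /\
  (forall q, in_ball q -> (h q = 0%quat <-> q = 0%quat)) /\
  slice_derivative h 0 = 1%quat.

Definition slice_starlike (h : quat -> quat) : Prop :=
  normalized_class h /\
  pos_re_on_ball (fun q => / h q * q * slice_derivative h q)%quat.

Definition slice_close_to_convex (f : quat -> quat) : Prop :=
  slice_regular f /\
  exists h, slice_starlike h /\
    pos_re_on_ball (fun q => / h q * q * slice_derivative f q)%quat.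

(* Main.v *)
(** On every slice the Cauchy formula, proved by contracting a circle to a point, turns
    slice regularity into a power series.  Write [h(q) = q k(q)].  Then [P = k^-* * f'] is slice
    regular on the ball: the symmetrization of [k] has real coefficients and no zero, so that its
    reciprocal is again slice regular.  Moreover [k(q)^-1 f'(q) = P(k(q)^-1 q k(q))], and
    [q |-> k(q)^-1 q k(q)] maps each sphere [x + y S] onto itself, so [Re P > 0].  Caratheodory's
    lemma on the slice containing a given coefficient of [P] bounds the coefficients of [P] by 2.
    Taking [f = h] first gives [|h_n| <= n]; then [f' = k * P] gives [n |a_n| <= n^2].  In the case
    of equality [|p_1| = 2], the positive measure [Re P] concentrates at one point of the circle,
    whence [p_n = 2 u^n] for all [n >= 1]. *)

Require Import Defs.
From Stdlib Require Import Reals Lra Lia ClassicalEpsilon FunctionalExtensionality.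
From Coquelicot Require Import Coquelicot.
Open Scope R_scope.

(** * Quaternions, limits and series *)

(** The pointwise quotient k(q)^-1 f'(q) is in general not slice regular, so no coefficient lemma
    applies to it directly; the sphere-preserving map exchanges it for P, whose series is the one
    that enters the Cauchy product f' = k * P. Identities between coefficients of regular products
    are mostly checked on the real axis: real powers commute with every coefficient, so regular
    products become pointwise there, and values on a real interval determine the coefficients. The
    constant n^2 is n + 2 (1 + ... + (n - 1)). In the equality case no limit measure is built:
    concentration takes the form 1 - cos(n x) <= n^2 (1 - cos x), integrated over circles of radius
    r < 1 with r tending to 1. Equality for one n forces |p_1| = |v_1| = 2, where v is the sequence
    obtained from f = h, and strict convexity of the norm makes the two unimodular parameters agree.
    Limits, sums, derivatives and integrals of quaternions are reduced to real ones by pairing with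
    constants through [qdot]. *)

Definition qdot (c q : quat) : R :=
  q_re c * q_re q + q_i c * q_i q + q_j c * q_j q + q_k c * q_k q.

Ltac qdot_ring := intros; unfold qdot, qzero, qone, qreal, qnorm2; simpl; ring.

Lemma qdotD (c p q : quat) : qdot c (p + q)%quat = qdot c p + qdot c q.
Proof. qdot_ring. Qed.

Lemma qdotN (c q : quat) : qdot c (- q)%quat = - qdot c q.
Proof. qdot_ring. Qed.

Lemma qdot0 (c : quat) : qdot c 0%quat = 0.
Proof. qdot_ring. Qed.

(** The adjoint of multiplication by [p] is multiplication by [qconj p]. With its right-hand
    analogue this moves a constant factor onto the test vector, hence past any limit, sum or
    integral. *)
Lemma qdotMl (c p q : quat) : qdot c (p * q)%quat = qdot (qconj p * c)%quat q.
Proof. qdot_ring. Qed.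

Lemma qdotMr (c p q : quat) : qdot c (p * q)%quat = qdot (c * qconj q)%quat p.
Proof. qdot_ring. Qed.

Lemma qdotZ (c q : quat) (x : R) : qdot c (qreal x * q)%quat = x * qdot c q.
Proof. qdot_ring. Qed.

Lemma qdot_re (q : quat) : qdot 1 q = q_re q.
Proof. qdot_ring. Qed.

Lemma qdot_i (q : quat) : qdot (mkQuat 0 1 0 0) q = q_i q.
Proof. qdot_ring. Qed.

Lemma qdot_j (q : quat) : qdot (mkQuat 0 0 1 0) q = q_j q.
Proof. qdot_ring. Qed.

Lemma qdot_k (q : quat) : qdot (mkQuat 0 0 0 1) q = q_k q.
Proof. qdot_ring. Qed.

Lemma qdot_inj (p q : quat) : (forall c, qdot c p = qdot c q) -> p = q.
Proof.
intros H; apply quat_ext.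
- now rewrite <- !qdot_re.
- now rewrite <- !qdot_i.
- now rewrite <- !qdot_j.
- now rewrite <- !qdot_k.
Qed.

(* Equality of noncommutative polynomials without cancellation. *)
Ltac qdistr :=
  repeat (rewrite qmulDl || rewrite qmulDr);
  rewrite ?qmul1l, ?qmul1r, ?qmulA, ?qaddA; reflexivity.

Lemma qnorm_ge0 (q : quat) : 0 <= qnorm q.
Proof. apply sqrt_pos. Qed.

Lemma qnorm_sq (q : quat) : qnorm q * qnorm q = qnorm2 q.
Proof. apply sqrt_sqrt, qnorm2_ge0. Qed.

Lemma qnorm_eq (q : quat) (x : R) : 0 <= x -> qnorm2 q = x * x -> qnorm q = x.
Proof. intros Hx H; unfold qnorm; rewrite H; now apply sqrt_square. Qed.

Lemma qnorm_le (q : quat) (x : R) : 0 <= x -> qnorm2 q <= x * x -> qnorm q <= x.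
Proof.
intros Hx H; unfold qnorm; rewrite <- (sqrt_square x Hx).
now apply sqrt_le_1_alt.
Qed.

Lemma qnorm_conj (q : quat) : qnorm (qconj q) = qnorm q.
Proof. unfold qnorm; f_equal; unfold qnorm2; simpl; ring. Qed.

Lemma qnormN (q : quat) : qnorm (- q)%quat = qnorm q.
Proof. unfold qnorm; f_equal; unfold qnorm2; simpl; ring. Qed.

Lemma qnorm_real (x : R) : qnorm (qreal x) = Rabs x.
Proof.
unfold qnorm, qnorm2, qreal; simpl; rewrite <- sqrt_Rsqr_abs.
f_equal; unfold Rsqr; ring.
Qed.

Lemma qnorm_1 : qnorm 1 = 1.
Proof. unfold qone; rewrite qnorm_real; apply Rabs_R1. Qed.

Lemma qnorm_gt0 (q : quat) : q <> 0%quat -> 0 < qnorm q.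
Proof.
intros H; destruct (qnorm_ge0 q) as [H1|H1]; auto.
now destruct H; apply qnorm_eq0.
Qed.

Lemma qnorm2_gt0 (q : quat) : q <> 0%quat -> 0 < qnorm2 q.
Proof. intros H; apply qnorm_gt0 in H; rewrite <- qnorm_sq; nra. Qed.

Lemma q_re_le (q : quat) : Rabs (q_re q) <= qnorm q.
Proof.
rewrite <- sqrt_Rsqr_abs; apply sqrt_le_1_alt; unfold qnorm2, Rsqr; nra.
Qed.

(** Cauchy-Schwarz from multiplicativity of the norm: the pairing is the real part of
    [qconj c * q]. *)
Lemma qdot_le (c q : quat) : Rabs (qdot c q) <= qnorm c * qnorm q.
Proof.
rewrite <- (qnorm_conj c), <- qnormM.
replace (qdot c q) with (q_re (qconj c * q)%quat) by (unfold qdot; simpl; ring).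
apply q_re_le.
Qed.

Lemma qnorm_le_comp (q : quat) :
  qnorm q <= Rabs (q_re q) + Rabs (q_i q) + Rabs (q_j q) + Rabs (q_k q).
Proof.
assert (H := fun x => Rabs_pos x).
apply qnorm_le.
- generalize (H (q_re q)) (H (q_i q)) (H (q_j q)) (H (q_k q)); lra.
- unfold qnorm2; rewrite <- (pow2_abs (q_re q)), <- (pow2_abs (q_i q)),
    <- (pow2_abs (q_j q)), <- (pow2_abs (q_k q)).
  generalize (H (q_re q)) (H (q_i q)) (H (q_j q)) (H (q_k q)).
  generalize (Rabs (q_re q)) (Rabs (q_i q)) (Rabs (q_j q)) (Rabs (q_k q)).
  intros; assert (0 <= r * r0) by nra; assert (0 <= r * r1) by nra;
  assert (0 <= r * r2) by nra; assert (0 <= r0 * r1) by nra;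
  assert (0 <= r0 * r2) by nra; assert (0 <= r1 * r2) by nra; nra.
Qed.

Lemma qmulV (q : quat) : q <> 0%quat -> (q * / q)%quat = 1%quat.
Proof.
intros H; apply qnorm2_gt0 in H; unfold qnorm2 in H.
apply quat_ext; unfold qinv, qnorm2; simpl; field; lra.
Qed.

Lemma qmulVl (q : quat) : q <> 0%quat -> (/ q * q)%quat = 1%quat.
Proof.
intros H; apply qnorm2_gt0 in H; unfold qnorm2 in H.
apply quat_ext; unfold qinv, qnorm2; simpl; field; lra.
Qed.

Lemma q1_neq0 : 1%quat <> 0%quat.
Proof. intros H; apply (f_equal q_re) in H; simpl in H; lra. Qed.

Lemma qmul_eq0 (p q : quat) : (p * q)%quat = 0%quat -> p = 0%quat \/ q = 0%quat.
Proof.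
intros H; apply (f_equal qnorm) in H; rewrite qnormM, qnorm0 in H.
apply Rmult_integral in H as [H|H]; apply qnorm_eq0 in H; auto.
Qed.

Lemma qinv_unique (p q : quat) : (p * q)%quat = 1%quat -> (/ p)%quat = q.
Proof.
intros H; assert (Hp : p <> 0%quat).
{ intros ->; apply q1_neq0; rewrite <- H; quat_ring. }
rewrite <- (qmul1r (/ p)), <- H, qmulA, qmulVl, qmul1l; auto.
Qed.

Lemma qsub_eq0 (p q : quat) : (p - q)%quat = 0%quat -> p = q.
Proof.
intros H; rewrite <- (qadd0 p), <- (qaddN q), (qaddC q), qaddA, H; quat_ring.
Qed.

Lemma qconjM (p q : quat) : qconj (p * q) = (qconj q * qconj p)%quat.
Proof. quat_ring. Qed.

Lemma qconjK (q : quat) : qconj (qconj q) = q.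
Proof. quat_ring. Qed.

Lemma qrealC (x : R) (q : quat) : (qreal x * q)%quat = (q * qreal x)%quat.
Proof. quat_ring. Qed.

(** Cauchy-Schwarz gives one direction, with [qnorm c + 1] as a nonzero denominator; for the other,
    the four basis functionals are each controlled within [eps / 4]. *)
Lemma filterlim_qdot {T : Type} (F : (T -> Prop) -> Prop) {FF : Filter F}
  (phi : T -> quat) (l : quat) :
  filterlim phi F (locally l) <->
  forall c, filterlim (fun t => qdot c (phi t)) F (locally (qdot c l)).
Proof.
assert (Hb : forall (x y : quat) (e : posreal), ball x e y <-> qnorm (y - x)%quat < e)
  by (intros; reflexivity).
assert (Hr : forall (x y : R) (e : posreal), ball x e y <-> Rabs (y - x) < e)
  by (intros; reflexivity).
split.
- intros H c; apply filterlim_locally; intros eps.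
  assert (Hc := qnorm_ge0 c).
  assert (He : 0 < eps / (qnorm c + 1)) by (apply Rdiv_lt_0_compat; [apply eps|lra]).
  eapply filter_imp; [|apply (proj1 (filterlim_locally phi l) H (mkposreal _ He))].
  intros t Ht; apply Hb in Ht; simpl in Ht; apply Hr.
  replace (qdot c (phi t) - qdot c l) with (qdot c (phi t - l)%quat)
    by (rewrite qdotD, qdotN; ring).
  apply Rle_lt_trans with (1 := qdot_le _ _).
  assert (H0 := qnorm_ge0 (phi t - l)%quat).
  apply Rle_lt_trans with ((qnorm c + 1) * qnorm (phi t - l)%quat); [nra|].
  apply Rlt_le_trans with ((qnorm c + 1) * (eps / (qnorm c + 1))).
  + apply Rmult_lt_compat_l; [lra|exact Ht].
  + apply Req_le; field; lra.
- intros H; apply filterlim_locally; intros eps.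
  assert (He : 0 < eps / 4) by (destruct eps; simpl; lra).
  assert (H1 := fun c => proj1 (filterlim_locally _ _) (H c) (mkposreal _ He)).
  generalize (filter_and _ _ (filter_and _ _ (H1 1%quat) (H1 (mkQuat 0 1 0 0)))
    (filter_and _ _ (H1 (mkQuat 0 0 1 0)) (H1 (mkQuat 0 0 0 1)))).
  apply filter_imp; intros t [[A B] [C D]]; apply Hb.
  apply (proj1 (Hr _ _ _)) in A, B, C, D; simpl pos in A, B, C, D.
  rewrite !qdot_re in A; rewrite !qdot_i in B; rewrite !qdot_j in C; rewrite !qdot_k in D.
  apply Rle_lt_trans with (1 := qnorm_le_comp _); simpl.
  unfold Rminus in *; lra.
Qed.

Lemma continuous_qdot {U : UniformSpace} (phi : U -> quat) (x : U) :
  continuous phi x <-> forall c, continuous (fun t => qdot c (phi t)) x.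
Proof. apply filterlim_qdot; apply locally_filter. Qed.

Lemma continuous_qmul {U : UniformSpace} (phi psi : U -> quat) (x : U) :
  continuous phi x -> continuous psi x -> continuous (fun t => (phi t * psi t)%quat) x.
Proof. intros H1 H2; exact (continuous_mult (K := quat_AbsRing) phi psi x H1 H2). Qed.

Lemma continuous_qadd {U : UniformSpace} (phi psi : U -> quat) (x : U) :
  continuous phi x -> continuous psi x -> continuous (fun t => (phi t + psi t)%quat) x.
Proof.
intros H1 H2; apply continuous_qdot; intros c.
apply continuous_ext with (fun t => plus (qdot c (phi t)) (qdot c (psi t))).
{ intros t; now rewrite qdotD. }
apply (continuous_plus (V := R_NormedModule)); now apply continuous_qdot.
Qed.

Lemma continuous_qopp {U : UniformSpace} (phi : U -> quat) (x : U) :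
  continuous phi x -> continuous (fun t => (- phi t)%quat) x.
Proof.
intros H1; apply continuous_qdot; intros c.
apply continuous_ext with (fun t => opp (qdot c (phi t))).
{ intros t; now rewrite qdotN. }
apply (continuous_opp (V := R_NormedModule)); now apply continuous_qdot.
Qed.

Lemma continuous_Rmult {U : UniformSpace} (f g : U -> R) (x : U) :
  continuous f x -> continuous g x -> continuous (fun t => f t * g t) x.
Proof. exact (continuous_mult (K := R_AbsRing) f g x). Qed.

Lemma continuous_Rplus {U : UniformSpace} (f g : U -> R) (x : U) :
  continuous f x -> continuous g x -> continuous (fun t => f t + g t) x.
Proof. exact (continuous_plus (V := R_NormedModule) f g x). Qed.

Lemma continuous_quat {U : UniformSpace} (phi : U -> quat) (x : U) :
  continuous phi x <->
  continuous (fun t => q_re (phi t)) x /\ continuous (fun t => q_i (phi t)) x /\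
  continuous (fun t => q_j (phi t)) x /\ continuous (fun t => q_k (phi t)) x.
Proof.
rewrite continuous_qdot; split.
- intros H; repeat split.
  + apply continuous_ext with (2 := H 1%quat); intros; apply qdot_re.
  + apply continuous_ext with (2 := H (mkQuat 0 1 0 0)); intros; apply qdot_i.
  + apply continuous_ext with (2 := H (mkQuat 0 0 1 0)); intros; apply qdot_j.
  + apply continuous_ext with (2 := H (mkQuat 0 0 0 1)); intros; apply qdot_k.
- intros (A & B & C & D) c; unfold qdot.
  assert (E : forall (r : R) (g : U -> R), continuous g x -> continuous (fun t => r * g t) x)
    by (intros; apply (continuous_Rmult (fun _ => r)); [apply continuous_const|auto]).
  apply (continuous_Rplus (fun t => _ + _ + _)); [|now apply E].
  apply (continuous_Rplus (fun t => _ + _)); [|now apply E].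
  apply continuous_Rplus; now apply E.
Qed.

Lemma continuous_qreal {U : UniformSpace} (phi : U -> R) (x : U) :
  continuous phi x -> continuous (fun t => qreal (phi t)) x.
Proof.
intros H; apply continuous_quat; simpl; repeat split; auto; apply continuous_const.
Qed.

Lemma continuous_qnorm {U : UniformSpace} (phi : U -> quat) (x : U) :
  continuous phi x -> continuous (fun t => qnorm (phi t)) x.
Proof.
intros H; apply (continuous_comp phi qnorm); auto.
apply (filterlim_norm (V := AbsRing_NormedModule quat_AbsRing)).
Qed.

Lemma continuous_qinv {U : UniformSpace} (phi : U -> quat) (x : U) :
  continuous phi x -> phi x <> 0%quat -> continuous (fun t => (/ phi t)%quat) x.
Proof.
intros H H0; apply continuous_quat in H as (A & B & C & D).
unfold qinv; apply continuous_qmul.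
- apply continuous_qreal.
  apply (continuous_comp (fun t => qnorm2 (phi t)) Rinv).
  + assert (E : forall g : U -> R, continuous g x -> continuous (fun t => g t ^ 2) x).
    { intros g Hg; simpl; apply continuous_Rmult; auto.
      apply continuous_Rmult; auto; apply continuous_const. }
    unfold qnorm2; apply (continuous_Rplus (fun t => _ + _ + _)); [|now apply E].
    apply (continuous_Rplus (fun t => _ + _)); [|now apply E].
    apply continuous_Rplus; now apply E.
  + apply continuous_Rinv, Rgt_not_eq, qnorm2_gt0, H0.
- apply continuous_quat; simpl; repeat split; auto;
  now apply (continuous_opp (V := R_NormedModule)).
Qed.

(** * Series of quaternions *)

Definition is_qsum (u : nat -> quat) (l : quat) : Prop :=
  is_series (V := AbsRing_NormedModule quat_AbsRing) u l.

Lemma qdot_sum_n (c : quat) (u : nat -> quat) (n : nat) :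
  qdot c (sum_n u n) = sum_n (fun k => qdot c (u k)) n.
Proof.
induction n as [|n IH]; [now rewrite !sum_O|].
rewrite !sum_Sn, <- IH; apply qdotD.
Qed.

Lemma is_qsum_qdot (u : nat -> quat) (l : quat) :
  is_qsum u l <-> forall c, is_series (fun n => qdot c (u n)) (qdot c l).
Proof.
unfold is_qsum, is_series.
assert (E := filterlim_qdot eventually (sum_n u) l).
etransitivity; [exact E|]; split; intros H c; generalize (H c); apply filterlim_ext;
intros n; now rewrite qdot_sum_n.
Qed.

Lemma is_qsum_unique (u : nat -> quat) (l l' : quat) :
  is_qsum u l -> is_qsum u l' -> l = l'.
Proof.
rewrite !is_qsum_qdot; intros H H'; apply qdot_inj; intros c.
now rewrite <- (is_series_unique _ _ (H c)), (is_series_unique _ _ (H' c)).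
Qed.

Lemma is_qsum_ext (u v : nat -> quat) (l : quat) :
  (forall n, u n = v n) -> is_qsum u l -> is_qsum v l.
Proof. intros H; now apply is_series_ext. Qed.

Lemma is_qsum_plus (u v : nat -> quat) (l l' : quat) :
  is_qsum u l -> is_qsum v l' -> is_qsum (fun n => u n + v n)%quat (l + l')%quat.
Proof. intros H H'; exact (is_series_plus _ _ _ _ H H'). Qed.

Lemma is_qsum_mul_l (p : quat) (u : nat -> quat) (l : quat) :
  is_qsum u l -> is_qsum (fun n => p * u n)%quat (p * l)%quat.
Proof.
rewrite !is_qsum_qdot; intros H c; rewrite qdotMl.
apply is_series_ext with (2 := H _); intros n; now rewrite qdotMl.
Qed.

Lemma is_qsum_mul_r (p : quat) (u : nat -> quat) (l : quat) :
  is_qsum u l -> is_qsum (fun n => u n * p)%quat (l * p)%quat.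
Proof.
rewrite !is_qsum_qdot; intros H c; rewrite qdotMr.
apply is_series_ext with (2 := H _); intros n; now rewrite qdotMr.
Qed.

Lemma is_qsum_decr (u : nat -> quat) (l : quat) :
  is_qsum (fun n => u (S n)) l -> is_qsum u (u 0%nat + l)%quat.
Proof.
intros H; apply (is_series_decr_1 (V := AbsRing_NormedModule quat_AbsRing)).
change (is_qsum (fun n => u (S n)) (u 0%nat + l - u 0%nat)%quat).
replace (u 0%nat + l - u 0%nat)%quat with l by quat_ring; exact H.
Qed.

Lemma ex_qsum_abs (u : nat -> quat) (b : nat -> R) :
  (forall n, qnorm (u n) <= b n) -> ex_series b -> exists l, is_qsum u l.
Proof.
intros H Hb.
assert (E : forall c, ex_series (fun n => qdot c (u n))).
{ intros c; apply (ex_series_le (V := R_CompleteNormedModule)) with (fun n => qnorm c * b n).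
  - intros n; apply Rle_trans with (1 := qdot_le _ _).
    apply Rmult_le_compat_l; [apply qnorm_ge0|auto].
  - now apply (ex_series_scal (V := R_NormedModule)). }
exists (mkQuat (Series (fun n => q_re (u n))) (Series (fun n => q_i (u n)))
  (Series (fun n => q_j (u n))) (Series (fun n => q_k (u n)))).
apply is_qsum_qdot; intros c; unfold qdot; simpl.
assert (Hs : forall x, ex_series x -> forall y, is_series (fun n => y * x n) (y * Series x)).
{ intros x Hx y; apply (is_series_scal (V := R_NormedModule)), Series_correct, Hx. }
apply (is_series_plus (V := R_NormedModule)); [apply (is_series_plus (V := R_NormedModule));
  [apply (is_series_plus (V := R_NormedModule))|]|]; apply Hs.
- apply ex_series_ext with (2 := E 1%quat); intros; apply qdot_re.
- apply ex_series_ext with (2 := E (mkQuat 0 1 0 0)); intros; apply qdot_i.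
- apply ex_series_ext with (2 := E (mkQuat 0 0 1 0)); intros; apply qdot_j.
- apply ex_series_ext with (2 := E (mkQuat 0 0 0 1)); intros; apply qdot_k.
Qed.

(** Norm bounds by duality: to estimate the norm of a sum or an integral it suffices to pair it with
    itself and estimate a real quantity. *)
Lemma qnorm_qdot_self (q : quat) (M : R) : 0 <= M ->
  Rabs (qdot q q) <= qnorm q * M -> qnorm q <= M.
Proof.
intros HM H.
replace (qdot q q) with (qnorm q * qnorm q) in H
  by (rewrite qnorm_sq; unfold qdot, qnorm2; ring).
assert (H0 := qnorm_ge0 q).
rewrite Rabs_pos_eq in H by nra.
destruct H0 as [H0|H0]; [|now rewrite <- H0].
now apply Rmult_le_reg_l in H.
Qed.

Lemma qsum_norm_le (u : nat -> quat) (b : nat -> R) (l : quat) :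
  (forall n, qnorm (u n) <= b n) -> ex_series b -> is_qsum u l -> qnorm l <= Series b.
Proof.
intros H Hb Hl.
assert (Hb0 : forall n, 0 <= b n)
  by (intros n; apply Rle_trans with (2 := H n), qnorm_ge0).
assert (Ha : forall c n, Rabs (qdot c (u n)) <= qnorm c * b n).
{ intros c n; apply Rle_trans with (1 := qdot_le _ _).
  apply Rmult_le_compat_l; [apply qnorm_ge0|auto]. }
assert (Hs : 0 <= Series b).
(* The zero series is written [0 * 0] so that [Series_scal_l] evaluates it. *)
{ apply Rle_trans with (Series (fun _ : nat => 0 * 0)).
  - rewrite Series_scal_l; lra.
  - apply Series_le; auto; intros n; rewrite Rmult_0_l; split; auto; lra. }
apply qnorm_qdot_self; auto.
rewrite is_qsum_qdot in Hl; rewrite <- (is_series_unique _ _ (Hl l)).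
assert (Hex : ex_series (fun n => qnorm l * b n))
  by now apply (ex_series_scal (V := R_NormedModule)).
assert (Hex' : ex_series (fun n => Rabs (qdot l (u n)))).
{ apply (ex_series_le (V := R_CompleteNormedModule)) with (2 := Hex).
  intros n; unfold norm; simpl; unfold abs; simpl; rewrite Rabs_Rabsolu; apply Ha. }
apply Rle_trans with (1 := Series_Rabs _ Hex').
rewrite <- Series_scal_l; apply Series_le; auto.
intros n; split; [apply Rabs_pos|apply Ha].
Qed.

(** The Cauchy product, that is, the coefficient sequence of the regular product. *)
Definition qconv (u v : nat -> quat) (n : nat) : quat :=
  sum_n (fun k => u k * v (n - k)%nat)%quat n.

Lemma is_qsum_conv (u v : nat -> quat) (l l' : quat) :
  is_qsum u l -> is_qsum v l' ->
  ex_series (fun n => qnorm (u n)) -> ex_series (fun n => qnorm (v n)) ->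
  is_qsum (qconv u v) (l * l')%quat.
Proof.
intros Hu Hv Au Av; rewrite is_qsum_qdot in Hu, Hv |- *; intros c.
assert (Ab : forall w, ex_series (fun n => qnorm (w n)) ->
  forall d, ex_series (fun n => Rabs (qdot d (w n)))).
{ intros w Aw d.
  apply (ex_series_le (V := R_CompleteNormedModule)) with (fun n => qnorm d * qnorm (w n)).
  - intros n; unfold norm; simpl; unfold abs; simpl; rewrite Rabs_Rabsolu; apply qdot_le.
  - now apply (ex_series_scal (V := R_NormedModule)). }
pose (e0 := 1%quat); pose (e1 := mkQuat 0 1 0 0);
pose (e2 := mkQuat 0 0 1 0); pose (e3 := mkQuat 0 0 0 1).
(* Expanding [q] in the orthonormal basis [e0], ..., [e3] turns each component of the quaternionic
   product into a sum of four products of real components, to which Mertens' theorem for real series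
   applies. *)
assert (E : forall p q, qdot c (p * q)%quat =
  qdot (c * qconj e0)%quat p * qdot e0 q + qdot (c * qconj e1)%quat p * qdot e1 q
  + qdot (c * qconj e2)%quat p * qdot e2 q + qdot (c * qconj e3)%quat p * qdot e3 q).
{ intros p q; unfold qdot, e0, e1, e2, e3, qone; simpl; ring. }
rewrite E.
assert (M := fun d d' => is_series_mult _ _ _ _ (Hu d) (Hv d') (Ab u Au d) (Ab v Av d')).
generalize (is_series_plus _ _ _ _ (is_series_plus _ _ _ _ (is_series_plus _ _ _ _
  (M (c * qconj e0)%quat e0) (M (c * qconj e1)%quat e1)) (M (c * qconj e2)%quat e2))
  (M (c * qconj e3)%quat e3)).
apply is_series_ext; intros n; unfold plus; simpl.
rewrite <- !sum_plus.
unfold qconv; rewrite qdot_sum_n, sum_n_Reals; apply sum_eq; intros k _; now rewrite E.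
Qed.

(** * Power series on the ball *)

Notation qpow q n := (@pow_n quat_Ring q%quat n).

Lemma qpowS (q : quat) (n : nat) : qpow q (S n) = (q * qpow q n)%quat.
Proof. reflexivity. Qed.

Lemma qpow_comm_gen (p q : quat) (n : nat) :
  (p * q)%quat = (q * p)%quat -> (p * qpow q n)%quat = (qpow q n * p)%quat.
Proof.
intros H; induction n as [|n IH].
- change (p * 1 = 1 * p)%quat; quat_ring.
- rewrite qpowS, qmulA, H, <- !qmulA; now rewrite IH.
Qed.

Lemma qpow_comm (q : quat) (n : nat) : (q * qpow q n)%quat = (qpow q n * q)%quat.
Proof. now apply qpow_comm_gen. Qed.

Lemma qpow_add (q : quat) (n m : nat) : qpow q (n + m) = (qpow q n * qpow q m)%quat.
Proof.
induction n as [|n IH]; [symmetry; apply qmul1l|].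
change (S n + m)%nat with (S (n + m)); rewrite !qpowS, IH; apply qmulA.
Qed.

Lemma qnorm_pow (q : quat) (n : nat) : qnorm (qpow q n) = qnorm q ^ n.
Proof.
induction n as [|n IH]; [apply qnorm_1|].
now rewrite qpowS, qnormM, IH.
Qed.

Lemma qpow_real (x : R) (n : nat) : qpow (qreal x) n = qreal (x ^ n).
Proof.
induction n as [|n IH]; [reflexivity|].
rewrite qpowS, IH; quat_ring.
Qed.

Lemma is_qseriesE (a : nat -> quat) (q l : quat) :
  is_qseries a q l <-> is_qsum (fun n => qpow q n * a n)%quat l.
Proof. reflexivity. Qed.

(** Absolute convergence on every smaller closed ball, stated for the coefficients alone;
    convolution, conjugation, shift and differentiation preserve it. *)
Definition summable_on_ball (a : nat -> quat) : Prop :=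
  forall r, 0 <= r < 1 -> ex_series (fun n => qnorm (a n) * r ^ n).

Lemma ex_series_le_R (u v : nat -> R) :
  (forall n, 0 <= u n <= v n) -> ex_series v -> ex_series u.
Proof.
intros H; apply (ex_series_le (V := R_CompleteNormedModule)).
intros n; unfold norm; simpl; unfold abs; simpl; rewrite Rabs_pos_eq; apply H.
Qed.

Lemma CV_radius_ge (u : nat -> R) (x : R) :
  ex_series (fun n => x ^ n * u n) -> Rbar_le (Rabs x) (CV_radius u).
Proof.
intros H; apply Rbar_not_lt_le; intros H0.
apply (CV_disk_outside _ _ H0).
apply is_lim_seq_ext with (fun n => x ^ n * u n); [intros; apply Rmult_comm|].
now apply ex_series_lim_0.
Qed.

(** Powers of a real point are real scalars, so the quaternionic series splits into ordinary real
    power series. *)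
Lemma is_qseries_real (a : nat -> quat) (x : R) (l : quat) :
  is_qseries a (qreal x) l <->
  forall c, is_series (fun n => x ^ n * qdot c (a n)) (qdot c l).
Proof.
rewrite is_qseriesE, is_qsum_qdot; split; intros H c;
apply is_series_ext with (2 := H c); intros n; now rewrite qpow_real, qdotZ.
Qed.

Lemma real_in_ball (x : R) : Rabs x < 1 -> in_ball (qreal x).
Proof. unfold in_ball; now rewrite qnorm_real. Qed.

(** Convergence at one real point [x] with r < x < 1 makes each of the four component series
    absolutely convergent at [r]. *)
Lemma expansion_summable (f : quat -> quat) (a : nat -> quat) :
  has_expansion f a -> summable_on_ball a.
Proof.
intros H r Hr; pose (x := (r + 1) / 2).
assert (Hx : 0 <= r < x /\ x < 1) by (unfold x; lra).
assert (H1 := H (qreal x)); rewrite is_qseries_real in H1.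
assert (H2 : forall c, ex_series (fun n => Rabs (qdot c (a n) * r ^ n))).
{ intros c; apply CV_disk_inside.
  apply Rbar_lt_le_trans with (Rabs x).
  - simpl; rewrite !Rabs_pos_eq; lra.
  - apply CV_radius_ge; eexists; apply H1.
    apply real_in_ball; rewrite Rabs_pos_eq; lra. }
apply ex_series_le_R with (2 := ex_series_plus _ _
  (ex_series_plus _ _ (ex_series_plus _ _ (H2 1%quat) (H2 (mkQuat 0 1 0 0)))
  (H2 (mkQuat 0 0 1 0))) (H2 (mkQuat 0 0 0 1))).
intros n; unfold plus; simpl.
assert (0 <= r ^ n) by (apply pow_le; lra).
split; [apply Rmult_le_pos; auto; apply qnorm_ge0|].
rewrite !Rabs_mult, (Rabs_pos_eq (r ^ n)) by auto.
rewrite <- !Rmult_plus_distr_r; apply Rmult_le_compat_r; auto.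
rewrite qdot_re, qdot_i, qdot_j, qdot_k; apply qnorm_le_comp.
Qed.

Lemma summable_abs (a : nat -> quat) (q : quat) :
  summable_on_ball a -> in_ball q ->
  ex_series (fun n => qnorm (qpow q n * a n)%quat).
Proof.
intros H Hq; apply ex_series_ext with (fun n => qnorm (a n) * qnorm q ^ n).
- intros n; rewrite qnormM, qnorm_pow; apply Rmult_comm.
- apply H; split; auto; apply qnorm_ge0.
Qed.

Lemma summable_expansion (a : nat -> quat) :
  summable_on_ball a -> has_expansion (qseries a) a.
Proof.
intros H q Hq; unfold qseries; apply epsilon_spec.
destruct (ex_qsum_abs _ _ (fun n => Rle_refl _) (summable_abs _ _ H Hq)) as [l Hl].
now exists l.
Qed.

Lemma qseries_eq (a : nat -> quat) (q l : quat) : is_qseries a q l -> qseries a q = l.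
Proof.
intros H; apply (is_qsum_unique (fun n => qpow q n * a n)%quat); auto.
apply (epsilon_spec (inhabits 0%quat) (is_qseries a q)); now exists l.
Qed.

(** The identity principle, from real points near 0 only. Since these points lie in every slice, it
    compares series obtained in different slices and checks identities between regular products. *)
Lemma qseries_unique (a b : nat -> quat) (d : R) : 0 < d ->
  (forall x, Rabs x < d -> exists l,
    is_qseries a (qreal x) l /\ is_qseries b (qreal x) l) ->
  forall n, a n = b n.
Proof.
intros Hd H n; apply qdot_inj; intros c.
assert (H' : forall x, Rabs x < d -> exists l, is_series (fun n => x ^ n * qdot c (a n)) l
  /\ is_series (fun n => x ^ n * qdot c (b n)) l).
{ intros x Hx; destruct (H x Hx) as (l & A & B); rewrite is_qseries_real in A, B.
  exists (qdot c l); auto. }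
assert (Hx : Rabs (d / 2) < d) by (rewrite Rabs_pos_eq; lra).
destruct (H' _ Hx) as (l & A & B).
apply (PSeries_ext_recip (fun n => qdot c (a n)) (fun n => qdot c (b n))).
- apply Rbar_lt_le_trans with (Rabs (d / 2)); [simpl; rewrite Rabs_pos_eq; lra|].
  apply CV_radius_ge; eexists; apply A.
- apply Rbar_lt_le_trans with (Rabs (d / 2)); [simpl; rewrite Rabs_pos_eq; lra|].
  apply CV_radius_ge; eexists; apply B.
- exists (mkposreal _ Hd); intros x Hx0.
  assert (Hx1 : Rabs x < d).
  { change (Rabs (x - 0) < d) in Hx0; now rewrite Rminus_0_r in Hx0. }
  destruct (H' _ Hx1) as (l' & A' & B').
  unfold PSeries.
  rewrite (Series_ext _ _ (fun n => Rmult_comm _ _)), (is_series_unique _ _ A').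
  now rewrite (Series_ext _ _ (fun n => Rmult_comm _ _)), (is_series_unique _ _ B').
Qed.

Lemma expansion_unique (f : quat -> quat) (a b : nat -> quat) :
  has_expansion f a -> has_expansion f b -> forall n, a n = b n.
Proof.
intros A B; apply (qseries_unique a b 1); [lra|].
intros x Hx; apply real_in_ball in Hx; eauto.
Qed.

Lemma coefs_eq (f : quat -> quat) (a : nat -> quat) : has_expansion f a -> coefs f = a.
Proof.
intros H; apply functional_extensionality; apply (expansion_unique f); auto.
apply (epsilon_spec (inhabits (fun _ => 0%quat)) (has_expansion f)); now exists a.
Qed.

Lemma expansion_ext (f g : quat -> quat) (a : nat -> quat) :
  (forall q, in_ball q -> f q = g q) -> has_expansion f a -> has_expansion g a.
Proof. intros E H q Hq; rewrite <- E by auto; now apply H. Qed.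

Lemma expansion_coefs_ext (f : quat -> quat) (a b : nat -> quat) :
  (forall n, a n = b n) -> has_expansion f a -> has_expansion f b.
Proof.
intros E H q Hq; apply is_qsum_ext with (2 := H q Hq).
intros n; now rewrite E.
Qed.

Lemma expansion_fun_unique (f g : quat -> quat) (a : nat -> quat) (q : quat) :
  has_expansion f a -> has_expansion g a -> in_ball q -> f q = g q.
Proof. intros A B Hq; apply is_qsum_unique with (1 := A q Hq) (2 := B q Hq). Qed.

Lemma in_ball_0 : in_ball 0.
Proof. unfold in_ball; rewrite qnorm0; lra. Qed.

Lemma is_qsum_head (u : nat -> quat) : (forall n, u (S n) = 0%quat) -> is_qsum u (u 0%nat).
Proof.
intros H; replace (u 0%nat) with (u 0%nat + 0)%quat by quat_ring.
apply is_qsum_decr; apply is_qsum_ext with (fun _ => 0%quat); [intros; now rewrite H|].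
apply is_qsum_qdot; intros c; rewrite qdot0.
assert (E : is_series (fun n => 0 * (1 / 2) ^ n) (0 * / (1 - 1 / 2))).
{ apply (is_series_scal (V := R_NormedModule)), is_series_geom; rewrite Rabs_pos_eq; lra. }
rewrite Rmult_0_l in E; apply is_series_ext with (2 := E); intros n; apply Rmult_0_l.
Qed.

Lemma qpow_0S (n : nat) : qpow 0%quat (S n) = 0%quat.
Proof. rewrite qpowS; generalize (qpow 0%quat n); quat_ring. Qed.

Lemma expansion_at_0 (f : quat -> quat) (a : nat -> quat) :
  has_expansion f a -> f 0%quat = a 0%nat.
Proof.
intros H; apply (is_qsum_unique _ _ _ (H _ in_ball_0)).
replace (a 0%nat) with (qpow 0%quat 0 * a 0%nat)%quat by apply qmul1l.
apply (is_qsum_head (fun n => qpow 0%quat n * a n)%quat).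
intros n; rewrite qpow_0S; quat_ring.
Qed.

Lemma summable_conv (a b : nat -> quat) :
  summable_on_ball a -> summable_on_ball b -> summable_on_ball (qconv a b).
Proof.
intros A B r Hr.
assert (P : forall n, 0 <= r ^ n) by (intros; apply pow_le; lra).
assert (N : forall u : nat -> quat, summable_on_ball u ->
  ex_series (fun n => Rabs (qnorm (u n) * r ^ n))).
{ intros u U; apply ex_series_ext with (2 := U r Hr); intros n.
  rewrite Rabs_pos_eq; auto; apply Rmult_le_pos; auto; apply qnorm_ge0. }
apply ex_series_le_R with (2 := ex_intro _ _ (is_series_mult _ _ _ _
  (Series_correct _ (A r Hr)) (Series_correct _ (B r Hr)) (N a A) (N b B))).
intros n; split; [apply Rmult_le_pos; auto; apply qnorm_ge0|].
rewrite <- sum_n_Reals.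
rewrite (sum_n_ext_loc _ (fun k => mult (qnorm (a k) * qnorm (b (n - k)%nat)) (r ^ n))).
- rewrite (sum_n_mult_r (K := R_Ring)); apply Rmult_le_compat_r; auto.
  unfold qconv.
  apply Rle_trans with (sum_n (fun k => qnorm (a k * b (n - k)%nat)%quat) n).
  + apply (norm_sum_n_m (V := AbsRing_NormedModule quat_AbsRing)).
  + apply Req_le, sum_n_ext; intros; apply qnormM.
- intros k Hk; unfold mult; simpl.
  replace (r ^ n) with (r ^ k * r ^ (n - k)) by (rewrite <- pow_add; f_equal; lia); ring.
Qed.

Lemma summable_shift (a : nat -> quat) :
  summable_on_ball a <-> summable_on_ball (fun n => a (S n)).
Proof.
split; intros H r Hr.
(* The shift divides by [r]. At [r = 0] only the first term survives, because [0 ^ 0 = 1], and a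
   geometric series dominates. *)
- destruct (Req_dec r 0) as [->|Hr0].
  { apply ex_series_le_R with (fun n => qnorm (a 1%nat) * (1 / 2) ^ n).
    - intros [|n]; simpl; [|rewrite Rmult_0_l, Rmult_0_r; split; [lra|]].
      + split; [|lra]; rewrite Rmult_1_r; apply qnorm_ge0.
      + apply Rmult_le_pos; [apply qnorm_ge0|]; assert (0 <= (1/2)^n) by (apply pow_le; lra); lra.
    - apply (ex_series_scal (V := R_NormedModule)), ex_series_geom; rewrite Rabs_pos_eq; lra. }
  assert (E := proj1 (ex_series_incr_1 _) (H r Hr)).
  apply ex_series_ext with (2 := ex_series_scal (V := R_NormedModule) (/ r) _ E).
  intros n; unfold scal; simpl; unfold mult; simpl; field; auto.
- apply ex_series_incr_1.
  apply ex_series_ext with (2 := ex_series_scal (V := R_NormedModule) r _ (H r Hr)).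
  intros n; unfold scal; simpl; unfold mult; simpl; ring.
Qed.

(** The real series of norms and its derived series have the same radius of convergence. *)
Lemma summable_INR (a : nat -> quat) :
  summable_on_ball a -> summable_on_ball (fun n => qreal (INR n) * a n)%quat.
Proof.
intros H r Hr; pose (x := (r + 1) / 2).
assert (Hx : 0 <= r < x /\ x < 1) by (unfold x; lra).
assert (H1 : Rbar_lt (Rabs r) (CV_radius (fun n => qnorm (a n)))).
{ apply Rbar_lt_le_trans with (Rabs x); [simpl; rewrite !Rabs_pos_eq; lra|].
  apply CV_radius_ge; apply ex_series_ext with (2 := H x ltac:(lra)).
  intros; apply Rmult_comm. }
rewrite <- CV_radius_derive in H1; apply CV_disk_inside in H1.
apply ex_series_incr_1.
apply ex_series_ext with (2 := ex_series_scal (V := R_NormedModule) r _ H1).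
intros n; unfold scal, PS_derive; simpl pow; unfold mult; cbv [scal]; simpl.
unfold mult; simpl.
rewrite qnormM, qnorm_real, !Rabs_mult, !Rabs_pos_eq.
- destruct n; simpl; ring.
- apply pow_le; lra.
- apply qnorm_ge0.
- destruct n; [lra|]; assert (H0 := pos_INR (S n)); lra.
Qed.

Lemma expansion_shift (f : quat -> quat) (a : nat -> quat) :
  has_expansion f (fun n => a (S n)) ->
  has_expansion (fun q => a 0%nat + q * f q)%quat a.
Proof.
intros H q Hq.
replace (a 0%nat) with (qpow q 0 * a 0%nat)%quat by apply qmul1l.
apply (is_qsum_decr (fun n => qpow q n * a n)%quat).
apply is_qsum_ext with (2 := is_qsum_mul_l q _ _ (H q Hq)).
intros n; now rewrite qpowS, qmulA.
Qed.

Definition qshift (a : nat -> quat) (n : nat) : quat :=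
  match n with O => 0%quat | S m => a m end.

Lemma expansion_mul_q (f : quat -> quat) (a : nat -> quat) :
  has_expansion f a -> has_expansion (fun q => q * f q)%quat (qshift a).
Proof.
intros H; apply expansion_ext with (fun q => qshift a 0 + q * f q)%quat.
- intros q _; change (0 + q * f q = q * f q)%quat; generalize (q * f q)%quat; quat_ring.
- now apply expansion_shift.
Qed.

Lemma expansion_factor_q (f : quat -> quat) (a : nat -> quat) :
  has_expansion f a -> a 0%nat = 0%quat ->
  exists g, has_expansion g (fun n => a (S n)) /\
    forall q, in_ball q -> f q = (q * g q)%quat.
Proof.
intros H H0; exists (qseries (fun n => a (S n))).
assert (G : has_expansion (qseries (fun n => a (S n))) (fun n => a (S n))).
{ apply summable_expansion; apply (summable_shift a), (expansion_summable f), H. }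
split; auto; intros q Hq.
generalize (expansion_shift _ _ G); intros G'.
rewrite (expansion_fun_unique _ _ _ q H G' Hq), H0.
generalize (q * qseries (fun n => a (S n)) q)%quat; quat_ring.
Qed.

Lemma expansion_mul_r (f : quat -> quat) (a : nat -> quat) (u : quat) :
  has_expansion f a -> has_expansion (fun q => f q * u)%quat (fun n => a n * u)%quat.
Proof.
intros A q Hq; apply is_qsum_ext with (2 := is_qsum_mul_r u _ _ (A q Hq)).
intros n; now rewrite qmulA.
Qed.

Lemma expansion_const (c : quat) :
  has_expansion (fun _ => c) (fun n => match n with O => c | S _ => 0%quat end).
Proof.
intros q _; apply is_qseriesE.
set (u := fun n => (qpow q n * match n with O => c | S _ => 0%quat end)%quat).
replace c with (u 0%nat) by apply qmul1l.
apply (is_qsum_head u); unfold u.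
intros n; generalize (qpow q (S n)); quat_ring.
Qed.

(* (x + y I)^n = cos_part n + sin_part n * I with real coefficients independent of I *)
Fixpoint slice_pow (x y : R) (n : nat) : R * R :=
  match n with
  | O => (1, 0)
  | S m => let (c, s) := slice_pow x y m in (x * c - y * s, x * s + y * c)
  end.

Lemma qpow_slice (I : quat) (x y : R) (n : nat) : imag_unit I ->
  qpow (slice_point I x y) n =
  (qreal (fst (slice_pow x y n)) + qreal (snd (slice_pow x y n)) * I)%quat.
Proof.
intros HI; induction n as [|n IH].
- change (1 = qreal 1 + qreal 0 * I)%quat; quat_ring.
- rewrite qpowS, IH; simpl slice_pow; destruct (slice_pow x y n) as [c s].
  simpl fst; simpl snd; unfold slice_point.
  transitivity (qreal (x * c) + qreal (x * s + y * c) * I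
    + qreal (y * s) * (I * I))%quat; [quat_ring|].
  rewrite HI; quat_ring.
Qed.

(** * Slice derivatives of power series *)

Definition is_qderive (phi : R -> quat) (t : R) (d : quat) : Prop :=
  forall c, is_derive (fun s => qdot c (phi s)) t (qdot c d).

Lemma is_qderive_comp (phi : R -> quat) (t : R) (d : quat) :
  is_qderive phi t d <->
  is_derive (fun s => q_re (phi s)) t (q_re d) /\
  is_derive (fun s => q_i (phi s)) t (q_i d) /\
  is_derive (fun s => q_j (phi s)) t (q_j d) /\
  is_derive (fun s => q_k (phi s)) t (q_k d).
Proof.
split.
- intros H; refine (conj _ (conj _ (conj _ _))).
  + assert (K := H 1%quat); rewrite qdot_re in K; exact (is_derive_ext _ _ _ _ (fun s => qdot_re (phi s)) K).
  + assert (K := H (mkQuat 0 1 0 0)); rewrite qdot_i in K; exact (is_derive_ext _ _ _ _ (fun s => qdot_i (phi s)) K).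
  + assert (K := H (mkQuat 0 0 1 0)); rewrite qdot_j in K; exact (is_derive_ext _ _ _ _ (fun s => qdot_j (phi s)) K).
  + assert (K := H (mkQuat 0 0 0 1)); rewrite qdot_k in K; exact (is_derive_ext _ _ _ _ (fun s => qdot_k (phi s)) K).
- intros (A & B & C & D) c; unfold qdot.
  apply (is_derive_plus (V := R_NormedModule)); [apply (is_derive_plus (V := R_NormedModule));
    [apply (is_derive_plus (V := R_NormedModule))|]|];
  apply is_derive_scal; assumption.
Qed.

Lemma is_qderive_unique (phi : R -> quat) (t : R) (d : quat) :
  is_qderive phi t d -> ex_qderive phi t /\ qDerive phi t = d.
Proof.
intros H; apply is_qderive_comp in H as (A & B & C & D); split.
- refine (conj _ (conj _ (conj _ _))); eexists; eassumption.
- unfold qDerive; apply quat_ext; simpl; now apply is_derive_unique.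
Qed.

Lemma ex_qderive_is (phi : R -> quat) (t : R) :
  ex_qderive phi t -> is_qderive phi t (qDerive phi t).
Proof.
intros (A & B & C & D); apply is_qderive_comp; unfold qDerive; simpl.
refine (conj _ (conj _ (conj _ _))); now apply Derive_correct.
Qed.

(** An explicit quadratic remainder takes the place of a theorem on termwise differentiation; for
    power series the remainder is summed term by term. *)
Lemma is_qderive_quadratic (phi : R -> quat) (t : R) (d : quat) (C delta : R) :
  0 < delta -> 0 <= C ->
  (forall s, Rabs (s - t) < delta ->
    qnorm (phi s - phi t - qreal (s - t) * d)%quat <= C * (Rabs (s - t) * Rabs (s - t))) ->
  is_qderive phi t d.
Proof.
intros Hd HC H c; apply is_derive_Reals; intros eps Heps.
assert (Hc := qnorm_ge0 c).
assert (HK : 0 < C * qnorm c + 1) by nra.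
assert (Hm : 0 < Rmin delta (eps / (C * qnorm c + 1)))
  by (apply Rmin_glb_lt; [auto|now apply Rdiv_lt_0_compat]).
exists (mkposreal _ Hm); simpl; intros h Hh Hlt.
assert (H1 : Rabs h < delta) by (apply Rlt_le_trans with (1 := Hlt), Rmin_l).
assert (H2 : Rabs h < eps / (C * qnorm c + 1)) by (apply Rlt_le_trans with (1 := Hlt), Rmin_r).
assert (H3 := H (t + h)); replace (t + h - t) with h in H3 by ring.
specialize (H3 H1).
set (e := (phi (t + h)%R - phi t - qreal h * d)%quat) in H3.
assert (E : (qdot c (phi (t + h)) - qdot c (phi t)) / h - qdot c d = qdot c e / h).
{ unfold e; rewrite !qdotD, !qdotN, qdotZ; field; auto. }
rewrite E; unfold Rdiv; rewrite Rabs_mult, Rabs_inv.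
assert (Hp : 0 < Rabs h) by now apply Rabs_pos_lt.
apply Rle_lt_trans with (qnorm c * (C * (Rabs h * Rabs h)) * / Rabs h).
- apply Rmult_le_compat_r; [left; now apply Rinv_0_lt_compat|].
  apply Rle_trans with (1 := qdot_le c e); now apply Rmult_le_compat_l.
- replace (qnorm c * (C * (Rabs h * Rabs h)) * / Rabs h) with (C * qnorm c * Rabs h)
    by (field; lra).
  apply Rle_lt_trans with ((C * qnorm c + 1) * Rabs h); [nra|].
  apply Rlt_le_trans with ((C * qnorm c + 1) * (eps / (C * qnorm c + 1))).
  + now apply Rmult_lt_compat_l.
  + apply Req_le; field; lra.
Qed.

(** Induction on z'^(n+2) - z^(n+2) = z (z'^(n+1) - z^(n+1)) + (z' - z) z'^(n+1), which holds
    without commutation. *)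
Lemma qpow_lipschitz (z z' : quat) (rho : R) (n : nat) :
  qnorm z <= rho -> qnorm z' <= rho ->
  qnorm (qpow z' (S n) - qpow z (S n))%quat <= INR (S n) * rho ^ n * qnorm (z' - z)%quat.
Proof.
intros Hz Hz'; assert (Hr : 0 <= rho) by (apply Rle_trans with (2 := Hz), qnorm_ge0).
induction n as [|n IH].
- simpl INR; simpl pow; rewrite !Rmult_1_l.
  change (qnorm (z' * 1 - z * 1)%quat <= qnorm (z' - z)%quat).
  rewrite !qmul1r; lra.
- set (D := (qpow z' (S n) - qpow z (S n))%quat) in IH.
  replace (qpow z' (S (S n)) - qpow z (S (S n)))%quat with
    (z * D + (z' - z) * qpow z' (S n))%quat.
  2:{ unfold D; rewrite !(qpowS _ (S n)).
      generalize (qpow z (S n)) (qpow z' (S n)); quat_ring. }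
  apply Rle_trans with (1 := qnormD _ _); rewrite !qnormM, qnorm_pow, (S_INR (S n)).
  assert (H1 : qnorm z * qnorm D <= rho * (INR (S n) * rho ^ n * qnorm (z' - z)%quat))
    by (apply Rmult_le_compat; auto; apply qnorm_ge0).
  assert (H2 : qnorm z' ^ S n <= rho ^ S n) by (apply pow_incr; split; auto; apply qnorm_ge0).
  assert (H3 := qnorm_ge0 (z' - z)).
  apply (Rmult_le_compat_l _ _ _ H3) in H2.
  change (rho ^ S n) with (rho * rho ^ n) in *; lra.
Qed.

(** The remainders satisfy E_(n+1) = z E_n + w D_n, where D_n is the increment of the (n+1)-st
    power, and n^2 + (n + 1) <= (n + 1)^2 closes the induction. Commutation of [z] and [w] enters
    the recurrence. The factor [rho] on the left avoids the exponent n - 1. *)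
Lemma qpow_taylor (z w : quat) (rho : R) (n : nat) :
  (z * w)%quat = (w * z)%quat -> qnorm z <= rho -> qnorm (z + w)%quat <= rho ->
  rho * qnorm (qpow (z + w)%quat (S n) - qpow z (S n) - qreal (INR (S n)) * (w * qpow z n))%quat
    <= INR n * INR n * rho ^ n * (qnorm w * qnorm w).
Proof.
intros C Hz Hzw; assert (Hr : 0 <= rho) by (apply Rle_trans with (2 := Hz), qnorm_ge0).
induction n as [|n IH].
- replace (_ - _ - _)%quat with 0%quat.
  { simpl INR; rewrite qnorm0; apply Req_le; ring. }
  change (0 = (z + w) * 1 - z * 1 - qreal 1 * (w * 1))%quat; quat_ring.
- set (E := (_ - _ - _)%quat) in IH.
  set (D := (qpow (z + w) (S n) - qpow z (S n))%quat).
  replace (_ - _ - _)%quat with (z * E + w * D)%quat.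
  2:{ unfold E, D; rewrite !(qpowS _ (S n)), (S_INR (S n)).
      rewrite (qpowS z n).
      transitivity (z * qpow (z + w) (S n) - z * (z * qpow z n)
        - qreal (INR (S n)) * (z * w * qpow z n)
        + (w * qpow (z + w) (S n) - w * (z * qpow z n)))%quat.
      - generalize (qpow z n) (qpow (z + w) (S n)) (INR (S n)); quat_ring.
      - rewrite C; generalize (qpow z n) (qpow (z + w) (S n)) (INR (S n)); quat_ring. }
  assert (H1 := qnormD (z * E) (w * D)); rewrite !qnormM in H1.
  assert (H2 : qnorm D <= INR (S n) * rho ^ n * qnorm w).
  { assert (K := qpow_lipschitz z (z + w) rho n Hz Hzw).
    replace (z + w - z)%quat with w in K by quat_ring; exact K. }
  assert (Hw := qnorm_ge0 w); assert (HE := qnorm_ge0 E); assert (HD := qnorm_ge0 D).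
  assert (Hn : 0 <= rho ^ n) by now apply pow_le.
  assert (Hi := pos_INR n); rewrite S_INR in *.
  change (rho ^ S n) with (rho * rho ^ n).
  assert (Ha : rho * (qnorm z * qnorm E) <= rho * (INR n * INR n * rho ^ n * (qnorm w * qnorm w))).
  { apply Rle_trans with (rho * (rho * qnorm E)).
    - apply Rmult_le_compat_l; auto; now apply Rmult_le_compat_r.
    - now apply Rmult_le_compat_l. }
  assert (Hb : rho * (qnorm w * qnorm D) <= rho * (qnorm w * ((INR n + 1) * rho ^ n * qnorm w))).
  { apply Rmult_le_compat_l; auto; now apply Rmult_le_compat_l. }
  apply (Rmult_le_compat_l _ _ _ Hr) in H1.
  apply Rle_trans with (1 := H1).
  apply Rle_trans with (rho * (INR n * INR n * rho ^ n * (qnorm w * qnorm w)) +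
    rho * (qnorm w * ((INR n + 1) * rho ^ n * qnorm w))); [lra|].
  assert (H3 : 0 <= rho * rho ^ n * (qnorm w * qnorm w)).
  { apply Rmult_le_pos; apply Rmult_le_pos; auto. }
  apply (Rmult_le_compat_l _ _ _ Hi) in H3; lra.
Qed.

Lemma is_qsum_incr (u : nat -> quat) (l : quat) :
  is_qsum u l -> is_qsum (fun n => u (S n)) (l - u 0%nat)%quat.
Proof.
intros H; apply (is_series_incr_1 (V := AbsRing_NormedModule quat_AbsRing)).
change (is_qsum u (l - u 0%nat + u 0%nat)%quat).
replace (l - u 0%nat + u 0%nat)%quat with l by quat_ring; exact H.
Qed.

Lemma is_qsum_opp (u : nat -> quat) (l : quat) :
  is_qsum u l -> is_qsum (fun n => - u n)%quat (- l)%quat.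
Proof. intros H; exact (is_series_opp _ _ H). Qed.

Definition dcoef (a : nat -> quat) (n : nat) : quat := (qreal (INR (S n)) * a (S n))%quat.

Lemma summable_dcoef (a : nat -> quat) : summable_on_ball a -> summable_on_ball (dcoef a).
Proof.
intros H; exact (proj1 (summable_shift _) (summable_INR _ H)).
Qed.

Lemma expansion_lipschitz (f : quat -> quat) (a : nat -> quat) (rho : R) :
  has_expansion f a -> 0 <= rho < 1 ->
  exists L, 0 <= L /\ forall z z', qnorm z <= rho -> qnorm z' <= rho ->
    qnorm (f z' - f z)%quat <= L * qnorm (z' - z)%quat.
Proof.
intros H Hr; assert (Sm := summable_dcoef _ (expansion_summable _ _ H) rho Hr).
exists (Series (fun n => qnorm (dcoef a n) * rho ^ n)); split.
{ apply Rle_trans with (Series (fun _ : nat => 0 * 0)).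
  - rewrite Series_scal_l; lra.
  - apply Series_le; auto; intros n; rewrite Rmult_0_l; split; [lra|].
    apply Rmult_le_pos; [apply qnorm_ge0|apply pow_le; lra]. }
intros z z' Hz Hz'.
assert (Bz : in_ball z) by (unfold in_ball; lra).
assert (Bz' : in_ball z') by (unfold in_ball; lra).
assert (E := is_qsum_incr _ _ (is_qsum_plus _ _ _ _ (proj1 (is_qseriesE _ _ _) (H z' Bz'))
  (is_qsum_opp _ _ (proj1 (is_qseriesE _ _ _) (H z Bz))))).
cbv beta in E; change (qpow z' 0) with 1%quat in E; change (qpow z 0) with 1%quat in E.
replace (_ - _)%quat with (f z' - f z)%quat in E
  by (generalize (f z) (f z') (a 0%nat); quat_ring).
rewrite Rmult_comm, <- Series_scal_l.
apply qsum_norm_le with (3 := E).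
- intros n.
  change (qnorm (qpow z' (S n) * a (S n) - qpow z (S n) * a (S n))%quat <=
    qnorm (z' - z)%quat * (qnorm (dcoef a n) * rho ^ n)).
  replace (qpow z' (S n) * a (S n) - qpow z (S n) * a (S n))%quat with
    ((qpow z' (S n) - qpow z (S n)) * a (S n))%quat
    by (generalize (qpow z' (S n)) (qpow z (S n)) (a (S n)); quat_ring).
  unfold dcoef; rewrite !qnormM, qnorm_real, Rabs_pos_eq by apply pos_INR.
  assert (K := qpow_lipschitz z z' rho n Hz Hz').
  apply (Rmult_le_compat_r _ _ _ (qnorm_ge0 (a (S n)))) in K; lra.
- now apply (ex_series_scal (V := R_NormedModule)).
Qed.

(** Increments commuting with [z] cover those that stay in a slice of [z]. The constant is the sum
    of n^2 |a_(n+1)| rho^n divided by rho, hence the double use of [summable_INR]. *)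
Lemma expansion_taylor (f g : quat -> quat) (a : nat -> quat) (rho : R) :
  has_expansion f a -> has_expansion g (dcoef a) -> 0 < rho < 1 ->
  exists C, 0 <= C /\ forall z w, (z * w)%quat = (w * z)%quat ->
    qnorm z <= rho -> qnorm (z + w)%quat <= rho ->
    qnorm (f (z + w) - f z - w * g z)%quat <= C * (qnorm w * qnorm w).
Proof.
intros H G Hr.
assert (Sm := summable_INR _ (summable_INR _ (proj1 (summable_shift _)
  (expansion_summable _ _ H))) rho ltac:(lra)).
set (b := fun n => qnorm (qreal (INR n) * (qreal (INR n) * a (S n)))%quat * rho ^ n) in Sm.
assert (Hb : forall n, 0 <= b n).
{ intros n; apply Rmult_le_pos; [apply qnorm_ge0|apply pow_le; lra]. }
exists (/ rho * Series b); split.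
{ apply Rmult_le_pos; [left; apply Rinv_0_lt_compat; lra|].
  apply Rle_trans with (Series (fun _ : nat => 0 * 0)).
  - rewrite Series_scal_l; lra.
  - apply Series_le; auto; intros n; rewrite Rmult_0_l; split; [lra|auto]. }
intros z w C Hz Hzw.
assert (Bz : in_ball z) by (unfold in_ball; lra).
assert (Bz' : in_ball (z + w)) by (unfold in_ball; lra).
assert (E := is_qsum_plus _ _ _ _ (is_qsum_incr _ _ (is_qsum_plus _ _ _ _ (proj1 (is_qseriesE _ _ _) (H _ Bz'))
  (is_qsum_opp _ _ (proj1 (is_qseriesE _ _ _) (H z Bz)))))
  (is_qsum_opp _ _ (is_qsum_mul_l w _ _ (proj1 (is_qseriesE _ _ _) (G z Bz))))).
cbv beta in E; change (qpow (z + w) 0) with 1%quat in E; change (qpow z 0) with 1%quat in E.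
replace (_ + - (w * g z))%quat with (f (z + w) - f z - w * g z)%quat in E
  by (generalize (f z) (f (z + w)%quat) (a 0%nat) (g z); quat_ring).
replace (/ rho * Series b * (qnorm w * qnorm w)) with
  (/ rho * (qnorm w * qnorm w) * Series b) by ring.
rewrite <- Series_scal_l.
apply qsum_norm_le with (3 := E).
- intros n.
  change (qnorm (qpow (z + w) (S n) * a (S n) - qpow z (S n) * a (S n)
    - w * (qpow z n * (qreal (INR (S n)) * a (S n))))%quat <=
    / rho * (qnorm w * qnorm w) * b n).
  replace (_ - _ - _)%quat with
    ((qpow (z + w) (S n) - qpow z (S n) - qreal (INR (S n)) * (w * qpow z n)) * a (S n))%quat
    by (generalize (qpow (z + w) (S n)) (qpow z (S n)) (qpow z n) (INR (S n)) (a (S n)); quat_ring).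
  assert (K := qpow_taylor z w rho n C Hz Hzw).
  rewrite qnormM; unfold b; rewrite !qnormM, !qnorm_real, !Rabs_pos_eq by apply pos_INR.
  apply Rmult_le_reg_l with rho; [lra|].
  apply (Rmult_le_compat_r _ _ _ (qnorm_ge0 (a (S n)))) in K.
  rewrite <- Rmult_assoc; apply Rle_trans with (1 := K).
  apply Req_le; field; lra.
- now apply (ex_series_scal (V := R_NormedModule)).
Qed.

(** * Imaginary units and slice coordinates *)

Lemma imag_unit_sq (I : quat) : imag_unit I ->
  q_re I = 0 /\ q_i I ^ 2 + q_j I ^ 2 + q_k I ^ 2 = 1.
Proof.
intros H; unfold imag_unit in H.
assert (H0 := f_equal q_re H); assert (H1 := f_equal q_i H);
assert (H2 := f_equal q_j H); assert (H3 := f_equal q_k H); simpl in *.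
(* A nonzero real part would make the vector part vanish, through the terms [2 * q_re I * q_i I] and
   their analogues, and leave a real square equal to -1. *)
destruct (Req_dec (q_re I) 0) as [E|E]; [split; auto; rewrite E in H0; nra|].
assert (q_i I = 0) by (apply (Rmult_eq_reg_l (2 * q_re I)); nra).
assert (q_j I = 0) by (apply (Rmult_eq_reg_l (2 * q_re I)); nra).
assert (q_k I = 0) by (apply (Rmult_eq_reg_l (2 * q_re I)); nra).
nra.
Qed.

Lemma imag_unit_intro (I : quat) : q_re I = 0 -> qnorm2 I = 1 -> imag_unit I.
Proof.
intros H0 H; unfold qnorm2 in H; apply quat_ext; simpl; rewrite H0 in *; lra.
Qed.

Lemma imag_unit_conj (I : quat) : imag_unit I -> qconj I = (- I)%quat.
Proof. intros H; apply imag_unit_sq in H as [H _]; apply quat_ext; simpl; lra. Qed.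

Lemma imag_unit_norm (I : quat) : imag_unit I -> qnorm I = 1.
Proof.
intros H; apply imag_unit_sq in H as [H0 H]; apply qnorm_eq; [lra|].
unfold qnorm2; rewrite H0; lra.
Qed.

Lemma slice_norm2 (I : quat) (x y : R) : imag_unit I ->
  qnorm2 (slice_point I x y) = x * x + y * y.
Proof.
intros H; apply imag_unit_sq in H as [H0 H].
unfold slice_point, qnorm2; simpl; rewrite H0.
transitivity (x * x + y * y * (q_i I ^ 2 + q_j I ^ 2 + q_k I ^ 2)); [ring|rewrite H; ring].
Qed.

Lemma slice_norm (I : quat) (x y : R) : imag_unit I ->
  qnorm (slice_point I x y) = sqrt (x * x + y * y).
Proof. intros H; unfold qnorm; now rewrite slice_norm2. Qed.

Lemma slice_in_ball (I : quat) (x y : R) : imag_unit I ->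
  in_ball (slice_point I x y) <-> x * x + y * y < 1.
Proof.
intros H; unfold in_ball; rewrite slice_norm by auto.
rewrite <- sqrt_1 at 1; split; intros H0.
- now apply sqrt_lt_0_alt.
- apply sqrt_lt_1_alt; split; auto; nra.
Qed.

Lemma slice_unit_spec (q : quat) :
  imag_unit (slice_unit q) /\ q = slice_point (slice_unit q) (q_re q) (vec_norm q).
Proof.
unfold slice_unit; destruct (Req_EM_T (vec_norm q) 0) as [E|E].
- split; [unfold imag_unit; quat_ring|].
  rewrite E; unfold vec_norm in E; apply sqrt_eq_0 in E; [|nra].
  apply quat_ext; simpl; nra.
- set (v := vec_norm q) in *.
  assert (Hv : v * v = q_i q ^ 2 + q_j q ^ 2 + q_k q ^ 2) by (apply sqrt_sqrt; nra).
  split.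
  + apply imag_unit_intro; auto; unfold qnorm2; simpl q_re; simpl q_i; simpl q_j; simpl q_k.
    replace (_ + _) with ((q_i q ^ 2 + q_j q ^ 2 + q_k q ^ 2) / (v * v)) by (field; auto).
    rewrite <- Hv; field; auto.
  + apply quat_ext; simpl; field; auto.
Qed.

Lemma slice_locally (I : quat) (x y : R) : imag_unit I -> in_ball (slice_point I x y) ->
  exists rho delta, 0 < rho < 1 /\ 0 < delta /\ forall w, qnorm w < delta ->
    qnorm (slice_point I x y + w)%quat <= rho.
Proof.
intros HI H; unfold in_ball in H; assert (H0 := qnorm_ge0 (slice_point I x y)).
exists ((qnorm (slice_point I x y) + 1) / 2), ((1 - qnorm (slice_point I x y)) / 2).
repeat split; try lra.
intros w Hw; apply Rle_trans with (1 := qnormD _ _); lra.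
Qed.

Lemma expansion_slice_derivatives (f g : quat -> quat) (a : nat -> quat) (I : quat) (x y : R) :
  has_expansion f a -> has_expansion g (dcoef a) -> imag_unit I -> in_ball (slice_point I x y) ->
  is_qderive (fun s => f (slice_point I s y)) x (g (slice_point I x y)) /\
  is_qderive (fun t => f (slice_point I x t)) y (I * g (slice_point I x y))%quat.
Proof.
intros H G HI Hb; destruct (slice_locally I x y HI Hb) as (rho & delta & Hr & Hd & Hl).
destruct (expansion_taylor f g a rho H G Hr) as (C & HC & T).
set (z := slice_point I x y) in *.
assert (Hz : qnorm z <= rho).
{ replace z with (z + 0)%quat by quat_ring; apply Hl; now rewrite qnorm0. }
split; apply is_qderive_quadratic with C delta; auto.
- intros s Hs; specialize (T z (qreal (s - x))).
  rewrite qnorm_real in T.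
  replace (slice_point I s y) with (z + qreal (s - x))%quat
    by (unfold z, slice_point; quat_ring).
  apply T; auto; [symmetry; apply qrealC|apply Hl; now rewrite qnorm_real].
- intros s Hs; specialize (T z (qreal (s - y) * I)%quat).
  rewrite qnormM, qnorm_real, (imag_unit_norm I HI), Rmult_1_r in T.
  rewrite qmulA.
  replace (slice_point I x s) with (z + qreal (s - y) * I)%quat
    by (unfold z, slice_point; quat_ring).
  apply T; auto.
  + unfold z, slice_point; quat_ring.
  + apply Hl; now rewrite qnormM, qnorm_real, (imag_unit_norm I HI), Rmult_1_r.
Qed.

Lemma continuous_slice_point (I : quat) (z : R * R) :
  continuous (fun z : R * R => slice_point I (fst z) (snd z)) z.
Proof.
destruct z as [x y].
apply continuous_qadd; [|apply continuous_qmul; [|apply continuous_const]];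
apply continuous_qreal; [apply continuous_fst|apply continuous_snd].
Qed.

Lemma expansion_continuous (f : quat -> quat) (a : nat -> quat) (q : quat) :
  has_expansion f a -> in_ball q -> continuous f q.
Proof.
intros H Hq; unfold in_ball in Hq; assert (H0 := qnorm_ge0 q).
destruct (expansion_lipschitz f a ((qnorm q + 1) / 2) H ltac:(lra)) as (L & HL & HLip).
apply filterlim_locally; intros eps.
assert (Hd : 0 < Rmin ((1 - qnorm q) / 2) (eps / (L + 1))).
{ apply Rmin_glb_lt; [lra|apply Rdiv_lt_0_compat; [apply eps|lra]]. }
exists (mkposreal _ Hd); intros p Hp; change (qnorm (f p - f q)%quat < eps).
change (qnorm (p - q)%quat < Rmin ((1 - qnorm q) / 2) (eps / (L + 1))) in Hp.
assert (H1 : qnorm (p - q)%quat < (1 - qnorm q) / 2) by (apply Rlt_le_trans with (1 := Hp), Rmin_l).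
assert (H2 : qnorm (p - q)%quat < eps / (L + 1)) by (apply Rlt_le_trans with (1 := Hp), Rmin_r).
assert (Hp' : qnorm p <= (qnorm q + 1) / 2).
{ replace p with (q + (p - q))%quat by quat_ring.
  apply Rle_trans with (1 := qnormD _ _); lra. }
apply Rle_lt_trans with (1 := HLip q p ltac:(lra) Hp').
assert (H3 := qnorm_ge0 (p - q)).
apply Rle_lt_trans with ((L + 1) * qnorm (p - q)%quat); [lra|].
apply Rlt_le_trans with ((L + 1) * (eps / (L + 1))).
- apply Rmult_lt_compat_l; [lra|auto].
- apply Req_le; field; lra.
Qed.

Lemma locally_in_ball (I : quat) (x y : R) : imag_unit I -> in_ball (slice_point I x y) ->
  locally (x, y) (fun z : R * R => in_ball (slice_point I (fst z) (snd z))).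
Proof.
intros HI H.
apply (continuous_slice_point I (x, y) in_ball).
assert (Hd : 0 < 1 - qnorm (slice_point I x y)) by (unfold in_ball in H; lra).
exists (mkposreal _ Hd); intros p Hp.
change (qnorm (p - slice_point I x y)%quat < 1 - qnorm (slice_point I x y)) in Hp.
unfold in_ball; replace p with (slice_point I x y + (p - slice_point I x y))%quat by quat_ring.
apply Rle_lt_trans with (1 := qnormD _ _); lra.
Qed.

(** The Cauchy-Riemann equation is built into the shape of the partial derivatives, d and I d, since
    d + I (I d) = 0. *)
Lemma slice_regular_intro (f : quat -> quat) (d : quat -> quat -> quat) :
  (forall I x y, imag_unit I -> in_ball (slice_point I x y) ->
    is_qderive (fun s => f (slice_point I s y)) x (d I (slice_point I x y)) /\
    is_qderive (fun t => f (slice_point I x t)) y (I * d I (slice_point I x y))%quat /\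
    continuous (fun z : R * R => d I (slice_point I (fst z) (snd z))) (x, y)) ->
  slice_regular f.
Proof.
intros H I HI x y Hb; destruct (H I x y HI Hb) as (A & B & C).
destruct (is_qderive_unique _ _ _ A) as [A1 A2].
destruct (is_qderive_unique _ _ _ B) as [B1 B2].
assert (L := locally_in_ball I x y HI Hb).
refine (conj A1 (conj B1 (conj _ (conj _ _)))).
- apply continuous_ext_loc with (2 := C); revert L; apply filter_imp.
  intros [s t] Hst; simpl in *; unfold slice_dx; symmetry.
  now apply is_qderive_unique, H.
- apply continuous_ext_loc with
    (fun z : R * R => (I * d I (slice_point I (fst z) (snd z)))%quat).
  + revert L; apply filter_imp; intros [s t] Hst; simpl in *; unfold slice_dy; symmetry.
    now apply is_qderive_unique, H.
  + apply continuous_qmul; auto; apply continuous_const.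
- unfold slice_dx, slice_dy; rewrite A2, B2, qmulA, HI.
  generalize (d I (slice_point I x y)); quat_ring.
Qed.

Lemma expansion_slice_regular (f : quat -> quat) (a : nat -> quat) :
  has_expansion f a -> slice_regular f.
Proof.
intros H; set (g := qseries (dcoef a)).
assert (G : has_expansion g (dcoef a))
  by (apply summable_expansion, summable_dcoef, expansion_summable with (1 := H)).
apply (slice_regular_intro f (fun _ => g)); intros I x y HI Hb.
destruct (expansion_slice_derivatives f g a I x y H G HI Hb) as [A B].
refine (conj A (conj B _)).
apply (continuous_comp (fun z : R * R => slice_point I (fst z) (snd z)) g).
- apply continuous_slice_point.
- now apply expansion_continuous with (dcoef a).
Qed.

Lemma slice_regular_dy (f : quat -> quat) (I : quat) (x y : R) :
  slice_regular f -> imag_unit I -> in_ball (slice_point I x y) ->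
  slice_dy f I x y = (I * slice_dx f I x y)%quat.
Proof.
intros H HI Hb; destruct (H I HI x y Hb) as (_ & _ & _ & _ & E).
set (dx := slice_dx f I x y) in *; set (dy := slice_dy f I x y) in *.
apply qsub_eq0.
transitivity ((I * I + 1) * dy - qreal 2 * I * (qreal (1 / 2) * (dx + I * dy)))%quat.
- clear E; apply quat_ext; unfold qreal; simpl; field.
- rewrite E, HI; generalize (qreal 2 * I)%quat; quat_ring.
Qed.

(** By Cauchy-Riemann the half-difference defining the slice derivative equals the x-derivative,
    which termwise differentiation computes. *)
Lemma slice_derivative_expansion (f : quat -> quat) (a : nat -> quat) :
  has_expansion f a -> has_expansion (slice_derivative f) (dcoef a).
Proof.
intros H; set (g := qseries (dcoef a)).
assert (G : has_expansion g (dcoef a))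
  by (apply summable_expansion, summable_dcoef, expansion_summable with (1 := H)).
apply expansion_ext with (2 := G); intros q Hq; unfold slice_derivative.
destruct (slice_unit_spec q) as [HI E].
set (I := slice_unit q) in *; set (x := q_re q) in *; set (y := vec_norm q) in *.
assert (Hb : in_ball (slice_point I x y)) by now rewrite <- E.
rewrite (slice_regular_dy f I x y (expansion_slice_regular _ _ H) HI Hb), qmulA, HI.
destruct (expansion_slice_derivatives f g a I x y H G HI Hb) as [A _].
apply is_qderive_unique in A as [_ A]; unfold slice_dx; rewrite A, <- E.
generalize (g q); intros p; apply quat_ext; unfold qreal; simpl; field.
Qed.

(** * Integrals of quaternion-valued functions *)

Definition qRInt (phi : R -> quat) (a b : R) : quat :=
  mkQuat (RInt (fun t => q_re (phi t)) a b) (RInt (fun t => q_i (phi t)) a b)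
         (RInt (fun t => q_j (phi t)) a b) (RInt (fun t => q_k (phi t)) a b).

Lemma is_RInt_qdot (phi : R -> quat) (a b : R) (c : quat) :
  a <= b -> (forall t, a <= t <= b -> continuous phi t) ->
  is_RInt (fun t => qdot c (phi t)) a b (qdot c (qRInt phi a b)).
Proof.
intros Hab H; unfold qdot, qRInt; simpl.
assert (E : forall g : R -> R, (forall t, a <= t <= b -> continuous g t) ->
  forall x, is_RInt (fun t => x * g t) a b (x * RInt g a b)).
{ intros g Hg x; apply (is_RInt_scal (V := R_NormedModule)).
  apply (RInt_correct (V := R_CompleteNormedModule)).
  apply (ex_RInt_continuous (V := R_CompleteNormedModule)).
  rewrite Rmin_left, Rmax_right; auto. }
apply (is_RInt_plus (V := R_NormedModule)); [apply (is_RInt_plus (V := R_NormedModule));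
  [apply (is_RInt_plus (V := R_NormedModule))|]|]; apply E; intros t Ht;
now apply continuous_quat, H.
Qed.

Lemma RInt_qdot (phi : R -> quat) (a b : R) (c : quat) :
  a <= b -> (forall t, a <= t <= b -> continuous phi t) ->
  RInt (fun t => qdot c (phi t)) a b = qdot c (qRInt phi a b).
Proof. intros; now apply is_RInt_unique, is_RInt_qdot. Qed.

Lemma qRInt_ext (phi psi : R -> quat) (a b : R) :
  (forall t, Rmin a b < t < Rmax a b -> phi t = psi t) -> qRInt phi a b = qRInt psi a b.
Proof.
intros H; unfold qRInt; apply quat_ext; simpl; apply RInt_ext; intros t Ht; now rewrite H.
Qed.

Lemma qRInt_mul_l (p : quat) (phi : R -> quat) (a b : R) :
  a <= b -> (forall t, a <= t <= b -> continuous phi t) ->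
  qRInt (fun t => p * phi t)%quat a b = (p * qRInt phi a b)%quat.
Proof.
intros Hab H; apply qdot_inj; intros c; rewrite <- RInt_qdot; auto.
- rewrite qdotMl, <- RInt_qdot; auto.
  apply RInt_ext; intros; apply qdotMl.
- intros t Ht; apply continuous_qmul; [apply continuous_const|auto].
Qed.

Lemma qRInt_mul_r (p : quat) (phi : R -> quat) (a b : R) :
  a <= b -> (forall t, a <= t <= b -> continuous phi t) ->
  qRInt (fun t => phi t * p)%quat a b = (qRInt phi a b * p)%quat.
Proof.
intros Hab H; apply qdot_inj; intros c; rewrite <- RInt_qdot; auto.
- rewrite qdotMr, <- RInt_qdot; auto.
  apply RInt_ext; intros; apply qdotMr.
- intros t Ht; apply continuous_qmul; [auto|apply continuous_const].
Qed.

Lemma qRInt_plus (phi psi : R -> quat) (a b : R) :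
  a <= b -> (forall t, a <= t <= b -> continuous phi t) ->
  (forall t, a <= t <= b -> continuous psi t) ->
  qRInt (fun t => phi t + psi t)%quat a b = (qRInt phi a b + qRInt psi a b)%quat.
Proof.
intros Hab H H'; apply qdot_inj; intros c; rewrite <- RInt_qdot; auto.
- rewrite qdotD; apply is_RInt_unique.
  apply (is_RInt_ext (V := R_NormedModule)) with
    (fun t => plus (qdot c (phi t)) (qdot c (psi t))).
  + intros; now rewrite qdotD.
  + apply (is_RInt_plus (V := R_NormedModule)); now apply is_RInt_qdot.
- intros t Ht; apply continuous_qadd; auto.
Qed.

Lemma qRInt_norm_le (phi : R -> quat) (a b M : R) :
  a <= b -> (forall t, a <= t <= b -> continuous phi t) ->
  (forall t, a <= t <= b -> qnorm (phi t) <= M) ->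
  qnorm (qRInt phi a b) <= (b - a) * M.
Proof.
intros Hab H HM.
assert (H0 : 0 <= M) by (apply Rle_trans with (2 := HM a ltac:(lra)), qnorm_ge0).
apply qnorm_qdot_self; [apply Rmult_le_pos; lra|].
set (l := qRInt phi a b); assert (E := is_RInt_qdot phi a b l Hab H); fold l in E.
rewrite <- (is_RInt_unique _ _ _ _ E).
replace (qnorm l * ((b - a) * M)) with ((b - a) * (qnorm l * M)) by ring.
apply abs_RInt_le_const; auto; [eexists; exact E|].
intros t Ht; apply Rle_trans with (1 := qdot_le _ _).
apply Rmult_le_compat_l; [apply qnorm_ge0|auto].
Qed.

Lemma qnorm_bounded (phi : R -> quat) (a b : R) :
  a <= b -> (forall t, a <= t <= b -> continuous phi t) ->
  exists M, forall t, a <= t <= b -> qnorm (phi t) <= M.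
Proof.
intros Hab H; destruct (continuity_ab_maj (fun t => qnorm (phi t)) a b Hab) as (t0 & Ht & _).
- intros t Ht; apply continuity_pt_filterlim.
  exact (continuous_qnorm phi t (H t Ht)).
- eexists; exact Ht.
Qed.

(** * The exponential on a slice and differentiation along curves *)

Definition qexp (I : quat) (theta : R) : quat := slice_point I (cos theta) (sin theta).

Lemma qexp_add (I : quat) (s t : R) : imag_unit I ->
  (qexp I s * qexp I t)%quat = qexp I (s + t).
Proof.
intros HI; unfold qexp, slice_point; rewrite cos_plus, sin_plus.
transitivity (qreal (cos s * cos t) + qreal (sin s * sin t) * (I * I)
  + qreal (sin s * cos t + cos s * sin t) * I)%quat; [quat_ring|rewrite HI; quat_ring].
Qed.

Lemma qexp_0 (I : quat) : qexp I 0 = 1%quat.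
Proof. unfold qexp, slice_point; rewrite cos_0, sin_0; quat_ring. Qed.

Lemma qexp_pow (I : quat) (t : R) (n : nat) : imag_unit I ->
  qpow (qexp I t) n = qexp I (INR n * t).
Proof.
intros HI; induction n as [|n IH].
- simpl INR; rewrite Rmult_0_l, qexp_0; reflexivity.
- rewrite qpowS, IH, qexp_add, S_INR; auto; f_equal; ring.
Qed.

Lemma qexp_norm (I : quat) (t : R) : imag_unit I -> qnorm (qexp I t) = 1.
Proof.
intros HI; unfold qexp; rewrite slice_norm by auto.
generalize (sin2_cos2 t); unfold Rsqr; intros E.
rewrite Rplus_comm, E; apply sqrt_1.
Qed.

Lemma qexp_period (I : quat) (n : nat) : qexp I (INR n * (2 * PI)) = 1%quat.
Proof.
replace (INR n * (2 * PI)) with (0 + 2 * INR n * PI) by ring.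
unfold qexp; rewrite cos_period, sin_period, cos_0, sin_0; unfold slice_point; quat_ring.
Qed.

Lemma continuous_qexp (I : quat) (t : R) : continuous (qexp I) t.
Proof.
apply continuous_qadd; [|apply continuous_qmul; [|apply continuous_const]];
apply continuous_qreal; [apply continuous_cos|apply continuous_sin].
Qed.

Lemma is_qderive_qexp (I : quat) (t : R) : imag_unit I ->
  is_qderive (qexp I) t (I * qexp I t)%quat.
Proof.
intros HI.
replace (I * qexp I t)%quat with (slice_point I (- sin t) (cos t)).
2:{ unfold qexp, slice_point.
    transitivity (qreal (cos t) * I + qreal (sin t) * (I * I))%quat;
    [rewrite HI|]; quat_ring. }
intros c; unfold qexp, slice_point, qdot, qreal; simpl; auto_derive; auto; ring.
Qed.

Lemma continuous_qexp_lin (I : quat) (x t : R) : continuous (fun t => qexp I (x * t)) t.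
Proof.
apply (continuous_comp (fun t => x * t) (qexp I)); [|apply continuous_qexp].
apply (continuous_scal_r (V := R_NormedModule)), continuous_id.
Qed.

Lemma is_derive_linear (k t : R) : is_derive (fun s => k * s) t k.
Proof. auto_derive; auto; ring. Qed.

Lemma qRInt_qexp (I : quat) (n : nat) : imag_unit I ->
  qRInt (fun t => qexp I (- INR (S n) * t)) 0 (2 * PI) = 0%quat.
Proof.
intros HI; assert (Hn : INR (S n) <> 0) by now apply not_0_INR.
assert (Hpi := PI_RGT_0).
apply qdot_inj; intros c.
rewrite <- RInt_qdot by (try lra; intros; apply continuous_qexp_lin).
apply is_RInt_unique.
(* A primitive: differentiating produces a factor -(n + 1) I, and I I = -1. It takes equal values at
   0 and 2 pi. *)
pose (g := fun t => qdot c (qreal (/ INR (S n)) * I * qexp I (- INR (S n) * t))%quat).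
replace (qdot c 0%quat) with (minus (g (2 * PI)) (g 0)).
- apply (is_RInt_derive (V := R_CompleteNormedModule)).
  + intros t _; unfold g.
    apply is_derive_ext with (fun t => qdot (qconj (qreal (/ INR (S n)) * I) * c)%quat
      (qexp I (- INR (S n) * t))); [intros; now rewrite qdotMl|].
    replace (qdot c (qexp I (- INR (S n) * t))) with
      (scal (- INR (S n)) (qdot (qconj (qreal (/ INR (S n)) * I) * c)%quat
        (I * qexp I (- INR (S n) * t))%quat)).
    * apply (is_derive_comp (V := R_NormedModule)
        (fun s => qdot (qconj (qreal (/ INR (S n)) * I) * c)%quat (qexp I s))
        (fun t => - INR (S n) * t)); [apply is_qderive_qexp; auto|apply is_derive_linear].
    * rewrite <- qdotMl; unfold scal; simpl scal; unfold mult; simpl mult.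
      rewrite <- qdotZ; f_equal.
      transitivity (qreal (- (INR (S n) * / INR (S n))) * (I * I) * qexp I (- INR (S n) * t))%quat;
      [generalize (qexp I (- INR (S n) * t)); quat_ring|].
      rewrite HI, Rinv_r by auto; generalize (qexp I (- INR (S n) * t)); quat_ring.
  + intros t _; apply continuous_qdot, continuous_qexp_lin.
- unfold g; rewrite Rmult_0_r, qexp_0.
  replace (qexp I (- INR (S n) * (2 * PI))) with 1%quat.
  + rewrite qdot0; unfold minus, plus, opp; simpl; ring.
  + rewrite <- (qmul1r (qexp I (- INR (S n) * (2 * PI)))).
    rewrite <- (qexp_period I (S n)) at 1 2; rewrite qexp_add by auto.
    replace (- INR (S n) * (2 * PI) + INR (S n) * (2 * PI)) with 0 by ring.
    rewrite qexp_0; apply qexp_period.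
Qed.

(** Total differentiability from an x-derivative that exists nearby and is continuous at the point,
    together with a y-derivative at the point. *)
Lemma slice_differentiable (f : quat -> quat) (I : quat) (x y : R) (c : quat) :
  slice_regular f -> imag_unit I -> in_ball (slice_point I x y) ->
  differentiable_pt_lim (fun s t => qdot c (f (slice_point I s t))) x y
    (qdot c (slice_dx f I x y)) (qdot c (I * slice_dx f I x y)%quat).
Proof.
intros H HI Hb; apply filterdiff_differentiable_pt_lim.
apply (is_derive_filterdiff (fun s t => qdot c (f (slice_point I s t))) x y
  (fun s t => qdot c (slice_dx f I s t)) (qdot c (I * slice_dx f I x y)%quat)).
- generalize (locally_in_ball I x y HI Hb); apply filter_imp.
  intros [s t] Hst; simpl in *; destruct (H I HI s t Hst) as (A & _).
  apply (ex_qderive_is _ _ A).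
- rewrite <- slice_regular_dy by auto; destruct (H I HI x y Hb) as (_ & A & _).
  apply (ex_qderive_is _ _ A).
- destruct (H I HI x y Hb) as (_ & _ & A & _).
  apply continuous_qdot with (1 := A).
Qed.

(** Cauchy-Riemann merges the two partial derivatives into one left multiplication by the velocity
    X' + Y' I, as for a holomorphic function along a curve. *)
Lemma slice_chain (f : quat -> quat) (I : quat) (X Y : R -> R) (t X' Y' : R) :
  slice_regular f -> imag_unit I -> in_ball (slice_point I (X t) (Y t)) ->
  is_derive X t X' -> is_derive Y t Y' ->
  is_qderive (fun s => f (slice_point I (X s) (Y s))) t
    (slice_point I X' Y' * slice_dx f I (X t) (Y t))%quat.
Proof.
intros H HI Hb HX HY c; apply is_derive_Reals.
apply is_derive_Reals in HX; apply is_derive_Reals in HY.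
assert (D := slice_differentiable f I (X t) (Y t) c H HI Hb).
assert (E := derivable_pt_lim_comp_2d (fun s t => qdot c (f (slice_point I s t))) X Y t
  _ _ _ _ D HX HY).
replace (qdot c (slice_point I X' Y' * slice_dx f I (X t) (Y t))%quat) with
  (qdot c (slice_dx f I (X t) (Y t)) * X' + qdot c (I * slice_dx f I (X t) (Y t))%quat * Y');
auto.
unfold slice_point; rewrite qmulDl, qdotD, qdotZ, <- qmulA, qdotZ; ring.
Qed.

Lemma is_qderive_continuous (phi : R -> quat) (t : R) (d : quat) :
  is_qderive phi t d -> continuous phi t.
Proof.
intros H; apply continuous_qdot; intros c.
apply (ex_derive_continuous (V := R_NormedModule)); eexists; apply H.
Qed.

(** * Cauchy's formula on a slice *)

Lemma slice_point_scale (I : quat) (r t : R) :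
  slice_point I (r * cos t) (r * sin t) = (qreal r * qexp I t)%quat.
Proof. unfold qexp, slice_point; quat_ring. Qed.

Lemma slice_comm (I : quat) (x y s t : R) :
  (slice_point I x y * slice_point I s t)%quat = (slice_point I s t * slice_point I x y)%quat.
Proof. unfold slice_point; quat_ring. Qed.

Lemma circle_neq (z w : quat) (r : R) : qnorm z < r -> qnorm w = r -> (w - z)%quat <> 0%quat.
Proof. intros Hz Hw E; apply qsub_eq0 in E; subst; lra. Qed.

Lemma qRInt_exact (phi psi : R -> quat) (a b : R) :
  a <= b -> (forall t, a <= t <= b -> is_qderive phi t (psi t)) ->
  (forall t, a <= t <= b -> continuous psi t) ->
  qRInt psi a b = (phi b - phi a)%quat.
Proof.
intros Hab H H'; apply qdot_inj; intros c; rewrite <- RInt_qdot by auto.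
apply is_RInt_unique; rewrite qdotD, qdotN.
apply (is_RInt_derive (V := R_CompleteNormedModule) (fun t => qdot c (phi t))
  (fun t => qdot c (psi t)));
rewrite Rmin_left, Rmax_right by auto; intros t Ht; [now apply H|].
now apply continuous_qdot, H'.
Qed.

Lemma is_qderive_mul_l (p : quat) (phi : R -> quat) (t : R) (d : quat) :
  is_qderive phi t d -> is_qderive (fun s => p * phi s)%quat t (p * d)%quat.
Proof.
intros H c; rewrite qdotMl.
apply is_derive_ext with (fun s => qdot (qconj p * c)%quat (phi s)); [|apply H].
intros; now rewrite qdotMl.
Qed.

(* The circle of radius [r] is contracted to the point [x + y I] as [t] goes from 1 to 0. *)
Definition contraction (I : quat) (x y r t theta : R) : quat :=
  slice_point I (x + t * (r * cos theta - x)) (y + t * (r * sin theta - y)).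

(** The parameter may leave [0, 1] slightly, so that two-sided derivatives exist at both ends. With
    margin (1 - r)/4 one has |1 - t| + |t| <= 1 + (1 - r)/2, and r (1 + (1 - r)/2) < 1. *)
Lemma contraction_in_ball (I : quat) (x y r t theta : R) : imag_unit I ->
  qnorm (slice_point I x y) < r < 1 -> - ((1 - r) / 4) < t < 1 + (1 - r) / 4 ->
  in_ball (contraction I x y r t theta).
Proof.
intros HI Hr Ht; unfold in_ball.
replace (contraction I x y r t theta) with
  (qreal (1 - t) * slice_point I x y + qreal (t * r) * qexp I theta)%quat
  by (unfold contraction, qexp, slice_point; quat_ring).
apply Rle_lt_trans with (1 := qnormD _ _).
rewrite !qnormM, !qnorm_real, qexp_norm, Rmult_1_r, Rabs_mult by auto.
assert (H0 := qnorm_ge0 (slice_point I x y)).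
rewrite (Rabs_pos_eq r) by lra.
apply Rle_lt_trans with (Rabs (1 - t) * r + Rabs t * r).
- apply Rplus_le_compat_r, Rmult_le_compat_l; [apply Rabs_pos|lra].
- assert (Rabs (1 - t) + Rabs t <= 1 + (1 - r) / 2).
  { unfold Rabs; destruct (Rcase_abs (1 - t)); destruct (Rcase_abs t); lra. }
  rewrite <- Rmult_plus_distr_r; nra.
Qed.

Lemma contraction_dt (f : quat -> quat) (I : quat) (x y r t theta : R) :
  slice_regular f -> imag_unit I -> in_ball (contraction I x y r t theta) ->
  is_qderive (fun s => f (contraction I x y r s theta)) t
    ((qreal r * qexp I theta - slice_point I x y) *
     slice_dx f I (x + t * (r * cos theta - x)) (y + t * (r * sin theta - y)))%quat.
Proof.
intros H HI Hb.
replace (qreal r * qexp I theta - slice_point I x y)%quat with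
  (slice_point I (r * cos theta - x) (r * sin theta - y))
  by (unfold qexp, slice_point; quat_ring).
apply (slice_chain f I (fun s => x + s * (r * cos theta - x))
  (fun s => y + s * (r * sin theta - y))); auto; auto_derive; auto; ring.
Qed.

Lemma contraction_dtheta (f : quat -> quat) (I : quat) (x y r t theta : R) :
  slice_regular f -> imag_unit I -> in_ball (contraction I x y r t theta) ->
  is_qderive (fun s => f (contraction I x y r t s)) theta
    (qreal t * I * (qreal r * qexp I theta *
     slice_dx f I (x + t * (r * cos theta - x)) (y + t * (r * sin theta - y))))%quat.
Proof.
intros H HI Hb; rewrite qmulA.
replace (qreal t * I * (qreal r * qexp I theta))%quat with
  (slice_point I (- t * r * sin theta) (t * r * cos theta)).
2:{ unfold qexp, slice_point.
    transitivity (qreal (t * r * cos theta) * I + qreal (t * r * sin theta) * (I * I))%quat;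
    [rewrite HI|]; quat_ring. }
apply (slice_chain f I (fun s => x + t * (r * cos s - x))
  (fun s => y + t * (r * sin s - y))); auto; auto_derive; auto; ring.
Qed.

Lemma contraction_dx_continuous (f : quat -> quat) (I : quat) (x y r t theta : R) :
  slice_regular f -> imag_unit I -> in_ball (contraction I x y r t theta) ->
  continuous (fun p : R * R => slice_dx f I (x + fst p * (r * cos (snd p) - x))
    (y + fst p * (r * sin (snd p) - y))) (t, theta).
Proof.
intros H HI Hb.
apply (continuous_comp_2 (fun p : R * R => x + fst p * (r * cos (snd p) - x))
  (fun p : R * R => y + fst p * (r * sin (snd p) - y)) (slice_dx f I) (t, theta)).
- apply (continuous_Rplus (fun _ => x)); [apply continuous_const|].
  apply (continuous_Rmult fst); [apply continuous_fst|].
  apply (continuous_Rplus (fun p => r * cos (snd p)) (fun _ => - x)); [|apply continuous_const].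
  apply (continuous_Rmult (fun _ => r) (fun p => cos (snd p))); [apply continuous_const|].
  apply (continuous_comp snd cos); [apply continuous_snd|apply continuous_cos].
- apply (continuous_Rplus (fun _ => y)); [apply continuous_const|].
  apply (continuous_Rmult fst); [apply continuous_fst|].
  apply (continuous_Rplus (fun p => r * sin (snd p)) (fun _ => - y)); [|apply continuous_const].
  apply (continuous_Rmult (fun _ => r) (fun p => sin (snd p))); [apply continuous_const|].
  apply (continuous_comp snd sin); [apply continuous_snd|apply continuous_sin].
- destruct (H I HI _ _ Hb) as (_ & _ & C & _); exact C.
Qed.

(** With w = r e^(I theta) and dw = I w dtheta, this is the Cauchy kernel dw/(w - z) without its
    constant factor I. *)
Definition cauchy_kernel (I z : quat) (r theta : R) : quat :=
  (qreal r * qexp I theta * / (qreal r * qexp I theta - z))%quat.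

Lemma circle_norm (I : quat) (r t : R) : imag_unit I -> 0 <= r ->
  qnorm (qreal r * qexp I t)%quat = r.
Proof.
intros HI Hr; now rewrite qnormM, qnorm_real, qexp_norm, Rmult_1_r, Rabs_pos_eq.
Qed.

Lemma cauchy_kernel_cont (I z : quat) (r theta : R) : imag_unit I -> qnorm z < r ->
  continuous (cauchy_kernel I z r) theta.
Proof.
intros HI Hr; assert (H0 := qnorm_ge0 z).
assert (C : continuous (fun t => qreal r * qexp I t)%quat theta)
  by (apply continuous_qmul; [apply continuous_const|apply continuous_qexp]).
apply continuous_qmul; auto; apply continuous_qinv.
- apply continuous_qadd; [auto|apply continuous_const].
- apply circle_neq with r; auto; apply circle_norm; auto; lra.
Qed.

Lemma cauchy_kernel_mul (I z : quat) (r theta : R) : imag_unit I -> qnorm z < r ->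
  (cauchy_kernel I z r theta * (qreal r * qexp I theta - z))%quat = (qreal r * qexp I theta)%quat.
Proof.
intros HI Hr; assert (H0 := qnorm_ge0 z); unfold cauchy_kernel; rewrite <- qmulA, qmulVl.
- apply qmul1r.
- apply circle_neq with r; auto; apply circle_norm; auto; lra.
Qed.

(** The integral of kernel times [f] over the contracted loop does not depend on [t]. Its
    t-derivative has integrand K (w - z) f' = w f', since the kernel cancels w - z; for t <> 0 this
    is the angular derivative of [f] on the loop, up to the factor t I, so it integrates to 0 over a
    period. The two sides of the equation are the values at t = 1 and t = 0. *)
Lemma circle_contraction_constant (f : quat -> quat) (I : quat) (x y r : R) :
  slice_regular f -> imag_unit I -> qnorm (slice_point I x y) < r < 1 ->
  qRInt (fun s => cauchy_kernel I (slice_point I x y) r s * f (qreal r * qexp I s))%quat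
    0 (2 * PI) =
  (qRInt (cauchy_kernel I (slice_point I x y) r) 0 (2 * PI) * f (slice_point I x y))%quat.
Proof.
intros H HI Hr; set (z := slice_point I x y) in *; set (K := cauchy_kernel I z r).
assert (Hpi := PI_RGT_0); set (e := (1 - r) / 4).
assert (He : 0 < e) by (unfold e; lra).
assert (HB : forall t theta, - e < t < 1 + e -> in_ball (contraction I x y r t theta))
  by (intros; now apply contraction_in_ball).
assert (HK : forall theta, continuous K theta)
  by (intros; apply cauchy_kernel_cont; [auto|apply Hr]).
assert (HG : forall t theta, - e < t < 1 + e ->
  continuous (fun s => K s * f (contraction I x y r t s))%quat theta).
{ intros t theta Ht; apply continuous_qmul; auto.
  eapply is_qderive_continuous, contraction_dtheta; auto. }
assert (E1 : forall s, contraction I x y r 1 s = (qreal r * qexp I s)%quat)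
  by (intros; unfold contraction, qexp, slice_point; quat_ring).
assert (E0 : forall s, contraction I x y r 0 s = z)
  by (intros; unfold contraction, z, slice_point; quat_ring).
rewrite <- qRInt_mul_r by (auto; lra).
transitivity (qRInt (fun s => K s * f (contraction I x y r 1 s))%quat 0 (2 * PI)).
{ apply qRInt_ext; intros; now rewrite E1. }
transitivity (qRInt (fun s => K s * f (contraction I x y r 0 s))%quat 0 (2 * PI)).
2:{ apply qRInt_ext; intros; now rewrite E0. }
apply qdot_inj; intros c.
rewrite <- !RInt_qdot by (try lra; intros; apply HG; lra).
set (g := fun t theta => qdot c (K theta * f (contraction I x y r t theta))%quat).
set (D := fun t theta => (qreal r * qexp I theta *
  slice_dx f I (x + t * (r * cos theta - x)) (y + t * (r * sin theta - y)))%quat).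
assert (Hg : forall t theta, - e < t < 1 + e ->
  is_derive (fun s => g s theta) t (qdot c (D t theta))).
{ intros t theta Ht; unfold g, D.
  rewrite <- (cauchy_kernel_mul I z r theta HI (proj1 Hr)), <- qmulA.
  refine (is_qderive_mul_l _ _ _ _ _ c); apply contraction_dt; auto. }
assert (HD : forall t theta, - e < t < 1 + e ->
  continuous (fun p : R * R => D (fst p) (snd p)) (t, theta)).
{ intros t theta Ht; apply continuous_qmul.
  - apply continuous_qmul; [apply continuous_const|].
    apply (continuous_comp snd (qexp I)); [apply continuous_snd|apply continuous_qexp].
  - apply contraction_dx_continuous; auto. }
assert (HL : forall t0, 0 <= t0 <= 1 -> forall t, Rabs (t - t0) < e -> - e < t < 1 + e).
{ intros t0 Ht0 t Ht; apply Rabs_def2 in Ht; lra. }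
assert (Hder : forall t, 0 <= t <= 1 -> is_derive (fun s => RInt (g s) 0 (2 * PI)) t
  (RInt (fun theta => qdot c (D t theta)) 0 (2 * PI))).
{ intros t Ht.
  replace (RInt (fun theta => qdot c (D t theta)) 0 (2 * PI)) with
    (RInt (fun theta => Derive (fun s => g s theta) t) 0 (2 * PI)).
  2:{ apply RInt_ext; intros theta _; apply is_derive_unique, Hg; lra. }
  apply (is_derive_RInt_param g 0 (2 * PI) t).
  - exists (mkposreal _ He); intros s Hs theta _.
    change (Rabs (s - t) < e) in Hs; eexists; apply Hg; eauto.
  - intros theta _.
    apply continuity_2d_pt_ext_loc with (fun u v => qdot c (D u v)).
    + exists (mkposreal _ He); intros u v Hu _; simpl in Hu.
      symmetry; apply is_derive_unique, Hg; eauto.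
    + apply continuity_2d_pt_filterlim.
      assert (C := HD t theta ltac:(lra)); rewrite continuous_qdot in C; apply C.
  - exists (mkposreal _ He); intros s Hs; change (Rabs (s - t) < e) in Hs.
    apply (ex_RInt_continuous (V := R_CompleteNormedModule)); intros theta _.
    assert (C := HG s theta (HL t Ht s Hs)); rewrite continuous_qdot in C; apply C. }
assert (Hzero : forall t, 0 < t < 1 -> RInt (fun theta => qdot c (D t theta)) 0 (2 * PI) = 0).
{ intros t Ht.
  assert (CD : forall theta, continuous (D t) theta).
  { intros theta; apply (continuous_comp_2 (fun _ => t) (fun v => v) D theta).
    - apply continuous_const.
    - apply continuous_id.
    - apply HD; lra. }
  rewrite RInt_qdot by (auto; lra).
  (* The angular derivative carries the factor t I, whose inverse is -(1/t) I. *)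
  rewrite (qRInt_exact (fun s => - (qreal (/ t) * I) * f (contraction I x y r t s))%quat).
  - unfold contraction; rewrite cos_2PI, sin_2PI, cos_0, sin_0, qaddN; apply qdot0.
  - lra.
  - intros theta _.
    replace (D t theta) with (- (qreal (/ t) * I) * (qreal t * I * D t theta))%quat.
    + apply is_qderive_mul_l, contraction_dtheta; auto; apply HB; lra.
    + transitivity (- (qreal (/ t * t) * (I * I) * D t theta))%quat;
      [generalize (D t theta); quat_ring|].
      rewrite HI, Rinv_l by lra; generalize (D t theta); quat_ring.
  - auto. }
(* The derivative is known to vanish only for 0 < t < 1, because of the division by [t]; continuity
   at the ends suffices for the mean value theorem. *)
destruct (MVT_gen (fun s => RInt (g s) 0 (2 * PI)) 0 1 (fun _ => 0)) as (u & _ & Hu).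
- rewrite Rmin_left, Rmax_right by lra; intros t Ht.
  assert (Q := Hder t ltac:(lra)); rewrite (Hzero t Ht) in Q; exact Q.
- rewrite Rmin_left, Rmax_right by lra; intros t Ht; apply continuity_pt_filterlim.
  apply (ex_derive_continuous (V := R_NormedModule) (fun s => RInt (g s) 0 (2 * PI))).
  eexists; now apply Hder.
- unfold g in Hu; lra.
Qed.

(** With v the inverse of the point w of the circle, K = 1 + z v K, iterated n + 1 times. Only [z]
    and [v], which lie in the same slice, have to commute; [p] is arbitrary and stays on the
    right. *)
Lemma cauchy_kernel_geometric (I : quat) (x y r : R) (theta : R) (n : nat) (p : quat) :
  imag_unit I -> qnorm (slice_point I x y) < r ->
  let z := slice_point I x y in
  let v := (qreal (/ r) * qexp I (- theta))%quat in
  (cauchy_kernel I z r theta * p)%quat =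
  (sum_n (fun k => qpow z k * (qpow v k * p))%quat n +
   qpow z (S n) * (qpow v (S n) * (cauchy_kernel I z r theta * p)))%quat.
Proof.
intros HI Hr z v; assert (H0 := qnorm_ge0 z); fold z in Hr.
set (K := cauchy_kernel I z r theta).
assert (Hv : (v * (qreal r * qexp I theta))%quat = 1%quat).
{ unfold v; transitivity (qreal (/ r * r) * (qexp I (- theta) * qexp I theta))%quat.
  - generalize (qexp I (- theta)) (qexp I theta); quat_ring.
  - rewrite qexp_add, Rplus_opp_l, qexp_0, Rinv_l by (auto; lra); quat_ring. }
assert (Czv : (z * v)%quat = (v * z)%quat).
{ unfold v; rewrite <- slice_point_scale; apply slice_comm. }
assert (Cw : (qreal r * qexp I theta * z)%quat = (z * (qreal r * qexp I theta))%quat).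
{ rewrite <- slice_point_scale; apply slice_comm. }
set (w := (qreal r * qexp I theta)%quat) in *.
assert (Hwz : (w - z)%quat <> 0%quat)
  by (apply circle_neq with r; auto; apply circle_norm; auto; lra).
assert (HK : K = (1 + z * (v * K))%quat).
{ unfold K, cauchy_kernel; fold w; rewrite (qmulA v), Hv, qmul1l.
  rewrite <- (qmulV _ Hwz), <- qmulDl; f_equal; quat_ring. }
clearbody K v z.
assert (Hstep : forall m, (qpow z m * (qpow v m * (K * p)))%quat =
  (qpow z m * (qpow v m * p) + qpow z (S m) * (qpow v (S m) * (K * p)))%quat).
{ intros m; rewrite HK at 1.
  rewrite !qpowS, (qpow_comm z m), (qpow_comm v m).
  transitivity (qpow z m * (qpow v m * p) + qpow z m * ((qpow v m * z) * (v * (K * p))))%quat.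
  - qdistr.
  - rewrite <- (qpow_comm_gen z v m Czv); qdistr. }
induction n as [|n IH].
- rewrite sum_O; etransitivity; [|exact (Hstep 0%nat)].
  change (K * p = 1 * (1 * (K * p)))%quat; generalize (K * p)%quat; quat_ring.
- etransitivity; [exact IH|]; rewrite (Hstep (S n)), sum_Sn; apply qaddA.
Qed.

(** The finite geometric identity is integrated and its remainder bounded by (|z|/r)^(n+1) times 2
    pi M, where M bounds the integrand, so sum and integral are exchanged by an explicit
    estimate. *)
Lemma cauchy_kernel_series (I : quat) (x y r : R) (phi : R -> quat) :
  imag_unit I -> qnorm (slice_point I x y) < r ->
  (forall t, continuous phi t) ->
  is_qsum (fun n => qpow (slice_point I x y) n *
    qRInt (fun t => qpow (qreal (/ r) * qexp I (- t)) n * phi t) 0 (2 * PI))%quat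
    (qRInt (fun t => cauchy_kernel I (slice_point I x y) r t * phi t)%quat 0 (2 * PI)).
Proof.
intros HI Hr Hphi; set (z := slice_point I x y) in *.
assert (Hpi := PI_RGT_0); assert (H0 := qnorm_ge0 z).
set (v := fun t => (qreal (/ r) * qexp I (- t))%quat).
assert (Cv : forall n t, continuous (fun t => qpow (v t) n) t).
{ induction n as [|n IH]; intros t.
  - apply (continuous_ext (fun _ => 1%quat)); [reflexivity|apply continuous_const].
  - apply continuous_qmul; auto; apply continuous_qmul; [apply continuous_const|].
    apply (continuous_comp Ropp (qexp I)); [|apply continuous_qexp].
    apply (continuous_opp (V := R_NormedModule)), continuous_id. }
assert (CK : forall t, continuous (fun t => cauchy_kernel I z r t * phi t)%quat t)
  by (intros; apply continuous_qmul; auto; now apply cauchy_kernel_cont).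
destruct (qnorm_bounded (fun t => cauchy_kernel I z r t * phi t)%quat 0 (2 * PI)
  ltac:(lra) (fun t _ => CK t)) as [M HM].
assert (CT : forall n p t, (forall t, continuous p t) ->
  continuous (fun t => qpow z n * (qpow (v t) n * p t))%quat t).
{ intros n p t Hp; apply continuous_qmul; [apply continuous_const|].
  apply continuous_qmul; auto. }
set (u := fun n => (qpow z n * qRInt (fun t => qpow (v t) n * phi t) 0 (2 * PI))%quat).
set (L := qRInt (fun t => cauchy_kernel I z r t * phi t)%quat 0 (2 * PI)).
assert (Esum : forall n, qRInt (fun t => sum_n (fun k => qpow z k * (qpow (v t) k * phi t))%quat n)
  0 (2 * PI) = sum_n u n /\
  forall t, continuous (fun t => sum_n (fun k => qpow z k * (qpow (v t) k * phi t))%quat n) t).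
{ assert (Eu : forall n, qRInt (fun t => qpow z n * (qpow (v t) n * phi t))%quat 0 (2 * PI) = u n).
  { intros n; apply (qRInt_mul_l (qpow z n) (fun t => qpow (v t) n * phi t)%quat); [lra|].
    intros; apply continuous_qmul; auto. }
  induction n as [|n [IH1 IH2]].
  - rewrite sum_O, <- Eu; split.
    + apply qRInt_ext; intros; now rewrite sum_O.
    + intros t; apply continuous_ext with (2 := CT O phi t Hphi); intros; now rewrite sum_O.
  - rewrite sum_Sn, <- IH1, <- Eu; split.
    + rewrite <- qRInt_plus by (auto; lra).
      apply qRInt_ext; intros; now rewrite sum_Sn.
    + intros t; apply continuous_ext with (2 := continuous_qadd _ _ t (IH2 t) (CT (S n) phi t Hphi)).
      intros; now rewrite sum_Sn. }
assert (Erem : forall n, qnorm (sum_n u n - L)%quat <= (qnorm z / r) ^ S n * (2 * PI * M)).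
{ intros n; set (rem := fun t => (qpow z (S n) * (qpow (v t) (S n) *
    (cauchy_kernel I z r t * phi t)))%quat).
  assert (Crem : forall t, continuous rem t) by (intros; now apply CT).
  replace L with (sum_n u n + qRInt rem 0 (2 * PI))%quat.
  - replace (sum_n u n - (sum_n u n + qRInt rem 0 (2 * PI)))%quat with (- qRInt rem 0 (2 * PI))%quat
      by (generalize (sum_n u n : quat) (qRInt rem 0 (2 * PI)); quat_ring).
    rewrite qnormN.
    replace ((qnorm z / r) ^ S n * (2 * PI * M)) with
      ((2 * PI - 0) * ((qnorm z / r) ^ S n * M)) by ring.
    apply qRInt_norm_le; auto; [lra|].
    intros t Ht; unfold rem; rewrite qnormM, (qnormM (qpow (v t) (S n))), !qnorm_pow.
    unfold v; rewrite circle_norm; [|auto|left; apply Rinv_0_lt_compat; lra].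
    rewrite <- Rmult_assoc, <- Rpow_mult_distr; apply Rmult_le_compat_l; auto.
    apply pow_le, Rmult_le_pos; auto; left; apply Rinv_0_lt_compat; lra.
  - rewrite <- (proj1 (Esum n)), <- qRInt_plus; auto; [|lra|intros; apply Esum].
    apply qRInt_ext; intros t _; symmetry; now apply cauchy_kernel_geometric. }
change (filterlim (sum_n u) eventually (locally L)).
apply filterlim_locally; intros eps.
assert (Hq : Rabs (qnorm z / r) < 1).
{ rewrite Rabs_pos_eq; [apply Rlt_div_l; lra|apply Rmult_le_pos; auto; left; apply Rinv_0_lt_compat; lra]. }
assert (Hl : is_lim_seq (fun n => (qnorm z / r) ^ S n * (2 * PI * M)) (0 * (2 * PI * M))).
{ apply (is_lim_seq_scal_r (fun n => (qnorm z / r) ^ S n) _ 0).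
  apply (is_lim_seq_incr_1 (fun n => (qnorm z / r) ^ n)), is_lim_seq_geom, Hq. }
rewrite Rmult_0_l in Hl.
generalize (proj1 (filterlim_locally _ _) Hl eps); apply filter_imp; intros n Hn.
change (Rabs ((qnorm z / r) ^ S n * (2 * PI * M) - 0) < eps) in Hn.
change (qnorm (sum_n u n - L)%quat < eps).
apply Rle_lt_trans with (1 := Erem n), Rle_lt_trans with (2 := Hn).
rewrite Rminus_0_r; apply Rle_abs.
Qed.

Lemma qpow_circle_inv (I : quat) (r t : R) (n : nat) : imag_unit I ->
  qpow (qreal (/ r) * qexp I (- t)) n = (qreal (/ r ^ n) * qexp I (- INR n * t))%quat.
Proof.
intros HI; induction n as [|n IH].
- simpl INR; simpl pow; rewrite Ropp_0, Rmult_0_l, qexp_0, Rinv_1.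
  change (1 = qreal 1 * 1)%quat; quat_ring.
- rewrite qpowS, IH, S_INR.
  replace (- (INR n + 1) * t) with (- t + - INR n * t) by ring.
  rewrite <- qexp_add by auto; simpl pow; rewrite Rinv_mult.
  generalize (qexp I (- t)) (qexp I (- INR n * t)); quat_ring.
Qed.

(** For the constant function 1 every term of positive order in the kernel series is the integral of
    a nontrivial exponential over its period, hence 0. *)
Lemma qRInt_cauchy_kernel (I : quat) (x y r : R) :
  imag_unit I -> qnorm (slice_point I x y) < r ->
  qRInt (cauchy_kernel I (slice_point I x y) r) 0 (2 * PI) = qreal (2 * PI).
Proof.
intros HI Hr; assert (Hpi := PI_RGT_0).
assert (S := cauchy_kernel_series I x y r (fun _ => 1%quat) HI Hr (fun t => continuous_const _ _)).
set (u := fun n => _) in S.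
assert (Hu : forall n, u (Datatypes.S n) = 0%quat).
{ intros n; unfold u.
  rewrite (qRInt_ext _ (fun t => qreal (/ r ^ (Datatypes.S n)) * qexp I (- INR (Datatypes.S n) * t))%quat).
  - rewrite qRInt_mul_l, qRInt_qexp; auto; [|lra|intros; apply continuous_qexp_lin].
    generalize (qpow (slice_point I x y) (Datatypes.S n)); quat_ring.
  - intros t _; rewrite qmul1r; now apply qpow_circle_inv. }
assert (E := is_qsum_unique _ _ _ S (is_qsum_head u Hu)).
transitivity (qRInt (fun t => cauchy_kernel I (slice_point I x y) r t * 1)%quat 0 (2 * PI)).
- apply qRInt_ext; intros; now rewrite qmul1r.
- rewrite E; unfold u.
  change (1 * qRInt (fun _ => 1 * 1) 0 (2 * PI) = qreal (2 * PI))%quat.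
  unfold qRInt; apply quat_ext; simpl; rewrite !RInt_const; unfold scal; simpl;
  unfold mult; simpl; ring.
Qed.

Definition slice_coef (f : quat -> quat) (I : quat) (r : R) (n : nat) : quat :=
  (qreal (/ (2 * PI) * / r ^ n) *
   qRInt (fun t => qexp I (- INR n * t) * f (qreal r * qexp I t)) 0 (2 * PI))%quat.

Lemma circle_continuous (f : quat -> quat) (I : quat) (r t : R) :
  slice_regular f -> imag_unit I -> 0 <= r < 1 ->
  continuous (fun s => f (qreal r * qexp I s))%quat t.
Proof.
intros H HI Hr.
assert (D := slice_chain f I (fun s => r * cos s) (fun s => r * sin s) t
  (- r * sin t) (r * cos t) H HI).
apply (continuous_ext (fun s => f (slice_point I (r * cos s) (r * sin s)))).
{ intros s; now rewrite slice_point_scale. }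
eapply is_qderive_continuous, D; try (auto_derive; auto; ring).
rewrite slice_point_scale; unfold in_ball; rewrite circle_norm; auto; lra.
Qed.

Lemma slice_coef_series (f : quat -> quat) (I : quat) (x y r : R) :
  slice_regular f -> imag_unit I -> qnorm (slice_point I x y) < r < 1 ->
  is_qseries (slice_coef f I r) (slice_point I x y) (f (slice_point I x y)).
Proof.
intros H HI Hr; set (z := slice_point I x y) in *; assert (H0 := qnorm_ge0 z).
assert (Hpi := PI_RGT_0).
assert (Cf : forall t, continuous (fun s => f (qreal r * qexp I s))%quat t)
  by (intros; apply circle_continuous; auto; lra).
assert (S := cauchy_kernel_series I x y r _ HI (proj1 Hr) Cf).
unfold z in Hr, S; cbv beta in S; rewrite circle_contraction_constant, qRInt_cauchy_kernel in S by (auto; lra).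
fold z in S, Hr; apply is_qseriesE.
assert (S' := is_qsum_mul_l (qreal (/ (2 * PI))) _ _ S).
replace (qreal (/ (2 * PI)) * (qreal (2 * PI) * f z))%quat with (f z) in S'.
2:{ rewrite qmulA; replace (qreal (/ (2 * PI)) * qreal (2 * PI))%quat with 1%quat.
    - symmetry; apply qmul1l.
    - apply quat_ext; unfold qreal; simpl; field; lra. }
apply is_qsum_ext with (2 := S'); intros n; unfold slice_coef.
rewrite (qRInt_ext _ (fun t => qreal (/ r ^ n) * (qexp I (- INR n * t) * f (qreal r * qexp I t)))%quat).
2:{ intros t _; rewrite qpow_circle_inv by auto; symmetry; apply qmulA. }
rewrite qRInt_mul_l.
- generalize (qpow z n) (qRInt (fun t => qexp I (- INR n * t) * f (qreal r * qexp I t))%quat 0 (2 * PI)).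
  quat_ring.
- lra.
- intros; apply continuous_qmul; auto; apply continuous_qexp_lin.
Qed.

(** All slices share the real axis, where both Cauchy series converge to [f]. This glues the
    slicewise expansions into one. *)
Lemma slice_coef_unique (f : quat -> quat) (I J : quat) (r s : R) (n : nat) :
  slice_regular f -> imag_unit I -> imag_unit J -> 0 < r < 1 -> 0 < s < 1 ->
  slice_coef f I r n = slice_coef f J s n.
Proof.
intros H HI HJ Hr Hs; apply (qseries_unique _ _ (Rmin r s)).
- apply Rmin_glb_lt; lra.
- intros x Hx; exists (f (qreal x)).
  assert (Hx' : Rabs x < r /\ Rabs x < s).
  { split; apply Rlt_le_trans with (1 := Hx); [apply Rmin_l|apply Rmin_r]. }
  assert (E : forall K, slice_point K x 0 = qreal x) by (intros; unfold slice_point; quat_ring).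
  split; [rewrite <- (E I)|rewrite <- (E J)]; apply slice_coef_series; auto;
  rewrite E, qnorm_real; lra.
Qed.

Lemma slice_regular_expansion (f : quat -> quat) :
  slice_regular f -> exists a, has_expansion f a.
Proof.
intros H; pose (i := mkQuat 0 1 0 0).
assert (Hi : imag_unit i) by (unfold imag_unit, i; quat_ring).
(* The reference slice and radius are arbitrary: at each [q] the series is taken in the slice of [q]
   on a circle of radius (|q| + 1)/2, and its coefficients are then identified with these. *)
exists (slice_coef f i (1 / 2)); intros q Hq.
destruct (slice_unit_spec q) as [HI E].
set (I := slice_unit q) in *; set (x := q_re q) in *; set (y := vec_norm q) in *.
unfold in_ball in Hq; assert (H0 := qnorm_ge0 q).
assert (S := slice_coef_series f I x y ((qnorm q + 1) / 2) H HI).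
rewrite <- E in S; specialize (S ltac:(lra)).
apply is_qsum_ext with (2 := S); intros n.
f_equal; apply slice_coef_unique; auto; lra.
Qed.

Lemma expansion_slice_coef (f : quat -> quat) (a : nat -> quat) (I : quat) (r : R) (n : nat) :
  has_expansion f a -> imag_unit I -> 0 < r < 1 -> a n = slice_coef f I r n.
Proof.
intros H HI Hr; assert (Hreg := expansion_slice_regular _ _ H).
apply (qseries_unique _ _ r); [lra|]; intros x Hx; exists (f (qreal x)).
split; [apply H, real_in_ball; lra|].
replace (qreal x) with (slice_point I x 0) by (unfold slice_point; quat_ring).
apply slice_coef_series; auto.
replace (slice_point I x 0) with (qreal x) by (unfold slice_point; quat_ring).
rewrite qnorm_real; lra.
Qed.

(** * The regular quotient *)

Lemma slice_pow_bound (x y : R) (n : nat) :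
  Rabs (fst (slice_pow x y n)) <= sqrt (x * x + y * y) ^ n /\
  Rabs (snd (slice_pow x y n)) <= sqrt (x * x + y * y) ^ n.
Proof.
pose (i := mkQuat 0 1 0 0).
assert (Hi : imag_unit i) by (unfold imag_unit, i; quat_ring).
rewrite <- (slice_norm i x y Hi), <- qnorm_pow, (qpow_slice i x y n Hi).
destruct (slice_pow x y n) as [c s]; simpl fst; simpl snd; split.
- replace c with (q_re (qreal c + qreal s * i)%quat) at 1 by (unfold i; simpl; ring).
  apply q_re_le.
- rewrite <- (Rmult_1_l (qnorm _)), <- (imag_unit_norm i Hi).
  replace s with (qdot i (qreal c + qreal s * i)%quat) at 1 by (unfold qdot, i; simpl; ring).
  apply qdot_le.
Qed.

Definition slice_cos_part (b : nat -> quat) (x y : R) (n : nat) : quat :=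
  (qreal (fst (slice_pow x y n)) * b n)%quat.

Definition slice_sin_part (b : nat -> quat) (x y : R) (n : nat) : quat :=
  (qreal (snd (slice_pow x y n)) * b n)%quat.

(** The representation formula: on the sphere x + y S a slice regular function is affine in the
    imaginary unit, with [A] and [B] independent of it. *)
Lemma slice_parts (b : nat -> quat) (x y : R) :
  summable_on_ball b -> x * x + y * y < 1 ->
  exists A B, is_qsum (slice_cos_part b x y) A /\ is_qsum (slice_sin_part b x y) B /\
    ex_series (fun n => qnorm (slice_cos_part b x y n)) /\
    ex_series (fun n => qnorm (slice_sin_part b x y n)) /\
    forall g I, has_expansion g b -> imag_unit I -> g (slice_point I x y) = (A + I * B)%quat.
Proof.
intros Hb Hxy; set (r := sqrt (x * x + y * y)).
assert (Hr : 0 <= r < 1).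
{ split; [apply sqrt_pos|unfold r; rewrite <- sqrt_1; apply sqrt_lt_1_alt; nra]. }
assert (N : forall n, qnorm (slice_cos_part b x y n) <= qnorm (b n) * r ^ n /\
  qnorm (slice_sin_part b x y n) <= qnorm (b n) * r ^ n).
{ intros n; unfold slice_cos_part, slice_sin_part; rewrite !qnormM, !qnorm_real.
  destruct (slice_pow_bound x y n) as [H1 H2]; fold r in H1, H2.
  split; rewrite Rmult_comm; apply Rmult_le_compat_l; auto; apply qnorm_ge0. }
destruct (ex_qsum_abs _ _ (fun n => proj1 (N n)) (Hb r Hr)) as [A HA].
destruct (ex_qsum_abs _ _ (fun n => proj2 (N n)) (Hb r Hr)) as [B HB].
exists A, B; repeat split; auto.
- apply ex_series_le_R with (2 := Hb r Hr); intros n; split; [apply qnorm_ge0|apply N].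
- apply ex_series_le_R with (2 := Hb r Hr); intros n; split; [apply qnorm_ge0|apply N].
- intros g I Hg HI; apply slice_in_ball with (1 := HI) in Hxy.
  apply (is_qsum_unique _ _ _ (Hg _ Hxy)).
  apply is_qsum_ext with (2 := is_qsum_plus _ _ _ _ HA (is_qsum_mul_l I _ _ HB)).
  intros n; unfold slice_cos_part, slice_sin_part.
  change (qreal (fst (slice_pow x y n)) * b n + I * (qreal (snd (slice_pow x y n)) * b n)
    = qpow (slice_point I x y) n * b n)%quat.
  rewrite (qpow_slice I x y n HI), (qmulA I), <- (qrealC _ I); qdistr.
Qed.

Lemma qmul_sum_n (p : quat) (u : nat -> quat) (n : nat) :
  (p * sum_n u n)%quat = sum_n (fun k => p * u k)%quat n.
Proof.
induction n as [|n IH]; [now rewrite !sum_O|].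
rewrite !sum_Sn, <- IH; apply qmulDr.
Qed.

Lemma qadd_sum_n (u v : nat -> quat) (n : nat) :
  (sum_n u n + sum_n v n)%quat = sum_n (fun k => u k + v k)%quat n.
Proof. symmetry; apply (sum_n_plus u v n). Qed.

Lemma qconv_plus_mul (a b c d e : nat -> quat) (I : quat) (n : nat) :
  (forall k, (k <= n)%nat -> (a k * b (n - k)%nat + I * (a k * c (n - k)%nat))%quat
    = (d n * (e k))%quat) ->
  (qconv a b n + I * qconv a c n)%quat = (d n * sum_n e n)%quat.
Proof.
intros H; unfold qconv; rewrite !qmul_sum_n, qadd_sum_n; now apply sum_n_ext_loc.
Qed.

Lemma qmul_slice_split (p I a b : quat) (c s : R) : (I * p)%quat = (p * I)%quat ->
  (p * a * (qreal c * b) + I * (p * a * (qreal s * b)) =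
   p * (qreal c + qreal s * I) * (a * b))%quat.
Proof.
intros C; rewrite (qmulA (p * a) _ b), <- (qrealC c), (qmulA (p * a) _ b), <- (qrealC s).
transitivity (qreal c * (p * a) * b + qreal s * (I * p) * (a * b))%quat.
- rewrite !qmulA, (qrealC s I); reflexivity.
- rewrite C, qmulDr, qmulDl, (qmulA p), <- (qrealC s p), <- (qrealC c p); qdistr.
Qed.

(** If g = A + J B on the sphere, then f * g at z = x + y I is f(z) A + I f(z) B. For f(z) <> 0 this
    is f(z) times the value of g at f(z)^-1 z f(z), the unit J being f(z)^-1 I f(z). Stated without
    inverses it needs no case distinction. *)
Lemma slice_conv (f : quat -> quat) (a b : nat -> quat) (x y : R) (A B I : quat) :
  has_expansion f a -> x * x + y * y < 1 -> imag_unit I ->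
  is_qsum (slice_cos_part b x y) A -> is_qsum (slice_sin_part b x y) B ->
  ex_series (fun n => qnorm (slice_cos_part b x y n)) ->
  ex_series (fun n => qnorm (slice_sin_part b x y n)) ->
  is_qseries (qconv a b) (slice_point I x y)
    (f (slice_point I x y) * A + I * (f (slice_point I x y) * B))%quat.
Proof.
intros Hf Hxy HI HA HB SA SB; set (z := slice_point I x y).
assert (Hz : in_ball z) by now apply slice_in_ball.
assert (Sf := summable_abs a z (expansion_summable _ _ Hf) Hz).
assert (Hfz := proj1 (is_qseriesE _ _ _) (Hf z Hz)).
apply is_qsum_ext with (2 := is_qsum_plus _ _ _ _ (is_qsum_conv _ _ _ _ Hfz HA Sf SA)
  (is_qsum_mul_l I _ _ (is_qsum_conv _ _ _ _ Hfz HB Sf SB))).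
intros n; apply (qconv_plus_mul _ _ _ (fun n => qpow z n)); intros k Hk.
replace (qpow z n) with (qpow z k * qpow z (n - k))%quat
  by (rewrite <- qpow_add; f_equal; lia).
unfold slice_cos_part, slice_sin_part, z at 4; rewrite (qpow_slice I x y (n - k) HI).
fold z.
destruct (slice_pow x y (n - k)) as [c s]; simpl fst; simpl snd.
assert (C : (I * qpow z k)%quat = (qpow z k * I)%quat)
  by (apply qpow_comm_gen; unfold z, slice_point; quat_ring).
now apply qmul_slice_split.
Qed.

(** Real powers commute with the coefficients, so on the real axis the regular product is the
    pointwise one. *)
Lemma conv_real (f g : quat -> quat) (a b : nat -> quat) (x : R) :
  has_expansion f a -> has_expansion g b -> Rabs x < 1 ->
  is_qseries (qconv a b) (qreal x) (f (qreal x) * g (qreal x))%quat.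
Proof.
intros Hf Hg Hx; apply real_in_ball in Hx.
assert (Sf := summable_abs a _ (expansion_summable _ _ Hf) Hx).
assert (Sg := summable_abs b _ (expansion_summable _ _ Hg) Hx).
apply is_qsum_ext with (2 := is_qsum_conv _ _ _ _ (proj1 (is_qseriesE _ _ _) (Hf _ Hx))
  (proj1 (is_qseriesE _ _ _) (Hg _ Hx)) Sf Sg).
intros n; unfold qconv; rewrite qmul_sum_n; apply sum_n_ext_loc; intros k Hk.
change (qpow (qreal x) k * a k * (qpow (qreal x) (n - k) * b (n - k)%nat) =
  qpow (qreal x) n * (a k * b (n - k)%nat))%quat.
replace (qpow (qreal x) n) with (qpow (qreal x) k * qpow (qreal x) (n - k))%quat
  by (rewrite <- qpow_add; f_equal; lia).
rewrite !qpow_real, (qmulA _ (qreal (x ^ (n - k)))), <- (qmulA _ (a k)), <- qrealC; qdistr.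
Qed.

Lemma expansion_conv (a b : nat -> quat) :
  summable_on_ball a -> summable_on_ball b ->
  has_expansion (qseries (qconv a b)) (qconv a b).
Proof. intros; now apply summable_expansion, summable_conv. Qed.

Lemma qseries_conv_real (f g : quat -> quat) (a b : nat -> quat) (x : R) :
  has_expansion f a -> has_expansion g b -> Rabs x < 1 ->
  qseries (qconv a b) (qreal x) = (f (qreal x) * g (qreal x))%quat.
Proof. intros; now apply qseries_eq, conv_real. Qed.

Lemma summable_qconj (a : nat -> quat) :
  summable_on_ball a -> summable_on_ball (fun n => qconj (a n)).
Proof.
intros H r Hr; apply ex_series_ext with (2 := H r Hr); intros n; now rewrite qnorm_conj.
Qed.

Lemma is_qsum_qconj (u : nat -> quat) (l : quat) :
  is_qsum u l -> is_qsum (fun n => qconj (u n)) (qconj l).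
Proof.
assert (E : forall c q, qdot (qconj c) q = qdot c (qconj q)) by qdot_ring.
rewrite !is_qsum_qdot; intros H c; rewrite <- E.
apply is_series_ext with (2 := H (qconj c)); intros n; apply E.
Qed.

Lemma qseries_qconj_real (f : quat -> quat) (a : nat -> quat) (x : R) :
  has_expansion f a -> Rabs x < 1 ->
  is_qseries (fun n => qconj (a n)) (qreal x) (qconj (f (qreal x))).
Proof.
intros H Hx; apply real_in_ball in Hx.
apply is_qsum_ext with (2 := is_qsum_qconj _ _ (H _ Hx)); intros n.
change (qconj (qpow (qreal x) n * a n) = qpow (qreal x) n * qconj (a n))%quat.
rewrite qconjM, qpow_real, qrealC; f_equal; unfold qreal; quat_ring.
Qed.

Lemma qconj_fixed (q : quat) : qconj q = q -> q = qreal (q_re q).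
Proof.
intros H; assert (H1 := f_equal q_i H); assert (H2 := f_equal q_j H);
assert (H3 := f_equal q_k H); simpl in *; apply quat_ext; simpl; lra.
Qed.

(** At a real point the symmetrization equals f times its conjugate, which is self-conjugate; a
    sequence and its conjugate with the same sums there coincide. *)
Lemma symmetrization_real_coefs (f : quat -> quat) (a : nat -> quat) (n : nat) :
  has_expansion f a ->
  qconj (qconv a (fun k => qconj (a k)) n) = qconv a (fun k => qconj (a k)) n.
Proof.
intros H; set (b := fun k => qconj (a k)).
assert (Sa := expansion_summable _ _ H).
assert (B := summable_expansion b (summable_qconj _ Sa)).
apply (qseries_unique (fun n => qconj (qconv a b n)) (qconv a b) 1); [lra|].
intros x Hx; exists (f (qreal x) * qconj (f (qreal x)))%quat.
assert (E : qseries b (qreal x) = qconj (f (qreal x)))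
  by now apply qseries_eq, qseries_qconj_real.
assert (C := conv_real f (qseries b) a b x H B Hx); rewrite E in C; split; auto.
assert (D := qseries_qconj_real _ _ x (expansion_conv a b Sa (summable_qconj _ Sa)) Hx).
rewrite (qseries_eq _ _ _ C), qconjM, qconjK in D; exact D.
Qed.

Lemma real_coefs_commute (g : quat -> quat) (a : nat -> quat) (I : quat) (x y : R) :
  has_expansion g a -> (forall n, qconj (a n) = a n) -> imag_unit I ->
  in_ball (slice_point I x y) ->
  (I * g (slice_point I x y))%quat = (g (slice_point I x y) * I)%quat.
Proof.
intros H Ha HI Hb; set (z := slice_point I x y) in *.
assert (G := proj1 (is_qseriesE _ _ _) (H z Hb)).
apply (is_qsum_unique _ _ _ (is_qsum_mul_l I _ _ G)).
apply is_qsum_ext with (2 := is_qsum_mul_r I _ _ G); intros n.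
rewrite (qconj_fixed _ (Ha n)), <- qmulA, qrealC, !qmulA; f_equal.
symmetry; apply qpow_comm_gen; unfold z, slice_point; quat_ring.
Qed.

Lemma conjugate_imag_unit (p K : quat) : p <> 0%quat -> imag_unit K ->
  imag_unit (p * K * / p)%quat.
Proof.
intros Hp HK; unfold imag_unit.
transitivity (p * K * (/ p * p) * K * / p)%quat; [qdistr|].
rewrite qmulVl, qmul1r, <- (qmulA p K K), HK by auto.
transitivity (- (p * / p))%quat; [quat_ring|now rewrite qmulV].
Qed.

Lemma conjugate_imag_unit' (p K : quat) : p <> 0%quat -> imag_unit K ->
  imag_unit (/ p * K * p)%quat.
Proof.
intros Hp HK; unfold imag_unit.
transitivity (/ p * K * (p * / p) * K * p)%quat; [qdistr|].
rewrite qmulV, qmul1r, <- (qmulA _ K K), HK by auto.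
transitivity (- (/ p * p))%quat; [quat_ring|now rewrite qmulVl].
Qed.

Lemma imag_unitN (K : quat) : imag_unit K -> imag_unit (- K)%quat.
Proof. intros H; unfold imag_unit; rewrite <- H; quat_ring. Qed.

(* If [b = c K] with [c <> 0], then [b + J c] vanishes at [J = - c K c^-1]. *)
Lemma sphere_nonvanishing (b c : quat) :
  (forall J, imag_unit J -> (b + J * c)%quat <> 0%quat) ->
  forall K, imag_unit K -> (b - c * K)%quat <> 0%quat.
Proof.
intros H K HK E; apply qsub_eq0 in E.
destruct (Req_dec (qnorm c) 0) as [Hc|Hc].
- apply qnorm_eq0 in Hc; apply (H K HK); rewrite E, Hc; quat_ring.
- assert (Hc' : c <> 0%quat) by (intros ->; apply Hc, qnorm0).
  apply (H (- (c * K * / c))%quat).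
  + now apply imag_unitN, conjugate_imag_unit.
  + transitivity (b - c * K * (/ c * c))%quat; [generalize (/ c)%quat; quat_ring|].
    rewrite qmulVl, qmul1r, E by auto; apply qaddN.
Qed.

(** Write f = b + J c on the sphere of [q], k = f(q) and K = k^-1 I k. Since the conjugate of K is
    -K, the symmetrization at [q] equals k times the conjugate of b - c K, so a zero of it would
    produce a zero of [f] somewhere on the sphere. *)
Lemma symmetrization_nonvanishing (f : quat -> quat) (a : nat -> quat) (q : quat) :
  has_expansion f a -> (forall q, in_ball q -> f q <> 0%quat) -> in_ball q ->
  qseries (qconv a (fun n => qconj (a n))) q <> 0%quat.
Proof.
intros H Hf Hq; destruct (slice_unit_spec q) as [HI E].
set (I := slice_unit q) in *; set (x := q_re q) in *; set (y := vec_norm q) in *.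
assert (Hz : in_ball (slice_point I x y)) by now rewrite <- E.
assert (Hxy : x * x + y * y < 1) by now apply slice_in_ball in Hz.
destruct (slice_parts a x y (expansion_summable _ _ H) Hxy) as (b & c & Hb & Hc & Sb & Sc & HB).
assert (N : forall J, imag_unit J -> (b + J * c)%quat <> 0%quat).
{ intros J HJ; rewrite <- (HB f J H HJ); apply Hf; now apply slice_in_ball. }
assert (Econj : forall (t : R) p, qconj (qreal t * p) = (qreal t * qconj p)%quat) by quat_ring.
assert (V : is_qseries (qconv a (fun n => qconj (a n))) q
  (f q * qconj b + I * (f q * qconj c))%quat).
{ rewrite E; apply slice_conv; auto.
  - apply is_qsum_ext with (2 := is_qsum_qconj _ _ Hb); intros; apply Econj.
  - apply is_qsum_ext with (2 := is_qsum_qconj _ _ Hc); intros; apply Econj.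
  - apply ex_series_ext with (2 := Sb); intros n; unfold slice_cos_part.
    now rewrite <- Econj, qnorm_conj.
  - apply ex_series_ext with (2 := Sc); intros n; unfold slice_sin_part.
    now rewrite <- Econj, qnorm_conj. }
rewrite (qseries_eq _ _ _ V).
assert (Hk := Hf q Hq); set (k := f q) in *.
assert (HK := conjugate_imag_unit' k I Hk HI); set (K := (/ k * I * k)%quat) in *.
replace (k * qconj b + I * (k * qconj c))%quat with (k * qconj (b - c * K))%quat.
- intros E0; apply qmul_eq0 in E0 as [E0|E0]; [now apply Hk|].
  apply (sphere_nonvanishing b c N K HK); rewrite <- (qconjK (b - c * K)%quat), E0; quat_ring.
- transitivity (k * (qconj b - qconj K * qconj c))%quat; [clearbody K k; quat_ring|].
  rewrite (imag_unit_conj K HK); unfold K.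
  transitivity (k * qconj b + (k * / k) * I * k * qconj c)%quat.
  + generalize (/ k)%quat; clearbody k I; quat_ring.
  + rewrite qmulV by auto; qdistr.
Qed.

Lemma is_derive_Rmult (u v : R -> R) (t du dv : R) :
  is_derive u t du -> is_derive v t dv ->
  is_derive (fun s => u s * v s) t (du * v t + u t * dv).
Proof. intros Hu Hv; exact (is_derive_mult u v t du dv Hu Hv Rmult_comm). Qed.

Lemma is_derive_Rplus (u v : R -> R) (t du dv : R) :
  is_derive u t du -> is_derive v t dv -> is_derive (fun s => u s + v s) t (du + dv).
Proof. intros Hu Hv; exact (is_derive_plus (V := R_NormedModule) u v t du dv Hu Hv). Qed.

Lemma is_qderive_inv (phi : R -> quat) (t : R) (d : quat) :
  is_qderive phi t d -> phi t <> 0%quat ->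
  is_qderive (fun s => / phi s)%quat t (- (/ phi t * d * / phi t))%quat.
Proof.
intros H H0 c; apply qnorm2_gt0 in H0.
assert (HN : is_derive (fun s => qnorm2 (phi s)) t (2 * qdot (phi t) d)).
{ apply is_qderive_comp in H as (A & B & C & D).
  assert (E := is_derive_Rplus _ _ _ _ _ (is_derive_Rplus _ _ _ _ _ (is_derive_Rplus _ _ _ _ _
    (is_derive_Rmult _ _ _ _ _ A A) (is_derive_Rmult _ _ _ _ _ B B))
    (is_derive_Rmult _ _ _ _ _ C C)) (is_derive_Rmult _ _ _ _ _ D D)).
  match type of E with is_derive _ _ ?e => replace (2 * qdot (phi t) d) with e end.
  - apply is_derive_ext with (2 := E); intros s; unfold qnorm2; simpl; ring.
  - unfold qdot; simpl; ring. }
assert (HI := is_derive_inv _ _ _ HN (Rgt_not_eq _ _ H0)).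
assert (E := is_derive_Rmult _ _ _ _ _ HI (H (qconj c))).
match type of E with is_derive _ _ ?e =>
  replace (qdot c (- (/ phi t * d * / phi t))%quat) with e end.
- apply is_derive_ext with (2 := E); intros s; unfold qinv; rewrite qdotZ; f_equal; qdot_ring.
- unfold qinv; destruct (phi t) as [p0 p1 p2 p3], d as [d0 d1 d2 d3], c as [c0 c1 c2 c3].
  unfold qdot, qnorm2 in *; simpl in *; field; lra.
Qed.

(** Real coefficients make the value of [f] on a slice commute with [I]; then [I] can be moved
    through 1/f in the derivative -(1/f) f' (1/f), and Cauchy-Riemann survives pointwise
    inversion. *)
Lemma reciprocal_slice_regular (f : quat -> quat) (a : nat -> quat) :
  has_expansion f a -> (forall n, qconj (a n) = a n) ->
  (forall q, in_ball q -> f q <> 0%quat) -> slice_regular (fun q => / f q)%quat.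
Proof.
intros H Ha Hf; set (g := qseries (dcoef a)).
assert (G : has_expansion g (dcoef a))
  by (apply summable_expansion, summable_dcoef, expansion_summable with (1 := H)).
apply (slice_regular_intro _ (fun _ q => - (/ f q * g q * / f q))%quat).
intros I x y HI Hb; destruct (expansion_slice_derivatives f g a I x y H G HI Hb) as [A B].
refine (conj _ (conj _ _)).
- exact (is_qderive_inv (fun s => f (slice_point I s y)) x _ A (Hf _ Hb)).
- assert (C := is_qderive_inv (fun s => f (slice_point I x s)) y _ B (Hf _ Hb)).
  replace (I * - (/ f (slice_point I x y) * g (slice_point I x y) * / f (slice_point I x y)))%quat
    with (- (/ f (slice_point I x y) * (I * g (slice_point I x y)) * / f (slice_point I x y)))%quat;
  auto.
  assert (Co := real_coefs_commute f a I x y H Ha HI Hb).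
  assert (Hn := Hf _ Hb); set (p := f (slice_point I x y)) in *.
  assert (Co' : (/ p * I)%quat = (I * / p)%quat).
  { transitivity (/ p * (I * p) * / p)%quat.
    - rewrite <- !qmulA, qmulV, qmul1r; auto.
    - rewrite Co, !qmulA, qmulVl, qmul1l; auto. }
  rewrite !qmulA, Co'; generalize (/ p)%quat (g (slice_point I x y)); quat_ring.
- apply (continuous_comp (fun z : R * R => slice_point I (fst z) (snd z))
    (fun q => - (/ f q * g q * / f q))%quat); [apply continuous_slice_point|].
  cbn [fst snd].
  assert (Cf := expansion_continuous f a _ H Hb).
  assert (Ci := continuous_qinv f _ Cf (Hf _ Hb)).
  apply continuous_qopp, continuous_qmul; auto; apply continuous_qmul; auto.
  exact (expansion_continuous g _ _ G Hb).
Qed.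

(* [P = k^-* * F]; the points [p] and [q] are related by the sphere-preserving map
   [p = k(q)^-1 q k(q)]. *)
Lemma regular_quotient (k F : quat -> quat) (a d : nat -> quat) :
  has_expansion k a -> has_expansion F d -> (forall q, in_ball q -> k q <> 0%quat) ->
  exists P c, has_expansion P c /\ (forall n, qconv a c n = d n) /\
    forall p, in_ball p -> exists q, qnorm q = qnorm p /\ F q = (k q * P p)%quat.
Proof.
intros Hk HF Hn.
assert (Sa := expansion_summable _ _ Hk); assert (Sd := expansion_summable _ _ HF).
set (ac := fun n => qconj (a n)); assert (Sac : summable_on_ball ac) by now apply summable_qconj.
assert (Hac := summable_expansion _ Sac).
set (s := qconv a ac).
assert (Hs : has_expansion (qseries s) s) by now apply expansion_conv.
assert (Ns : forall q, in_ball q -> qseries s q <> 0%quat)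
  by (intros q Hq; now apply (symmetrization_nonvanishing k a)).
destruct (slice_regular_expansion (fun q => / qseries s q)%quat) as [t Ht].
{ apply reciprocal_slice_regular with s; auto; intros n.
  now apply (symmetrization_real_coefs k). }
assert (St := expansion_summable _ _ Ht).
assert (Std : summable_on_ball (qconv t d)) by now apply summable_conv.
(* Here [t] expands the reciprocal of the symmetrization of [k] and [ac] the regular conjugate, so
   [c] is the coefficient sequence of k^-* * F. On the real axis k P = (k k^c) (1/k^s) F = F. *)
set (c := qconv ac (qconv t d)).
assert (Sc : summable_on_ball c) by now apply summable_conv.
assert (Hc := summable_expansion _ Sc); set (P := qseries c) in *.
assert (Eac : forall n, qconv a c n = d n).
{ apply (qseries_unique _ _ 1); [lra|]; intros x Hx; exists (F (qreal x)).
  split; [|now apply HF, real_in_ball].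
  assert (E := conv_real k P a c x Hk Hc Hx).
  replace (F (qreal x)) with (k (qreal x) * P (qreal x))%quat; auto.
  unfold P, c.
  rewrite (qseries_conv_real (qseries ac) (qseries (qconv t d)) ac (qconv t d) x Hac
    (summable_expansion _ Std) Hx), (qseries_conv_real _ F t d x Ht HF Hx).
  assert (Es : qseries s (qreal x) = (k (qreal x) * qseries ac (qreal x))%quat)
    by now apply qseries_conv_real.
  assert (N := Ns (qreal x) (real_in_ball x Hx)); cbv beta; rewrite !qmulA, <- Es, qmulV by auto.
  apply qmul1l. }
exists P, c; refine (conj Hc (conj Eac _)); intros p Hp.
destruct (slice_unit_spec p) as [HK E].
set (K := slice_unit p) in *; set (x := q_re p) in *; set (y := vec_norm p) in *.
assert (Hz : in_ball (slice_point K x y)) by now rewrite <- E.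
assert (Hxy : x * x + y * y < 1) by now apply slice_in_ball in Hz.
destruct (slice_parts a x y Sa Hxy) as (b & e & Hb & He & Sb & Se & HB).
destruct (slice_parts c x y Sc Hxy) as (A & B & HA & HB' & SA & SB & HP).
assert (N : forall J, imag_unit J -> (b + J * e)%quat <> 0%quat).
{ intros J HJ; rewrite <- (HB k J Hk HJ); apply Hn; now apply slice_in_ball. }
(* The point q = x + y J has to satisfy J k(q) = k(q) K with k(q) = b + J e. By J^2 = K^2 = -1 this
   equation becomes linear in J, namely J (b - e K) = (b - e K) K, whose solution is J = w K
   w^-1. *)
assert (Hw := sphere_nonvanishing b e N K HK); set (w := (b - e * K)%quat) in *.
assert (HJ := conjugate_imag_unit w K Hw HK); set (J := (w * K * / w)%quat) in *.
exists (slice_point J x y); split; [rewrite E, !slice_norm; auto|].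
assert (Hq : in_ball (slice_point J x y)) by now apply slice_in_ball.
assert (EF : F (slice_point J x y) =
  (k (slice_point J x y) * A + J * (k (slice_point J x y) * B))%quat).
{ apply (is_qsum_unique _ _ _ (HF _ Hq)).
  apply (is_qsum_ext (fun n => qpow (slice_point J x y) n * qconv a c n)%quat).
  - intros n; now rewrite Eac.
  - now apply slice_conv. }
rewrite EF, E, (HP P K Hc HK).
assert (EJ : (J * k (slice_point J x y))%quat = (k (slice_point J x y) * K)%quat).
{ rewrite (HB k J Hk HJ).
  assert (Jw : (J * w)%quat = (w * K)%quat).
  { unfold J; rewrite <- qmulA, qmulVl, qmul1r; auto. }
  clearbody J; unfold w in Jw.
  transitivity (J * (b - e * K) + J * e * K + (J * J) * e)%quat; [clear; quat_ring|].
  rewrite Jw, HJ.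
  transitivity (b * K - e * (K * K) + J * e * K - e)%quat; [clear; quat_ring|].
  rewrite HK; clear; quat_ring. }
rewrite (qmulA J), EJ; qdistr.
Qed.

Lemma qinv_mul (p q : quat) : p <> 0%quat -> q <> 0%quat -> (/ (p * q))%quat = (/ q * / p)%quat.
Proof.
intros Hp Hq; apply qinv_unique.
transitivity (p * (q * / q) * / p)%quat; [qdistr|].
now rewrite qmulV, qmul1r, qmulV.
Qed.

(** With h = q k the factor [q] cancels in h^-1 q f' = k^-1 f', so positivity at [q] becomes
    positivity of P at the corresponding [p]; at 0 it follows from P(0) = 1. The lemma serves for
    [f] and also, with f = h, for the starlike function itself. *)
Lemma positive_quotient (f h : quat -> quat) (a hc : nat -> quat) :
  has_expansion f a -> a 1%nat = 1%quat -> has_expansion h hc -> normalized_class h ->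
  pos_re_on_ball (fun q => / h q * q * slice_derivative f q)%quat ->
  hc 1%nat = 1%quat /\
  exists P c, has_expansion P c /\ c 0%nat = 1%quat /\
    (forall n, qconv (fun m => hc (S m)) c n = dcoef a n) /\
    (forall p, in_ball p -> 0 < q_re (P p)).
Proof.
intros Hf Ha1 Hh (_ & Hz & Hd) [Hpos _].
assert (H0 : hc 0%nat = 0%quat).
{ rewrite <- (expansion_at_0 _ _ Hh); apply Hz; auto; apply in_ball_0. }
assert (H1 : hc 1%nat = 1%quat).
{ rewrite <- Hd, (expansion_at_0 _ _ (slice_derivative_expansion _ _ Hh)).
  unfold dcoef; symmetry; apply qmul1l. }
split; auto.
destruct (expansion_factor_q h hc Hh H0) as (k & Hk & Ehk).
assert (Nk : forall q, in_ball q -> k q <> 0%quat).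
{ intros q Hq E.
  assert (Hq0 : q = 0%quat).
  { apply Hz; auto; rewrite Ehk, E by auto; quat_ring. }
  rewrite Hq0, (expansion_at_0 _ _ Hk), H1 in E; now apply q1_neq0. }
assert (HF := slice_derivative_expansion _ _ Hf).
destruct (regular_quotient k _ _ _ Hk HF Nk) as (P & c & HP & Ec & HPq).
assert (Hc0 : c 0%nat = 1%quat).
{ generalize (Ec 0%nat); unfold qconv; rewrite sum_O; cbn [Nat.sub].
  rewrite H1, qmul1l; intros ->; unfold dcoef; rewrite Ha1; apply qmul1l. }
exists P, c; repeat split; auto.
intros p Hp; destruct (Req_dec (qnorm p) 0) as [Hp0|Hp0].
- apply qnorm_eq0 in Hp0; rewrite Hp0, (expansion_at_0 _ _ HP), Hc0; simpl; lra.
- destruct (HPq p Hp) as (q & Eq & EF).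
  assert (Hq : in_ball q) by (unfold in_ball; now rewrite Eq).
  assert (Hq0 : q <> 0%quat).
  { intros ->; apply Hp0; rewrite <- Eq; apply qnorm0. }
  generalize (Hpos q Hq Hq0); rewrite EF, (Ehk q Hq), qinv_mul by auto.
  assert (E : (/ k q * / q * q * (k q * P p))%quat = P p).
  { rewrite <- (qmulA (/ k q)), qmulVl, qmul1r, qmulA, qmulVl, qmul1l; auto. }
  now rewrite E.
Qed.

(** * Caratheodory's lemma *)

Lemma expansion_mul_pow (f : quat -> quat) (a : nat -> quat) (n : nat) :
  has_expansion f a ->
  has_expansion (fun q => qpow q n * f q)%quat (Nat.iter n qshift a).
Proof.
intros H; induction n as [|n IH].
- apply expansion_ext with (2 := H); intros; symmetry; apply qmul1l.
- apply expansion_ext with (2 := expansion_mul_q _ _ IH); intros q _.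
  now rewrite qpowS, qmulA.
Qed.

Lemma circle_moment (f : quat -> quat) (a : nat -> quat) (I : quat) (r : R) (n : nat) :
  has_expansion f a -> imag_unit I -> 0 < r < 1 ->
  qRInt (fun t => qexp I (- INR n * t) * f (qreal r * qexp I t))%quat 0 (2 * PI) =
  (qreal (2 * PI * r ^ n) * a n)%quat.
Proof.
intros H HI Hr; rewrite (expansion_slice_coef f a I r n H HI Hr); unfold slice_coef.
assert (Hpi := PI_RGT_0); assert (Hn : 0 < r ^ n) by (apply pow_lt; lra).
set (X := qRInt _ _ _); rewrite qmulA.
replace (qreal (2 * PI * r ^ n) * qreal (/ (2 * PI) * / r ^ n))%quat with 1%quat.
- symmetry; apply qmul1l.
- apply quat_ext; unfold qone, qreal; simpl; field; lra.
Qed.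

(** A Fourier coefficient of negative index is, up to a power of r, the constant coefficient of
    q^(n+1) f(q), which is 0. *)
Lemma circle_moment_neg (f : quat -> quat) (a : nat -> quat) (I : quat) (r : R) (n : nat) :
  has_expansion f a -> imag_unit I -> 0 < r < 1 ->
  qRInt (fun t => qexp I (INR (S n) * t) * f (qreal r * qexp I t))%quat 0 (2 * PI) = 0%quat.
Proof.
intros H HI Hr.
assert (Hpi := PI_RGT_0); assert (Hn : 0 < r ^ S n) by (apply pow_lt; lra).
assert (Hreg := expansion_slice_regular _ _ H).
assert (E := circle_moment _ _ I r 0 (expansion_mul_pow f a (S n) H) HI Hr).
rewrite (qRInt_ext _ (fun t => qreal (r ^ S n) * (qexp I (INR (S n) * t) *
  f (qreal r * qexp I t)))%quat) in E.
- rewrite qRInt_mul_l in E.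
  + replace (qreal (2 * PI * r ^ 0) * Nat.iter (S n) qshift a 0%nat)%quat with 0%quat in E
      by (change (Nat.iter (S n) qshift a 0%nat) with 0%quat; quat_ring).
    apply qmul_eq0 in E as [E|E]; auto.
    apply (f_equal q_re) in E; change (r ^ S n = 0) in E; lra.
  + lra.
  + intros t _; apply continuous_qmul; [apply continuous_qexp_lin|].
    apply circle_continuous; auto; lra.
- intros t _; simpl INR at 1; rewrite Ropp_0, Rmult_0_l, qexp_0, qmul1l, qmulA; f_equal.
  rewrite <- (qexp_pow I t (S n) HI); generalize (S n); intros m.
  induction m as [|m IH].
  + change (1 = qreal 1 * 1)%quat; quat_ring.
  + rewrite !qpowS, IH; simpl pow.
    generalize (qexp I t) (qpow (qexp I t) m) (r ^ m); quat_ring.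
Qed.

(** The cosine is the half-sum of two exponentials, of which the one of negative index contributes
    0; hence the factor [PI] in place of [2 * PI]. Being real, the cosine can be taken inside the
    real part. *)
Lemma cos_moment (f : quat -> quat) (a : nat -> quat) (I : quat) (r g : R) (n : nat) :
  has_expansion f a -> imag_unit I -> 0 < r < 1 ->
  is_RInt (fun t => cos (INR (S n) * t + g) * q_re (f (qreal r * qexp I t)%quat)) 0 (2 * PI)
    (PI * r ^ S n * q_re (qexp I (- g) * a (S n))%quat).
Proof.
intros H HI Hr; assert (Hpi := PI_RGT_0).
set (F := fun t => f (qreal r * qexp I t)%quat).
assert (CF : forall t, continuous F t).
{ intros t; apply circle_continuous; auto; [now apply expansion_slice_regular with a|lra]. }
set (X := fun t => (qexp I (- INR (S n) * t) * F t)%quat).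
set (Y := fun t => (qexp I (INR (S n) * t) * F t)%quat).
assert (CX : forall t, continuous X t)
  by (intros; apply continuous_qmul; auto; apply continuous_qexp_lin).
assert (CY : forall t, continuous Y t)
  by (intros; apply continuous_qmul; auto; apply continuous_qexp_lin).
assert (EX : qRInt X 0 (2 * PI) = (qreal (2 * PI * r ^ S n) * a (S n))%quat)
  by now apply circle_moment.
assert (EY : qRInt Y 0 (2 * PI) = 0%quat) by now apply circle_moment_neg with a.
set (Z := fun t => (qreal (/ 2) * qexp I (- g) * X t + qreal (/ 2) * qexp I g * Y t)%quat).
assert (CZ1 : forall t, continuous (fun t => qreal (/ 2) * qexp I (- g) * X t)%quat t)
  by (intros; apply continuous_qmul; auto; apply continuous_const).
assert (CZ2 : forall t, continuous (fun t => qreal (/ 2) * qexp I g * Y t)%quat t)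
  by (intros; apply continuous_qmul; auto; apply continuous_const).
assert (CZ : forall t, continuous Z t) by (intros; apply continuous_qadd; auto).
assert (EZ : qRInt Z 0 (2 * PI) = (qreal (PI * r ^ S n) * (qexp I (- g) * a (S n)))%quat).
{ unfold Z; rewrite qRInt_plus by (auto; lra).
  rewrite !qRInt_mul_l by (auto; lra); rewrite EX, EY.
  generalize (qexp I (- g)) (a (S n)); intros p q; apply quat_ext; unfold qreal, qzero; simpl; field. }
assert (I1 := is_RInt_qdot Z 0 (2 * PI) 1 ltac:(lra) (fun t _ => CZ t)).
rewrite EZ, qdotZ, qdot_re in I1.
apply (is_RInt_ext (V := R_NormedModule)) with (2 := I1); intros t _.
rewrite qdot_re; unfold Z, X, Y.
replace (_ + _)%quat with (qreal (/ 2) * (qexp I (- g) * qexp I (- INR (S n) * t) +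
  qexp I g * qexp I (INR (S n) * t)) * F t)%quat by qdistr.
rewrite !qexp_add by auto.
replace (- g + - INR (S n) * t) with (- (INR (S n) * t + g)) by ring.
replace (g + INR (S n) * t) with (INR (S n) * t + g) by ring.
set (s := INR (S n) * t + g); fold (F t).
replace (qreal (/ 2) * (qexp I (- s) + qexp I s))%quat with (qreal (cos s)).
- simpl; ring.
- unfold qexp, slice_point; rewrite cos_neg, sin_neg.
  apply quat_ext; unfold qreal; simpl; field.
Qed.

Lemma mean_moment (f : quat -> quat) (a : nat -> quat) (I : quat) (r : R) :
  has_expansion f a -> imag_unit I -> 0 < r < 1 ->
  is_RInt (fun t => q_re (f (qreal r * qexp I t)%quat)) 0 (2 * PI) (2 * PI * q_re (a 0%nat)).
Proof.
intros H HI Hr; assert (Hpi := PI_RGT_0).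
assert (Hreg := expansion_slice_regular _ _ H).
assert (E := circle_moment f a I r 0 H HI Hr).
rewrite (qRInt_ext _ (fun t => f (qreal r * qexp I t)%quat)) in E.
- assert (I1 := is_RInt_qdot (fun t => f (qreal r * qexp I t)%quat) 0 (2 * PI) 1 ltac:(lra)
    (fun t _ => circle_continuous f I r t Hreg HI ltac:(lra))).
  rewrite E, qdotZ, qdot_re in I1; simpl pow in I1; rewrite Rmult_1_r in I1.
  apply (is_RInt_ext (V := R_NormedModule)) with (2 := I1); intros t _; apply qdot_re.
- intros t _; simpl INR; now rewrite Ropp_0, Rmult_0_l, qexp_0, qmul1l.
Qed.

(** In the coordinates of its own slice [q] has y >= 0, so the arccosine of x/|q|, whose sine is
    nonnegative, is an argument. *)
Lemma polar_form (q : quat) : exists I g, imag_unit I /\ q = (qreal (qnorm q) * qexp I g)%quat.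
Proof.
destruct (slice_unit_spec q) as [HI E].
set (I := slice_unit q) in *; set (x := q_re q) in *; set (y := vec_norm q) in *.
assert (Hy : 0 <= y) by apply sqrt_pos.
exists I; destruct (Req_dec (qnorm q) 0) as [H|H].
- exists 0; split; auto; rewrite H; apply qnorm_eq0 in H; rewrite H.
  generalize (qexp I 0); quat_ring.
- set (m := qnorm q) in *; assert (Hm : 0 < m) by (generalize (qnorm_ge0 q); unfold m in *; lra).
  assert (E2 : m * m = x * x + y * y) by (unfold m; rewrite qnorm_sq, E; now apply slice_norm2).
  exists (acos (x / m)); split; auto.
  assert (Hx : -1 <= x / m <= 1).
  { split; [apply Rle_div_r|apply Rle_div_l]; nra. }
  unfold qexp; rewrite cos_acos, sin_acos by auto.
  replace (sqrt (1 - (x / m)²)) with (y / m).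
  + rewrite E; unfold slice_point; clearbody m x y I.
    apply quat_ext; unfold qreal; simpl; field; auto.
  + symmetry; replace (1 - (x / m)²) with ((y / m) * (y / m)).
    * apply sqrt_square, Rmult_le_pos; auto; left; now apply Rinv_0_lt_compat.
    * unfold Rsqr.
      replace (y / m * (y / m)) with ((m * m - x * x) / (m * m))
        by (replace (m * m - x * x) with (y * y) by lra; field; auto).
      field; auto.
Qed.

(** [P] is controlled only inside the ball; inequalities are proved at radius r < 1, and only the
    resulting numerical bounds pass to r = 1. *)
Lemma le_0_at_1 (g : R -> R) :
  continuous g 1 -> (forall r, 0 < r < 1 -> g r <= 0) -> g 1 <= 0.
Proof.
intros C H; destruct (Rle_lt_dec (g 1) 0) as [H0|H0]; auto.
destruct (proj1 (filterlim_locally g (g 1)) C (mkposreal _ H0)) as [d Hd].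
set (r := 1 - Rmin d 1 / 2).
assert (Hm : 0 < Rmin d 1) by (apply Rmin_glb_lt; [apply d|lra]).
assert (Hm1 := Rmin_l d 1); assert (Hm2 := Rmin_r d 1).
assert (Hr : ball 1 d r).
{ change (Rabs (r - 1) < d); unfold r.
  replace (1 - Rmin d 1 / 2 - 1) with (- (Rmin d 1 / 2)) by ring.
  rewrite Rabs_Ropp, Rabs_pos_eq; lra. }
specialize (Hd r Hr); change (Rabs (g r - g 1) < g 1) in Hd.
assert (H1 := H r ltac:(unfold r; lra)).
apply Rabs_def2 in Hd; lra.
Qed.

(** Weighting the positive function Re P by a cosine phased by the argument of the coefficient can
    only decrease its integral: pi r^(n+1) |c_(n+1)| <= 2 pi. Only Re P on one slice enters, so [P]
    need not map that slice to itself. *)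
Lemma caratheodory (P : quat -> quat) (c : nat -> quat) (n : nat) :
  has_expansion P c -> c 0%nat = 1%quat -> (forall q, in_ball q -> 0 < q_re (P q)) ->
  qnorm (c (S n)) <= 2.
Proof.
intros H H0 Hpos; assert (Hpi := PI_RGT_0).
destruct (polar_form (c (S n))) as (I & g & HI & E).
set (m := qnorm (c (S n))) in *.
assert (Hm : m * 1 ^ S n - 2 <= 0); [|rewrite pow1 in Hm; lra].
apply (le_0_at_1 (fun r => m * r ^ S n - 2)).
{ apply (ex_derive_continuous (V := R_NormedModule)); auto_derive; auto. }
intros r Hr.
assert (I1 := cos_moment P c I r g n H HI Hr).
assert (I0 := mean_moment P c I r H HI Hr).
rewrite H0 in I0; simpl q_re in I0; rewrite Rmult_1_r in I0.
assert (L : PI * r ^ S n * q_re (qexp I (- g) * c (S n))%quat <= 2 * PI).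
{ apply (is_RInt_le _ _ 0 (2 * PI) _ _ ltac:(lra) I1 I0); intros t _.
  assert (Hp : 0 < q_re (P (qreal r * qexp I t)%quat)).
  { apply Hpos; unfold in_ball; rewrite circle_norm; auto; lra. }
  destruct (COS_bound (INR (S n) * t + g)) as [_ B]; nra. }
replace (q_re (qexp I (- g) * c (S n))%quat) with m in L.
- apply Rmult_le_reg_l with PI; auto; lra.
- rewrite E, qmulA, <- qrealC, <- qmulA, qexp_add by auto.
  rewrite Rplus_opp_l, qexp_0; simpl; ring.
Qed.

Lemma abs_sin_mult (n : nat) (x : R) : Rabs (sin (INR n * x)) <= INR n * Rabs (sin x).
Proof.
induction n as [|n IH].
- simpl INR; rewrite Rmult_0_l, sin_0, Rabs_R0; lra.
- rewrite S_INR, Rmult_plus_distr_r, Rmult_1_l, sin_plus.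
  apply Rle_trans with (1 := Rabs_triang _ _); rewrite !Rabs_mult.
  assert (C : forall y, Rabs (cos y) <= 1)
    by (intros y; apply Rabs_le; destruct (COS_bound y); lra).
  assert (C1 := C x); assert (C2 := C (INR n * x)).
  assert (S1 := Rabs_pos (sin (INR n * x))); assert (S2 := Rabs_pos (sin x)).
  assert (K1 : Rabs (sin (INR n * x)) * Rabs (cos x) <= Rabs (sin (INR n * x)) * 1)
    by now apply Rmult_le_compat_l.
  assert (K2 : Rabs (cos (INR n * x)) * Rabs (sin x) <= 1 * Rabs (sin x))
    by now apply Rmult_le_compat_r.
  lra.
Qed.

(** The half-angle form of |sin(n x)| <= n |sin x|. It quantifies concentration: a positive density
    giving little mass to 1 - cos x gives little mass to 1 - cos(n x). *)
Lemma one_minus_cos_mult (n : nat) (x : R) :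
  1 - cos (INR n * x) <= INR n ^ 2 * (1 - cos x).
Proof.
assert (E : forall y, 1 - cos y = 2 * Rabs (sin (y / 2)) ^ 2).
{ intros y; rewrite pow2_abs; replace y with (2 * (y / 2)) at 1 by field.
  rewrite cos_2a_sin; ring. }
rewrite !E; replace (INR n * x / 2) with (INR n * (x / 2)) by field.
replace (INR n ^ 2 * (2 * Rabs (sin (x / 2)) ^ 2)) with
  (2 * (INR n * Rabs (sin (x / 2))) ^ 2) by ring.
apply Rmult_le_compat_l; [lra|]; apply pow_incr; split; [apply Rabs_pos|apply abs_sin_mult].
Qed.

(** For c_1 = 2 e^(I g), integrating 1 - cos(N (t + g)) <= N^2 (1 - cos(t + g)) against Re P on the
    circle of radius r bounds 2 - r^N Re(e^(-I N g) c_N) by N^2 (2 - 2 r). At r = 1 the real part is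
    at least 2, while the norm is at most 2, so the rotated coefficient is exactly 2. The slice of
    c_1 serves for all N. *)
Lemma caratheodory_eq (P : quat -> quat) (c : nat -> quat) :
  has_expansion P c -> c 0%nat = 1%quat -> (forall q, in_ball q -> 0 < q_re (P q)) ->
  qnorm (c 1%nat) = 2 ->
  exists u, qnorm u = 1 /\ forall n, c (S n) = (qreal 2 * qpow u (S n))%quat.
Proof.
intros H H0 Hpos H1; assert (Hpi := PI_RGT_0).
destruct (polar_form (c 1%nat)) as (I & g & HI & E); rewrite H1 in E.
exists (qexp I g); split; [now apply qexp_norm|]; intros n.
rewrite qexp_pow by auto.
set (e := (qexp I (- (INR (S n) * g)) * c (S n))%quat).
assert (He : 2 <= q_re e).
{ assert (K : 2 - 1 ^ S n * q_re e - INR (S n) ^ 2 * (2 - 2 * 1) <= 0);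
  [|rewrite pow1 in K; lra].
  apply (le_0_at_1 (fun r => 2 - r ^ S n * q_re e - INR (S n) ^ 2 * (2 - 2 * r))).
  { apply (ex_derive_continuous (V := R_NormedModule)); auto_derive; auto. }
  intros r Hr.
  assert (J1 := cos_moment P c I r g 0 H HI Hr).
  assert (Jn := cos_moment P c I r (INR (S n) * g) n H HI Hr); fold e in Jn.
  assert (J0 := mean_moment P c I r H HI Hr).
  rewrite H0 in J0; simpl q_re in J0; rewrite Rmult_1_r in J0.
  replace (q_re (qexp I (- g) * c 1%nat)%quat) with 2 in J1.
  2:{ rewrite E, qmulA, <- qrealC, <- qmulA, qexp_add by auto.
      rewrite Rplus_opp_l, qexp_0; simpl; ring. }
  assert (A := is_RInt_minus (V := R_NormedModule) _ _ _ _ _ _ J0 Jn).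
  assert (B := is_RInt_scal (V := R_NormedModule) _ _ _ (INR (S n) ^ 2) _
    (is_RInt_minus (V := R_NormedModule) _ _ _ _ _ _ J0 J1)).
  assert (L : 2 * PI - PI * r ^ S n * q_re e <= INR (S n) ^ 2 * (2 * PI - PI * r ^ 1 * 2)).
  { apply (is_RInt_le _ _ 0 (2 * PI) _ _ ltac:(lra) A B); intros t _.
    assert (Hp : 0 < q_re (P (qreal r * qexp I t)%quat)).
    { apply Hpos; unfold in_ball; rewrite circle_norm; auto; lra. }
    set (rho := q_re (P (qreal r * qexp I t)%quat)) in *.
    change (rho - cos (INR (S n) * t + INR (S n) * g) * rho <=
      INR (S n) ^ 2 * (rho - cos (INR 1 * t + g) * rho)).
    replace (INR (S n) * t + INR (S n) * g) with (INR (S n) * (t + g)) by ring.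
    replace (INR 1 * t + g) with (t + g) by (simpl; ring).
    assert (K := one_minus_cos_mult (S n) (t + g)).
    apply (Rmult_le_compat_r rho) in K; lra. }
  apply Rmult_le_reg_l with PI; auto; lra. }
assert (Hn : qnorm e <= 2).
{ unfold e; rewrite qnormM, qexp_norm, Rmult_1_l by auto; now apply caratheodory with P. }
assert (Ee : e = qreal 2).
{ assert (K := qnorm_sq e); unfold qnorm2 in K; assert (K0 := qnorm_ge0 e).
  assert (K1 : qnorm e * qnorm e <= 4) by nra.
  assert (K2 : q_re e * q_re e >= 4) by nra.
  clearbody e; destruct e as [e0 e1 e2 e3]; simpl in *; apply quat_ext; simpl; nra. }
rewrite qrealC, <- Ee; unfold e; rewrite qmulA, qexp_add by auto.
now rewrite Rplus_opp_r, qexp_0, qmul1l.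
Qed.

(** * Coefficient estimates and the Koebe function *)

(** Since m < N, every factor of [p] has positive index and norm at most 2, and 2 (1 + ... + (m +
    1)) = (m + 1)(m + 2). *)
Lemma partial_conv_bound (b p : nat -> quat) (N m : nat) :
  (forall j, (j <= m)%nat -> qnorm (b j) <= INR (S j)) ->
  (forall j, qnorm (p (S j)) <= 2) -> (m < N)%nat ->
  qnorm (sum_n (fun j => b j * p (N - j)%nat)%quat m) <= INR (S m) * INR (S (S m)).
Proof.
intros Hb Hp; induction m as [|m IH]; intros Hm.
- rewrite sum_O, qnormM.
  replace (N - 0)%nat with (S (N - 1)) by lia.
  assert (H1 := Hb 0%nat (le_n _)); assert (H2 := Hp (N - 1)%nat).
  simpl INR in *; assert (H3 := qnorm_ge0 (b 0%nat)); assert (H4 := qnorm_ge0 (p (S (N - 1)))).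
  nra.
- rewrite sum_Sn; apply Rle_trans with (1 := qnormD _ _); rewrite qnormM.
  specialize (IH (fun j Hj => Hb j (le_S _ _ Hj)) ltac:(lia)).
  assert (H1 := Hb (S m) (le_n _)).
  replace (N - S m)%nat with (S (N - S m - 1)) by lia.
  assert (H2 := Hp (N - S m - 1)%nat).
  assert (H3 := qnorm_ge0 (b (S m))); assert (H4 := qnorm_ge0 (p (S (N - S m - 1)))).
  rewrite !S_INR in *; assert (Hi := pos_INR m).
  assert (K : qnorm (b (S m)) * qnorm (p (S (N - S m - 1))) <= (INR m + 1 + 1) * 2)
    by (apply Rmult_le_compat; auto).
  lra.
Qed.

(** Isolates the terms containing [p 1] and [b (S m)], the only ones examined in the equality case;
    the others are merely bounded. *)
Lemma conv_split (b p : nat -> quat) (m : nat) : p 0%nat = 1%quat ->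
  (forall j, (j <= m)%nat -> qnorm (b j) <= INR (S j)) ->
  (forall j, qnorm (p (S j)) <= 2) ->
  exists r, qconv b p (S m) = (r + b m * p 1%nat + b (S m))%quat /\
    sum_n (fun j => b j * p (S m - j)%nat)%quat m = (r + b m * p 1%nat)%quat /\
    qnorm r <= INR m * INR (S m).
Proof.
intros Hp0 Hb Hp; unfold qconv; rewrite sum_Sn, Nat.sub_diag, Hp0, qmul1r.
destruct m as [|m].
- exists 0%quat; rewrite sum_O; cbn [Nat.sub]; split; [|split].
  + change (b 0%nat * p 1%nat + b 1%nat = 0 + b 0%nat * p 1%nat + b 1%nat)%quat.
    generalize (b 0%nat * p 1%nat)%quat; quat_ring.
  + generalize (b 0%nat * p 1%nat)%quat; quat_ring.
  + rewrite qnorm0; simpl; lra.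
- exists (sum_n (fun j => b j * p (S (S m) - j)%nat)%quat m); rewrite sum_Sn.
  replace (S (S m) - S m)%nat with 1%nat by lia; split; [reflexivity|split; [reflexivity|]].
  apply partial_conv_bound; auto.
Qed.

Lemma conv_bound (b p : nat -> quat) (m : nat) :
  (forall j, (j <= m)%nat -> qnorm (b j) <= INR (S j)) ->
  (forall j, qnorm (p (S j)) <= 2) ->
  qnorm (sum_n (fun j => b j * p (S m - j)%nat)%quat m) <= INR (S m) * INR (S (S m)).
Proof. intros; apply partial_conv_bound; auto. Qed.

Lemma qconv_S (b p : nat -> quat) (m : nat) : p 0%nat = 1%quat ->
  qconv b p (S m) = (sum_n (fun j => b j * p (S m - j)%nat)%quat m + b (S m))%quat.
Proof.
intros Hp0; unfold qconv; rewrite sum_Sn, Nat.sub_diag, Hp0, qmul1r; reflexivity.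
Qed.

(* The relation [z k' + k = k * p], i.e. [h' = k * p] for [h = z k], determines [k] from [p]. *)
Lemma starlike_recursion (b v : nat -> quat) (m : nat) : v 0%nat = 1%quat ->
  (forall n, qconv b v n = qreal (INR (S n)) * b n)%quat ->
  (qreal (INR (S m)) * b (S m))%quat = sum_n (fun j => b j * v (S m - j)%nat)%quat m.
Proof.
intros Hv H; specialize (H (S m)); rewrite qconv_S in H by auto.
set (s := sum_n _ m) in *.
transitivity (qreal (INR (S (S m))) * b (S m) - b (S m))%quat.
- rewrite (S_INR (S m)); generalize (b (S m)); quat_ring.
- rewrite <- H; clearbody s; generalize (b (S m)) (s : quat); quat_ring.
Qed.

Lemma qreal_INR_norm (n : nat) (q : quat) : qnorm (qreal (INR n) * q) = INR n * qnorm q.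
Proof. rewrite qnormM, qnorm_real, Rabs_pos_eq; auto; apply pos_INR. Qed.

Lemma qreal_INR_cancel (n : nat) (p q : quat) :
  (qreal (INR (S n)) * p)%quat = (qreal (INR (S n)) * q)%quat -> p = q.
Proof.
intros H; apply qsub_eq0; assert (Hn : INR (S n) <> 0) by now apply not_0_INR.
assert (E : (qreal (INR (S n)) * (p - q))%quat = 0%quat).
{ transitivity (qreal (INR (S n)) * p - qreal (INR (S n)) * q)%quat; [quat_ring|].
  rewrite H; apply qaddN. }
apply qmul_eq0 in E as [E|E]; auto.
apply (f_equal q_re) in E; now contradict Hn.
Qed.

(** Here [b m] is the coefficient of order m + 1 of h. The recursion bounds (m + 1) |b_(m+1)| by (m
    + 1)(m + 2). *)
Lemma starlike_bound (b v : nat -> quat) : b 0%nat = 1%quat -> v 0%nat = 1%quat ->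
  (forall n, qconv b v n = qreal (INR (S n)) * b n)%quat ->
  (forall j, qnorm (v (S j)) <= 2) -> forall m, qnorm (b m) <= INR (S m).
Proof.
intros Hb0 Hv0 H Hv m; induction m as [m IH] using Wf_nat.lt_wf_ind; destruct m as [|m].
- rewrite Hb0, qnorm_1; simpl; lra.
- assert (K := conv_bound b v m (fun j Hj => IH j (proj2 (Nat.lt_succ_r j m) Hj)) Hv).
  rewrite <- starlike_recursion, qreal_INR_norm in K by auto.
  apply Rmult_le_reg_l in K; auto; apply lt_0_INR; lia.
Qed.

(** All terms are real multiples of the same power of [u], so for unimodular [u] the bound of
    [partial_conv_bound] is attained. *)
Lemma geometric_conv (b p : nat -> quat) (u : quat) (m l : nat) :
  (forall j, (j <= l)%nat -> b j = qreal (INR (S j)) * qpow u j)%quat ->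
  (forall j, p (S j) = qreal 2 * qpow u (S j))%quat -> (l <= m)%nat ->
  sum_n (fun j => b j * p (S m - j)%nat)%quat l =
  (qreal (INR (S l) * INR (S (S l))) * qpow u (S m))%quat.
Proof.
intros Hb Hp Hl.
assert (T : forall j, (j <= l)%nat -> (b j * p (S m - j)%nat)%quat =
  (qreal (2 * INR (S j)) * qpow u (S m))%quat).
{ intros j Hj; rewrite Hb by auto.
  replace (S m - j)%nat with (S (m - j)) by lia; rewrite Hp.
  replace (S m) with (j + S (m - j))%nat by lia; rewrite qpow_add.
  generalize (qpow u j) (qpow u (S (m - j))); quat_ring. }
clear Hb Hp; induction l as [|l IH].
- rewrite sum_O, T by lia; simpl INR; f_equal; f_equal; ring.
- rewrite sum_Sn, IH, T by (try lia; intros; apply T; lia).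
  change (qreal (INR (S l) * INR (S (S l))) * qpow u (S m) + qreal (2 * INR (S (S l))) * qpow u (S m)
    = qreal (INR (S (S l)) * INR (S (S (S l)))) * qpow u (S m))%quat.
  rewrite (S_INR (S (S l))), (S_INR (S l)).
  generalize (qpow u (S m)); quat_ring.
Qed.

Lemma starlike_extremal (b v : nat -> quat) (u : quat) : b 0%nat = 1%quat -> v 0%nat = 1%quat ->
  (forall n, qconv b v n = qreal (INR (S n)) * b n)%quat ->
  (forall j, v (S j) = qreal 2 * qpow u (S j))%quat ->
  forall m, b m = (qreal (INR (S m)) * qpow u m)%quat.
Proof.
intros Hb0 Hv0 H Hv m; induction m as [m IH] using Wf_nat.lt_wf_ind; destruct m as [|m].
- rewrite Hb0; change (1 = qreal 1 * 1)%quat; quat_ring.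
- apply (qreal_INR_cancel m); rewrite (starlike_recursion b v m Hv0 H).
  rewrite (geometric_conv b v u) by (auto; intros; apply IH; lia).
  generalize (qpow u (S m)); quat_ring.
Qed.

(** Strict convexity of the Euclidean norm: expanding the square gives [qdot u v >= 1], hence |u -
    v|^2 = 2 - 2 [qdot u v] <= 0. *)
Lemma unit_sum_extremal (u v : quat) (al be : R) : 0 < al -> 0 < be ->
  qnorm u = 1 -> qnorm v = 1 -> al + be <= qnorm (qreal al * u + qreal be * v)%quat -> u = v.
Proof.
intros Ha Hb Hu Hv H; apply qsub_eq0, qnorm_eq0.
assert (E1 := qnorm_sq (qreal al * u + qreal be * v)%quat).
assert (Eu := qnorm_sq u); assert (Ev := qnorm_sq v); rewrite Hu in Eu; rewrite Hv in Ev.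
assert (E2 : qnorm2 (qreal al * u + qreal be * v)%quat =
  al * al * qnorm2 u + be * be * qnorm2 v + 2 * (al * be) * qdot u v) by qdot_ring.
assert (E3 : qnorm2 (u - v)%quat = qnorm2 u + qnorm2 v - 2 * qdot u v) by qdot_ring.
set (N := qnorm (qreal al * u + qreal be * v)%quat) in *.
assert (Hn : (al + be) * (al + be) <= N * N) by nra.
assert (Hd : 1 <= qdot u v).
{ apply Rmult_le_reg_l with (2 * (al * be)); [nra|].
  rewrite E1, E2, <- Eu, <- Ev in Hn; lra. }
assert (H0 := qnorm2_ge0 (u - v)%quat).
unfold qnorm; replace (qnorm2 (u - v)%quat) with 0 by lra; apply sqrt_0.
Qed.

(** The convolution is at most (m + 1)(m + 2) + (m + 2) = (m + 2)^2, and differentiation supplied a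
    factor m + 2. *)
Lemma close_to_convex_bound (b p : nat -> quat) (A : quat) (m : nat) : p 0%nat = 1%quat ->
  (forall j, qnorm (b j) <= INR (S j)) -> (forall j, qnorm (p (S j)) <= 2) ->
  qconv b p (S m) = (qreal (INR (S (S m))) * A)%quat -> qnorm A <= INR (S (S m)).
Proof.
intros Hp0 Hb Hp H; rewrite qconv_S in H by auto.
assert (K := conv_bound b p m (fun j _ => Hb j) Hp).
apply (f_equal qnorm) in H; rewrite qreal_INR_norm in H.
assert (Hpos : 0 < INR (S (S m))) by (apply lt_0_INR; lia).
apply Rmult_le_reg_l with (1 := Hpos); rewrite <- H.
apply Rle_trans with (1 := qnormD _ _).
generalize (Hb (S m)); rewrite (S_INR (S m)) in *; lra.
Qed.

(** The budget is (m + 2)^2 = m (m + 1) + 2 (m + 1) + (m + 2), for the remainder, [b m * p 1] and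
    [b (S m)]. Equality leaves no slack in any share, nor in the sum of the last two, which later
    aligns their directions. *)
Lemma extremal_factors (b p : nat -> quat) (A : quat) (m : nat) : p 0%nat = 1%quat ->
  (forall j, qnorm (b j) <= INR (S j)) -> (forall j, qnorm (p (S j)) <= 2) ->
  qconv b p (S m) = (qreal (INR (S (S m))) * A)%quat -> qnorm A = INR (S (S m)) ->
  qnorm (p 1%nat) = 2 /\ qnorm (b (S m)) = INR (S (S m)) /\
  2 * INR (S m) + INR (S (S m)) <= qnorm (b m * p 1%nat + b (S m))%quat.
Proof.
intros Hp0 Hb Hp H HA; destruct (conv_split b p m Hp0 (fun j _ => Hb j) Hp) as (r & E & _ & Hr).
rewrite H in E; apply (f_equal qnorm) in E; rewrite qreal_INR_norm, HA, <- qaddA in E.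
assert (K1 := qnormD r (b m * p 1%nat + b (S m))).
assert (K2 := qnormD (b m * p 1%nat) (b (S m))); rewrite qnormM in K2.
assert (Hm := Hb m); assert (Hm1 := Hb (S m)); assert (Hp1 := Hp 0%nat).
rewrite <- E in K1; rewrite !S_INR in *; assert (Hi := pos_INR m).
assert (H0 := qnorm_ge0 (b m)); assert (H1 := qnorm_ge0 (p 1%nat)).
assert (K3 : qnorm (b m) * qnorm (p 1%nat) <= (INR m + 1) * qnorm (p 1%nat))
  by now apply Rmult_le_compat_r.
assert (K4 : (INR m + 1) * qnorm (p 1%nat) <= (INR m + 1) * 2)
  by (apply Rmult_le_compat_l; lra).
assert (K5 : 2 * (INR m + 1) + (INR m + 1 + 1) <= qnorm (b m * p 1%nat + b (S m))%quat) by nra.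
repeat split; try lra.
apply Rle_antisym; auto; apply Rmult_le_reg_l with (INR m + 1); lra.
Qed.

(** The same accounting for the starlike recursion: (m + 1)(m + 2) = m (m + 1) + 2 (m + 1). *)
Lemma starlike_extremal_factor (b v : nat -> quat) (m : nat) : v 0%nat = 1%quat ->
  (forall n, qconv b v n = qreal (INR (S n)) * b n)%quat ->
  (forall j, qnorm (b j) <= INR (S j)) -> (forall j, qnorm (v (S j)) <= 2) ->
  qnorm (b (S m)) = INR (S (S m)) -> qnorm (v 1%nat) = 2.
Proof.
intros Hv0 H Hb Hv HA.
destruct (conv_split b v m Hv0 (fun j _ => Hb j) Hv) as (r & _ & E & Hr).
rewrite <- starlike_recursion in E by auto.
apply (f_equal qnorm) in E; rewrite qreal_INR_norm, HA in E.
assert (K := qnormD r (b m * v 1%nat)); rewrite qnormM, <- E in K.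
assert (Hm := Hb m); assert (Hv1 := Hv 0%nat).
rewrite !S_INR in *; assert (Hi := pos_INR m); assert (H1 := qnorm_ge0 (v 1%nat)).
assert (K3 : qnorm (b m) * qnorm (v 1%nat) <= (INR m + 1) * qnorm (v 1%nat))
  by now apply Rmult_le_compat_r.
apply Rle_antisym; auto; apply Rmult_le_reg_l with (INR m + 1); lra.
Qed.

Definition koebe_coef (u : quat) : nat -> quat :=
  qshift (fun n => qreal (INR (S n)) * qpow u n)%quat.

Lemma koebe_coef_norm (u : quat) (n : nat) : qnorm u = 1 -> qnorm (koebe_coef u n) = INR n.
Proof.
intros Hu; destruct n as [|n]; [apply qnorm0|].
unfold koebe_coef, qshift; rewrite qreal_INR_norm, qnorm_pow, Hu, pow1; ring.
Qed.

(* All triangle inequalities in the bound of [a (m + 2)] become equalities, which forces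
   [p 1 = v 1 = 2 u] with [u] unimodular, hence determines [b], [v], [p] and [a]. *)
Lemma extremal_coefs (b v p a : nat -> quat) (m : nat) :
  b 0%nat = 1%quat -> v 0%nat = 1%quat -> p 0%nat = 1%quat ->
  a 0%nat = 0%quat -> a 1%nat = 1%quat ->
  (forall n, qconv b v n = qreal (INR (S n)) * b n)%quat ->
  (forall n, qconv b p n = qreal (INR (S n)) * a (S n))%quat ->
  (forall j, qnorm (v (S j)) <= 2) -> (forall j, qnorm (p (S j)) <= 2) ->
  (qnorm (v 1%nat) = 2 ->
    exists u, qnorm u = 1 /\ forall n, v (S n) = (qreal 2 * qpow u (S n))%quat) ->
  (qnorm (p 1%nat) = 2 ->
    exists u, qnorm u = 1 /\ forall n, p (S n) = (qreal 2 * qpow u (S n))%quat) ->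
  qnorm (a (S (S m))) = INR (S (S m)) ->
  exists u, qnorm u = 1 /\ forall n, a n = koebe_coef u n.
Proof.
intros Hb0 Hv0 Hp0 Ha0 Ha1 Hbv Hbp Hv Hp Xv Xp HA.
assert (Hb := starlike_bound b v Hb0 Hv0 Hbv Hv).
destruct (extremal_factors b p _ m Hp0 Hb Hp (Hbp (S m)) HA) as (Hp1 & Hb1 & Hs).
destruct (Xv (starlike_extremal_factor b v m Hv0 Hbv Hb Hv Hb1)) as (w & Hw & Ew).
destruct (Xp Hp1) as (u & Hu & Eu).
assert (Eb := starlike_extremal b v w Hb0 Hv0 Hbv Ew).
assert (Euw : u = w).
{ apply unit_sum_extremal with (2 * INR (S m)) (INR (S (S m))); auto.
  - apply Rmult_lt_0_compat; [lra|apply lt_0_INR; lia].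
  - apply lt_0_INR; lia.
  (* With b_j = (j + 1) w^j and p_1 = 2 u, the unimodular factor w^m comes out on the left and drops
     from the norm. *)
  - replace (b m * p 1%nat + b (S m))%quat with
      (qpow w m * (qreal (2 * INR (S m)) * u + qreal (INR (S (S m))) * w))%quat in Hs.
    + rewrite qnormM, qnorm_pow, Hw, pow1, Rmult_1_l in Hs; exact Hs.
    + rewrite (Eb m), (Eb (S m)), (Eu 0%nat), (qpowS w m), (qpow_comm w m).
      change (qpow u 1) with (u * 1)%quat; rewrite qmul1r.
      generalize (qpow w m); quat_ring. }
subst w; exists u; split; auto; intros [|[|n]]; auto.
- rewrite Ha1; change (1 = qreal 1 * 1)%quat; quat_ring.
- apply (qreal_INR_cancel (S n)); rewrite <- Hbp, qconv_S by auto.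
  rewrite (geometric_conv b p u n n), (Eb (S n)) by auto.
  unfold koebe_coef, qshift; rewrite (S_INR (S n)).
  generalize (qpow u (S n)); quat_ring.
Qed.

(** * The regular reciprocal of 1 - q u and the Koebe function *)

Definition linear_coef (u : quat) (n : nat) : quat :=
  match n with O => 1%quat | S O => (- u)%quat | _ => 0%quat end.

Lemma linear_expansion (u : quat) : has_expansion (fun p => 1 - p * u)%quat (linear_coef u).
Proof.
assert (H := expansion_shift (fun _ => - u)%quat (linear_coef u)).
apply expansion_ext with (2 := H (expansion_coefs_ext _ _ _
  (fun n => match n with O => eq_refl | S _ => eq_refl end) (expansion_const (- u)))).
intros q _; unfold linear_coef; quat_ring.
Qed.

Lemma geometric_summable (u : quat) : qnorm u = 1 -> summable_on_ball (fun n => qpow u n).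
Proof.
intros Hu r Hr; apply ex_series_ext with (fun n => r ^ n).
- intros n; rewrite qnorm_pow, Hu, pow1; symmetry; apply Rmult_1_l.
- apply ex_series_geom; rewrite Rabs_pos_eq; lra.
Qed.

Lemma regular_conj_linear (u : quat) :
  has_expansion (regular_conj (fun p => 1 - p * u)%quat) (linear_coef (qconj u)) /\
  forall q, in_ball q -> regular_conj (fun p => 1 - p * u)%quat q = (1 - q * qconj u)%quat.
Proof.
assert (L := linear_expansion (qconj u)).
assert (E : forall q, in_ball q ->
  regular_conj (fun p => 1 - p * u)%quat q = (1 - q * qconj u)%quat).
{ intros q Hq; unfold regular_conj; rewrite (coefs_eq _ _ (linear_expansion u)).
  apply qseries_eq, is_qsum_ext with (2 := L q Hq).
  intros [|[|n]]; unfold linear_coef; f_equal; unfold qone, qzero, qreal; quat_ring. }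
split; auto; apply expansion_ext with (2 := L); intros; now rewrite E.
Qed.

(** At real x the symmetrization is |1 - x u|^2 = 1 - 2 Re(u) x + x^2, and real points determine the
    coefficients. *)
Lemma symmetrization_linear (u q : quat) : qnorm u = 1 -> in_ball q ->
  symmetrization (fun p => 1 - p * u)%quat q = (1 - qreal (2 * q_re u) * q + q * q)%quat.
Proof.
intros Hu Hq; unfold symmetrization, regular_mul.
rewrite (coefs_eq _ _ (linear_expansion u)), (coefs_eq _ _ (proj1 (regular_conj_linear u))).
change (qseries (qconv (linear_coef u) (linear_coef (qconj u))) q =
  (1 - qreal (2 * q_re u) * q + q * q)%quat).
set (c := fun n => match n with O => 1%quat | S O => qreal (- (2 * q_re u))
  | S (S O) => 1%quat | _ => 0%quat end).
assert (H1 : has_expansion (fun q => qreal (- (2 * q_re u)) + q * 1)%quat (fun n => c (S n))).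
{ apply (expansion_shift (fun _ => 1%quat) (fun n => c (S n))).
  apply expansion_coefs_ext with (2 := expansion_const 1); intros [|n]; reflexivity. }
apply expansion_shift in H1.
assert (Hc : forall n, qconv (linear_coef u) (linear_coef (qconj u)) n = c n).
{ apply (qseries_unique _ _ 1); [lra|]; intros x Hx; eexists; split.
  - apply conv_real; auto; apply linear_expansion.
  - generalize (H1 (qreal x) (real_in_ball x Hx)).
    match goal with |- is_qseries _ _ ?l -> is_qseries _ _ ?l' => replace l with l'; auto end.
    assert (K := qnorm_sq u); rewrite Hu in K; unfold qnorm2 in K.
    unfold c; apply quat_ext; unfold qreal, qone; simpl; try ring.
    transitivity (1 - 2 * q_re u * x + x * x * (q_re u ^ 2 + q_i u ^ 2 + q_j u ^ 2 + q_k u ^ 2));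
    [ring|rewrite <- K; ring]. }
apply qseries_eq.
apply (expansion_coefs_ext _ _ _ (fun n => eq_sym (Hc n))) in H1.
generalize (H1 q Hq).
match goal with |- is_qseries _ _ ?l -> is_qseries _ _ ?l' => replace l with l'; auto end.
unfold c; quat_ring.
Qed.

(** The sum G of the geometric series satisfies G = 1 + q G u, with [u] on the right. Evaluating q^2
    G u^2 once by iterating this relation and once by u^2 = 2 Re(u) u - 1 eliminates [u] from the
    right and yields s G = 1 - q conj(u), where s is the symmetrization; s <> 0 because |q conj(u)|
    < 1. *)
Lemma regular_inv_linear (u : quat) : qnorm u = 1 ->
  has_expansion (regular_inv (fun p => 1 - p * u)%quat) (fun n => qpow u n).
Proof.
intros Hu; set (G := qseries (fun n => qpow u n)).
assert (HG : has_expansion G (fun n => qpow u n))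
  by now apply summable_expansion, geometric_summable.
apply expansion_ext with (2 := HG); intros q Hq; unfold regular_inv.
rewrite symmetrization_linear, (proj2 (regular_conj_linear u)) by auto.
assert (E : G q = (1 + q * (G q * u))%quat).
{ refine (expansion_fun_unique G (fun q => qpow u 0 + q * (G q * u))%quat _ q HG _ Hq).
  apply (expansion_shift (fun q => G q * u)%quat (fun n => qpow u n)).
  apply expansion_coefs_ext with (2 := expansion_mul_r G _ u HG); intros n.
  rewrite qpowS; symmetry; apply qpow_comm. }
set (g := G q) in *; clearbody g.
assert (K := qnorm_sq u); rewrite Hu in K.
assert (Eu : (u * u)%quat = (qreal (2 * q_re u) * u - 1)%quat).
{ unfold qnorm2 in K; apply quat_ext; unfold qreal, qone; simpl; try ring; lra. }
assert (E' : (q * g * u)%quat = (g - 1)%quat).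
{ transitivity (1 + q * (g * u) - 1)%quat; [|now rewrite <- E].
  rewrite (qmulA q g u); generalize (q * g * u)%quat; quat_ring. }
assert (E1 : (q * q * g * (u * u))%quat = (g - 1 - q * u)%quat).
{ transitivity (q * (q * g * u) * u)%quat; [qdistr|rewrite E'].
  transitivity (q * g * u - q * u)%quat; [quat_ring|now rewrite E']. }
assert (E2 : (q * q * g * (u * u))%quat =
  (qreal (2 * q_re u) * (q * (g - 1)) - q * q * g)%quat).
{ rewrite Eu, <- E'; generalize (2 * q_re u); quat_ring. }
set (s := (1 - qreal (2 * q_re u) * q + q * q)%quat).
assert (Es : (s * g)%quat = (1 - q * qconj u)%quat).
{ unfold s; apply qsub_eq0.
  transitivity ((g - 1 - q * u) - (qreal (2 * q_re u) * (q * (g - 1)) - q * q * g))%quat;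
  [|rewrite <- E1, <- E2; apply qaddN].
  clear; apply quat_ext; unfold qreal, qone; simpl; ring. }
assert (Hs : s <> 0%quat).
{ intros H0; rewrite H0 in Es.
  assert (E0 : (1 - q * qconj u)%quat = 0%quat) by (rewrite <- Es; quat_ring).
  apply qsub_eq0, (f_equal qnorm) in E0; rewrite qnorm_1, qnormM, qnorm_conj, Hu in E0.
  unfold in_ball in Hq; lra. }
now rewrite <- Es, qmulA, qmulVl, qmul1l.
Qed.

(** Convolving the powers of [u] with themselves gives n + 1 equal terms in degree n; the outer
    factor [q] shifts the index. *)
Lemma koebe_expansion (u : quat) : qnorm u = 1 ->
  has_expansion (fun q => q * regular_mul (regular_inv (fun p => 1 - p * u))
    (regular_inv (fun p => 1 - p * u)) q)%quat (koebe_coef u).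
Proof.
intros Hu; apply expansion_mul_q; unfold regular_mul.
rewrite (coefs_eq _ _ (regular_inv_linear u Hu)).
assert (E : forall n, qconv (fun n => qpow u n) (fun n => qpow u n) n =
  (qreal (INR (S n)) * qpow u n)%quat).
{ intros n; unfold qconv.
  rewrite (sum_n_ext_loc _ (fun _ => qpow u n)).
  - generalize (qpow u n) as p; intros p; induction n as [|n IH].
    + rewrite sum_O; simpl INR; quat_ring.
    + rewrite sum_Sn, IH, (S_INR (S n)); generalize (INR (S n)); clear; intros x.
      change (qreal x * p + p = qreal (x + 1) * p)%quat; quat_ring.
  - intros k Hk; rewrite <- qpow_add; f_equal; lia. }
apply (expansion_coefs_ext _ _ _ E).
apply expansion_conv; now apply geometric_summable.
Qed.

Theorem theorem4p3 (f : quat -> quat) (a : nat -> quat)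
  (f_ctc : slice_close_to_convex f)
  (a0 : a 0%nat = 0%quat) (a1 : a 1%nat = 1%quat)
  (f_exp : has_expansion f a) :
  forall n : nat, (2 <= n)%nat ->
    qnorm (a n) <= INR n /\
    (qnorm (a n) = INR n <->
     exists u : quat, qnorm u = 1 /\
       forall q, in_ball q ->
         f q =
         (q * regular_mul (regular_inv (fun p => 1 - p * u))
                          (regular_inv (fun p => 1 - p * u)) q)%quat).
Proof.
intros n Hn; destruct n as [|[|m]]; [lia|lia|]; clear Hn.
destruct f_ctc as (_ & h & [h_norm h_star] & f_pos).
destruct (slice_regular_expansion h (proj1 h_norm)) as [hc h_exp].
destruct (positive_quotient f h a hc f_exp a1 h_exp h_norm f_pos)
  as (hc1 & P & p & HP & Hp0 & Hbp & Ppos).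
(* Starlikeness of [h] is the same positivity condition with f = h; the normalization of its
   coefficient of order 1 comes from the previous application. *)
destruct (positive_quotient h h hc hc h_exp hc1 h_exp h_norm h_star)
  as (_ & V & v & HV & Hv0 & Hbv & Vpos).
set (b := fun n => hc (S n)) in *; unfold dcoef in Hbp, Hbv.
assert (Hp : forall j, qnorm (p (S j)) <= 2) by (intros; now apply caratheodory with P).
assert (Hv : forall j, qnorm (v (S j)) <= 2) by (intros; now apply caratheodory with V).
assert (Hb := starlike_bound b v hc1 Hv0 Hbv Hv).
split; [now apply (close_to_convex_bound b p _ m)|split].
- intros HA.
  destruct (extremal_coefs b v p a m hc1 Hv0 Hp0 a0 a1 Hbv Hbp Hv Hp
    (caratheodory_eq V v HV Hv0 Vpos) (caratheodory_eq P p HP Hp0 Ppos) HA) as (u & Hu & E).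
  exists u; split; auto; intros q Hq.
  exact (is_qsum_unique _ _ _ (expansion_coefs_ext _ _ _ E f_exp q Hq)
    (koebe_expansion u Hu q Hq)).
- intros (u & Hu & Ef).
  (* Conversely, uniqueness of the expansion identifies [a] with the Koebe coefficients, whose norms
     are known. *)
  rewrite <- (koebe_coef_norm u (S (S m)) Hu); f_equal.
  apply (expansion_unique f); auto.
  apply expansion_ext with (2 := koebe_expansion u Hu); intros; now rewrite Ef.
Qed.
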